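(* Let $\alpha\in\mathbb{R}$. Suppose that there is a constant $C$ such that for all sufficiently large $N$ and all $f\in L^2(\mathbb{R}^2)$ with $\hat f$ supported in $A(1)$, $$\Big\|\sup_{0\le t\le N}|e^{it\Delta}f|\Big\|_{L^2_x(B(0,N))}\le C N^{\alpha}\|f\|_2 .$$ Then there is a constant $C'$ such that for all sufficiently large $N$, all sufficiently large $\lambda$ and all $f\in L^2(\mathbb{R}^2)$ with $\hat f$ supported in $A(1)$, $$\Big\|\sup_{0\le t\le N^2}|e^{it\Delta}f|\Big\|_{L^2_x(B(0,N))}\le C' N^{\alpha}\|f\|_2$$ and $$\Big\|\sup_{0\le t\le N}|e^{it\Delta}f|\Big\|_{L^2_x(B(0,\lambda N))}\le C' N^{\alpha}\|f\|_2 .$$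
   Context: The spatial dimension is $2$. The Schrödinger evolution is $e^{it\Delta}f(x):=\int_{\mathbb{R}^2}e^{ix\cdot\xi+it|\xi|^2}\hat f(\xi)\,d\xi$, where the Fourier transform $\hat f$ is normalized so that $f(x)=\int_{\mathbb{R}^2} e^{ix\cdot\xi}\hat f(\xi)\,d\xi$. The annulus is $A(1):=\{\xi\in\mathbb{R}^2: 1/2\le|\xi|\le 1\}$, and $B(x_0,r)$ is the ball in $\mathbb{R}^2$ with center $x_0$ and radius $r$. *)

(* Defs.v *)
From HB Require Import structures.
From mathcomp Require Import all_boot all_order all_algebra.
From mathcomp Require Import complex.
From mathcomp Require Import all_classical all_reals all_analysis.

Set Implicit Arguments.
Unset Strict Implicit.
Unset Printing Implicit Defensive.
Import Order.TTheory GRing.Theory Num.Theory.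
Import numFieldNormedType.Exports.

Local Open Scope classical_set_scope.
Local Open Scope ring_scope.

Section schrodinger.
Context {R : realType}.

(* R^2 is the product R * R with its product sigma-algebra. *)
Local Notation R2 := (R * R)%type.

Local Notation leb2 := (@lebesgue_measure R \x @lebesgue_measure R)%E.

Definition dot2 (x y : R2) : R := x.1 * y.1 + x.2 * y.2.

(* The norm carried by the product type R * R is the sup norm. *)
Definition enorm2 (x : R2) : R := Num.sqrt (dot2 x x).

Definition eball2 (x0 : R2) (r : R) : set R2 :=
  [set x | enorm2 (x - x0) < r].

Definition annulus1 : set R2 := [set xi | 2^-1 <= enorm2 xi <= 1].

Definition cis (theta : R) : R[i] := Complex (cos theta) (sin theta).

(* The norm `|z| of R[i] takes its values in R[i]. *)
Definition cmod (z : R[i]) : R := complex.Re `|z|.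

Definition cintegral (D : set R2) (f : R2 -> R[i]) : R[i] :=
  Complex (\int[leb2]_(x in D) complex.Re (f x))%R
          (\int[leb2]_(x in D) complex.Im (f x))%R.

Definition L2norm (f : R2 -> R[i]) : \bar R :=
  'N[leb2]_2%:E [(fun x => (cmod (f x))%:E)]%E.

Definition inL2 (f : R2 -> R[i]) : Prop :=
  [/\ measurable_fun setT (fun x => complex.Re (f x)),
      measurable_fun setT (fun x => complex.Im (f x)) &
      (L2norm f < +oo)%E].

(* g is the Fourier transform of f, normalized by
   f(x) = \int e^{i x . xi} g(xi) d xi. For general f in L^2 this inversion
   formula holds in the sense of L^2 convergence of the integrals over the
   balls B(0, r) as r tends to infinity. It determines g almost everywhere. *)
Definition fourier_transform_of (f g : R2 -> R[i]) : Prop :=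
  [/\ inL2 f, inL2 g &
      L2norm (fun x =>
        f x - cintegral (eball2 0 r) (fun xi => cis (dot2 x xi) * g xi))
      @[r --> +oo] --> 0%E].

(* The essential support is contained in the closed set A. *)
Definition ae_supported (A : set R2) (g : R2 -> R[i]) : Prop :=
  {ae leb2, forall xi, ~ A xi -> g xi = 0}.

(* e^{it Delta} f (x), as a function of the Fourier transform of f. *)
Definition schrodinger (fhat : R2 -> R[i]) (t : R) (x : R2) : R[i] :=
  cintegral setT
    (fun xi => cis (dot2 x xi + t * enorm2 xi ^+ 2) * fhat xi).

Definition schrodinger_max (fhat : R2 -> R[i]) (T : R) (x : R2) : \bar R :=
  ereal_sup [set (cmod (schrodinger fhat t x))%:E | t in `[0, T]].

(* || sup_{0 <= t <= T} |e^{it Delta} f| ||_{L^2(B(0, r))} <= K ||f||_2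
   for all f in L^2 with Fourier transform supported in A(1). *)
Definition maximal_estimate (T r K : R) : Prop :=
  forall f fhat : R2 -> R[i],
    fourier_transform_of f fhat -> ae_supported annulus1 fhat ->
    ('N[leb2]_2%:E [schrodinger_max fhat T \_ (eball2 0%R r)]
       <= K%:E * L2norm f)%E.

End schrodinger.

(* Main.v *)
Require Import Defs.
From HB Require Import structures.
From mathcomp Require Import all_boot all_order all_algebra.
From mathcomp Require Import complex.
From mathcomp Require Import all_classical all_reals all_analysis.
From mathcomp Require Import measurable_realfun ring lra.
Set Implicit Arguments.
Unset Strict Implicit.
Unset Printing Implicit Defensive.
Import Order.TTheory GRing.Theory Num.Theory.
Import numFieldNormedType.Exports.
Local Open Scope classical_set_scope.
Local Open Scope ring_scope.

(** Write [g] for the Fourier transform of the datum; it is supported in the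
    annulus [A(1)], and modulating it by [cis (t * |xi|^2)], respectively by
    [cis (x0 . xi)], translates the evolution by [t] in time, respectively by
    [x0] in space. The interval [0, N^2] is a union of about [N] intervals of
    length [N], and the ball [B(0, lambda N)] is covered by translates of
    [B(0, N)], so both conclusions follow once the hypothesis is strengthened
    to a bound for a sum: for the modulations [q_j] occurring here,

      \sum_j || sup_{0 <= t <= N} |u_j| ||^2_{L^2(B(0,N))} <= C K ||g||^2,

    where [u_j] is the evolution of [cis q_j * g], [K] is the square of the
    constant in the hypothesis, and [C] depends neither on [N] nor on the
    number of modulations ([annulus_transfers]). Physically: on [B(0,N)] and
    [0, N] the datum only matters through wave packets that meet this region,
    and a wave packet meets a bounded number of the translated regions, since
    it moves with a speed between two positive constants.

    The proof of this sum makes no wave packet decomposition. On the scale [N]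
    of the ball, the function [cis (x . xi)] of [xi] is almost constant on a
    box of side [1/N]. So fix a box [B] with side about [1/N] and consider

      \int \int cis (x . zeta + t |xi|^2) 1_B(zeta - xi) g(xi) dxi dzeta.

    Integrating in [zeta] first gives the evolution of [g] times the Fourier
    transform of [1_B] at [x], which is bounded below on [B(0,N)]
    ([window_schrodinger], [window_transform_ge]). On the other hand [|xi|^2]
    is within [O(1/N)] of [|zeta|^2], so that expanding [cis (t (|xi|^2 -
    |zeta|^2))] into its exponential series writes the same integral as
    \sum_m (t/N)^m times the evolution at time [t] of a function [layer m g]
    of [zeta], whose value at [zeta] is an integral of [g] over the box
    [zeta - B], with a weight of size [2^-m]. The [t]-dependence is in the
    scalar (t/N)^m <= 1, so the hypothesis applies to each layer separately
    ([sup_sqm_layers]).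

    In the layers the modulations are tested on one box at a time, and there
    they are orthogonal up to a constant. The frequencies [N k], [k] in Z^2,
    are orthogonal on a square of side [2 pi / N] containing the box. The
    functions [cis (l N |xi|^2)], [l] in Z, are orthogonal for the weight
    [|xi_i|] over an interval on which [xi_i^2] increases by [2 pi / N]; this
    is where [|xi|] must stay away from zero, and [i] is a coordinate with
    [|xi_i| >= 1/4]. Bessel's inequality [bessel] then gives
    \sum_j |layer m (cis q_j * g) (zeta)|^2 <= M 4^-m \int_{zeta - B} |g|^2,
    and integrating in [zeta] gives [layer_bessel]. Summing the layers against
    the weights [2^(m+1)] coming from Cauchy-Schwarz leaves a convergent
    geometric series ([localized_transference]).

    The function [layer m g] has to live in the annulus again, since the
    hypothesis says nothing outside it. This forces [B] to point inwards for
    frequencies near the outer circle and outwards near the inner one, and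
    the annulus is accordingly cut into eight pieces, each with its own box
    ([piece_shift], [transfers_union]).

    The hypothesis and the conclusion involve the L^2 norm of the datum and
    the proof that of its Fourier transform. They are comparable by
    Plancherel's theorem, which is proved here up to constants, as two
    inequalities ([fourier2_upper], [fourier2_lower]), through Abel means and
    the Poisson kernel. *)

(** * Complex numbers in real coordinates *)

Section complex_basics.
Context {R : realType}.
Implicit Types z w : R[i].

(** The square of the modulus, as a real number: it is polynomial in the
    coordinates, so squared estimates need no square root. *)
Definition sqm z : R := complex.Re z ^+ 2 + complex.Im z ^+ 2.

Lemma ReM z w :
  complex.Re (z * w) = complex.Re z * complex.Re w - complex.Im z * complex.Im w.
Proof. by case: z w => a b [c d]. Qed.

Lemma ImM z w :
  complex.Im (z * w) = complex.Re z * complex.Im w + complex.Im z * complex.Re w.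
Proof. by case: z w => a b [c d]. Qed.

Lemma ReD z w : complex.Re (z + w) = complex.Re z + complex.Re w.
Proof. by case: z w => a b [c d]. Qed.

Lemma ImD z w : complex.Im (z + w) = complex.Im z + complex.Im w.
Proof. by case: z w => a b [c d]. Qed.

Lemma ReN z : complex.Re (- z) = - complex.Re z.
Proof. by case: z. Qed.

Lemma ImN z : complex.Im (- z) = - complex.Im z.
Proof. by case: z. Qed.

Lemma Re_sum I (r : seq I) (F : I -> R[i]) :
  complex.Re (\sum_(i <- r) F i) = \sum_(i <- r) complex.Re (F i).
Proof. by elim/big_rec2: _ => //= i x y _ <-; rewrite ReD. Qed.

Lemma Im_sum I (r : seq I) (F : I -> R[i]) :
  complex.Im (\sum_(i <- r) F i) = \sum_(i <- r) complex.Im (F i).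
Proof. by elim/big_rec2: _ => //= i x y _ <-; rewrite ImD. Qed.

Lemma complex_ext z w : complex.Re z = complex.Re w ->
  complex.Im z = complex.Im w -> z = w.
Proof. by case: z w => a b [c d] /= -> ->. Qed.

Lemma sqm_ge0 z : 0 <= sqm z.
Proof. by rewrite addr_ge0// sqr_ge0. Qed.

Lemma sqmM z w : sqm (z * w) = sqm z * sqm w.
Proof. by rewrite /sqm ReM ImM; ring. Qed.

Lemma sqm0 : sqm 0 = 0.
Proof. by rewrite /sqm /= expr0n addr0. Qed.

Lemma sqm_eq0 z : sqm z = 0 -> z = 0.
Proof.
move/eqP; rewrite paddr_eq0 ?sqr_ge0// !sqrf_eq0 => /andP[/eqP a /eqP b].
exact: complex_ext.
Qed.

Lemma sqm_real (x : R) : sqm (x%:C)%C = x ^+ 2.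
Proof. by rewrite /sqm /= expr0n addr0. Qed.

Lemma sqmD_le z w : sqm (z + w) <= 2 * sqm z + 2 * sqm w.
Proof.
rewrite /sqm ReD ImD.
have := sqr_ge0 (complex.Re z - complex.Re w).
have := sqr_ge0 (complex.Im z - complex.Im w).
by nra.
Qed.

Lemma cmodE z : cmod z = Num.sqrt (sqm z).
Proof. by case: z. Qed.

Lemma cmod_ge0 z : 0 <= cmod z.
Proof. by rewrite cmodE sqrtr_ge0. Qed.

Lemma cmod_sqr z : cmod z ^+ 2 = sqm z.
Proof. by rewrite cmodE sqr_sqrtr// sqm_ge0. Qed.

Lemma cmodM z w : cmod (z * w) = cmod z * cmod w.
Proof. by rewrite !cmodE sqmM sqrtrM// sqm_ge0. Qed.

Lemma cmod0 : cmod (0 : R[i]) = 0.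
Proof. by rewrite cmodE sqm0 sqrtr0. Qed.

Lemma cmod_real (x : R) : 0 <= x -> cmod (x%:C)%C = x.
Proof. by move=> x0; rewrite cmodE sqm_real sqrtr_sqr ger0_norm. Qed.

Lemma cmod_le z (x : R) : 0 <= x -> sqm z <= x ^+ 2 -> cmod z <= x.
Proof. by move=> x0 h; rewrite -(ler_pXn2r (ltn0Sn 1)) ?nnegrE ?cmod_ge0// cmod_sqr. Qed.

Lemma sqm_le z (x : R) : cmod z <= x -> sqm z <= x ^+ 2.
Proof.
move=> h; rewrite -cmod_sqr ler_pXn2r// ?nnegrE ?cmod_ge0//.
exact: le_trans (cmod_ge0 _) h.
Qed.

Lemma normRe_le z : `|complex.Re z| <= cmod z.
Proof.
rewrite -(ler_pXn2r (ltn0Sn 1)) ?nnegrE ?cmod_ge0// cmod_sqr real_normK ?num_real//.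
by rewrite lerDl sqr_ge0.
Qed.

Lemma normIm_le z : `|complex.Im z| <= cmod z.
Proof.
rewrite -(ler_pXn2r (ltn0Sn 1)) ?nnegrE ?cmod_ge0// cmod_sqr real_normK ?num_real//.
by rewrite lerDr sqr_ge0.
Qed.

Lemma cmod_le_ReIm z : cmod z <= `|complex.Re z| + `|complex.Im z|.
Proof.
apply: cmod_le; first by rewrite addr_ge0.
rewrite /sqm -(real_normK (num_real (complex.Re z))) -(real_normK (num_real (complex.Im z))).
have := mulr_ge0 (normr_ge0 (complex.Re z)) (normr_ge0 (complex.Im z)); nra.
Qed.

Lemma cmodD_le z w : cmod (z + w) <= cmod z + cmod w.
Proof.
apply: cmod_le; first by rewrite addr_ge0 ?cmod_ge0.
rewrite sqrrD !cmod_sqr -cmodM.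
have -> : sqm (z + w) = sqm z + sqm w +
   (complex.Re (z * (w^*)%C)) *+ 2 by rewrite /sqm ReD ImD; case: z w => a b [c d] /=; ring.
have -> : cmod (z * w) = cmod (z * (w^*)%C).
  by rewrite !cmodE !sqmM; congr (Num.sqrt (_ * _)); case: (w) => c d; rewrite /sqm/= sqrrN.
rewrite [leRHS]addrAC lerD2l lerMn2r/=.
by rewrite (le_trans (ler_norm _)) ?normRe_le.
Qed.

Lemma cisD (a b : R) : cis (a + b) = cis a * cis b.
Proof. by apply: complex_ext; rewrite ?ReM ?ImM /= ?cosD ?sinD//; ring. Qed.

Lemma cis0 : cis (0 : R) = 1.
Proof. by rewrite /cis cos0 sin0. Qed.

Lemma sqm_cis (a : R) : sqm (cis a) = 1.
Proof. by rewrite /sqm /= cos2Dsin2. Qed.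

Lemma cmod_cis (a : R) : cmod (cis a) = 1.
Proof. by rewrite cmodE sqm_cis sqrtr1. Qed.

Lemma sqm_cisM (a : R) z : sqm (cis a * z) = sqm z.
Proof. by rewrite sqmM sqm_cis mul1r. Qed.

End complex_basics.

(** * Integrals of complex-valued functions *)

Section complex_integral.
Context {R : realType} d (T : measurableType d).
Implicit Types (f g : T -> R[i]).

Definition cmeas f := measurable_fun setT (fun x => complex.Re (f x)) /\
  measurable_fun setT (fun x => complex.Im (f x)).

Lemma cmeasD f g : cmeas f -> cmeas g -> cmeas (fun x => f x + g x).
Proof.
move=> [f1 f2] [g1 g2]; split.
  by under eq_fun do rewrite ReD; exact: measurable_funD.
by under eq_fun do rewrite ImD; exact: measurable_funD.
Qed.

Lemma cmeasM f g : cmeas f -> cmeas g -> cmeas (fun x => f x * g x).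
Proof.
move=> [f1 f2] [g1 g2]; split.
  under eq_fun do rewrite ReM.
  by apply: measurable_funB; exact: measurable_funM.
under eq_fun do rewrite ImM.
by apply: measurable_funD; exact: measurable_funM.
Qed.

Lemma cmeas_cst (c : R[i]) : cmeas (fun=> c).
Proof. by split; exact: measurable_cst. Qed.

Lemma cmeas_real (h : T -> R) : measurable_fun setT h -> cmeas (fun x => (h x)%:C%C).
Proof. by move=> mh; split => //=; exact: measurable_cst. Qed.

Lemma cmeas_cis (h : T -> R) : measurable_fun setT h -> cmeas (fun x => cis (h x)).
Proof.
move=> mh; split => /=; apply: measurableT_comp => //;
apply: continuous_measurable_fun; [exact: continuous_cos|exact: continuous_sin].
Qed.

Lemma cmeas_sum I (r : seq I) (F : I -> T -> R[i]) :
  (forall i, cmeas (F i)) -> cmeas (fun x => \sum_(i <- r) F i x).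
Proof.
move=> mF; split.
  by under eq_fun do rewrite Re_sum; apply: measurable_sum => i; case: (mF i).
by under eq_fun do rewrite Im_sum; apply: measurable_sum => i; case: (mF i).
Qed.

Lemma measurable_sqm f : cmeas f -> measurable_fun setT (fun x => sqm (f x)).
Proof. by move=> [f1 f2]; apply: measurable_funD; exact: measurable_funX. Qed.

Lemma measurable_cmod f : cmeas f -> measurable_fun setT (fun x => cmod (f x)).
Proof.
move=> mf; under eq_fun do rewrite cmodE.
apply: measurableT_comp (measurable_sqm mf) => //.
by apply: continuous_measurable_fun; exact: sqrt_continuous.
Qed.

Variable mu : {measure set T -> \bar R}.

Definition cintegrable f := cmeas f /\ mu.-integrable setT (fun x => (cmod (f x))%:E).

Definition cint f : R[i] := Complex (\int[mu]_x complex.Re (f x)) (\int[mu]_x complex.Im (f x)).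

Lemma cintegrable_Re f : cintegrable f -> mu.-integrable setT (EFin \o (fun x => complex.Re (f x))).
Proof.
move=> [[f1 f2] fi]; apply: le_integrable fi => //; first exact/measurable_EFinP.
by move=> x _ /=; rewrite lee_fin [leRHS]ger0_norm ?cmod_ge0// normRe_le.
Qed.

Lemma cintegrable_Im f : cintegrable f -> mu.-integrable setT (EFin \o (fun x => complex.Im (f x))).
Proof.
move=> [[f1 f2] fi]; apply: le_integrable fi => //; first exact/measurable_EFinP.
by move=> x _ /=; rewrite lee_fin [leRHS]ger0_norm ?cmod_ge0// normIm_le.
Qed.

Lemma cintegrable_le f (g : T -> R) : cmeas f -> mu.-integrable setT (EFin \o g) ->
  (forall x, cmod (f x) <= g x) -> cintegrable f.
Proof.
move=> mf gi fg; split => //; apply: le_integrable gi => //.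
  by apply/measurable_EFinP; exact: measurable_cmod.
move=> x _ /=; rewrite lee_fin ger0_norm ?cmod_ge0//.
exact: le_trans (fg x) (ler_norm _).
Qed.

Lemma cintegrableD f g : cintegrable f -> cintegrable g -> cintegrable (fun x => f x + g x).
Proof.
move=> [mf fi] [mg gi].
apply: (cintegrable_le (g := fun x => cmod (f x) + cmod (g x))).
- exact: cmeasD.
- by have := integrableD measurableT fi gi.
- by move=> x; exact: cmodD_le.
Qed.

Lemma cintegrableM (C : R) f g : cmeas f -> (forall x, cmod (f x) <= C) -> cintegrable g ->
  cintegrable (fun x => f x * g x).
Proof.
move=> mf fC [mg gi]; apply: (cintegrable_le (g := fun x => C * cmod (g x))).
- exact: cmeasM.
- by have := integrableZl measurableT C gi.
- by move=> x; rewrite cmodM ler_wpM2r ?cmod_ge0.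
Qed.

Lemma cintegrableZ (c : R[i]) f : cintegrable f -> cintegrable (fun x => c * f x).
Proof. by apply: (cintegrableM (C := cmod c)) => //; exact: cmeas_cst. Qed.

Lemma cintegrable0 : cintegrable (fun=> 0).
Proof.
split; first exact: cmeas_cst.
by under eq_fun do rewrite cmod0; exact: integrable0.
Qed.

Lemma cintegrable_sum I (r : seq I) (F : I -> T -> R[i]) :
  (forall i, cintegrable (F i)) -> cintegrable (fun x => \sum_(i <- r) F i x).
Proof.
move=> Fi; elim: r => [|i r ih].
  by under eq_fun do rewrite big_nil; exact: cintegrable0.
by under eq_fun do rewrite big_cons; exact: cintegrableD.
Qed.

Lemma cintD f g : cintegrable f -> cintegrable g ->
  cint (fun x => f x + g x) = cint f + cint g.
Proof.
move=> fi gi; apply: complex_ext; rewrite ?ReD ?ImD /=.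
  under eq_Rintegral do rewrite ReD.
  by rewrite RintegralD//; exact: cintegrable_Re.
under eq_Rintegral do rewrite ImD.
by rewrite RintegralD//; exact: cintegrable_Im.
Qed.

Lemma cintZ (c : R[i]) f : cintegrable f -> cint (fun x => c * f x) = c * cint f.
Proof.
move=> fi; apply: complex_ext; rewrite ?ReM ?ImM /=.
  under eq_Rintegral do rewrite ReM.
  rewrite RintegralB//=.
  - by rewrite !RintegralZl//; [exact: cintegrable_Im|exact: cintegrable_Re].
  - by have := integrableZl measurableT (complex.Re c) (cintegrable_Re fi).
  - by have := integrableZl measurableT (complex.Im c) (cintegrable_Im fi).
under eq_Rintegral do rewrite ImM.
rewrite RintegralD//=.
- by rewrite !RintegralZl//; [exact: cintegrable_Re|exact: cintegrable_Im].
- by have := integrableZl measurableT (complex.Re c) (cintegrable_Im fi).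
- by have := integrableZl measurableT (complex.Im c) (cintegrable_Re fi).
Qed.

Lemma eq_cint f g : f =1 g -> cint f = cint g.
Proof. by move=> /funext ->. Qed.

Lemma cint0 : cint (fun=> 0) = 0.
Proof. by apply: complex_ext => /=; rewrite Rintegral_cst// mul0r. Qed.

Lemma cint_sum I (r : seq I) (F : I -> T -> R[i]) :
  (forall i, cintegrable (F i)) ->
  cint (fun x => \sum_(i <- r) F i x) = \sum_(i <- r) cint (F i).
Proof.
move=> Fi; elim: r => [|i r ih].
  by rewrite big_nil; under eq_fun do rewrite big_nil; exact: cint0.
rewrite big_cons; under eq_fun do rewrite big_cons.
by rewrite cintD// ?ih//; exact: cintegrable_sum.
Qed.

Lemma ae_eq_cint f g : cmeas f -> cmeas g ->
  {ae mu, forall x, f x = g x} -> cint f = cint g.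
Proof.
move=> [f1 f2] [g1 g2] fg; apply: complex_ext => /=; congr fine;
  apply: ae_eq_integral => //; try exact/measurable_EFinP;
  by apply: filterS fg => x fgx _; rewrite fgx.
Qed.

Lemma cvg_Rintegral (F : nat -> T -> R) (f g : T -> R) :
  (forall n, measurable_fun setT (F n)) -> measurable_fun setT f ->
  mu.-integrable setT (EFin \o g) -> (forall n x, `|F n x| <= g x) ->
  {ae mu, forall x, F n x @[n --> \oo] --> f x} ->
  (\int[mu]_x F n x)%R @[n --> \oo] --> (\int[mu]_x f x)%R.
Proof.
move=> mF mf gi Fg cF.
have [] := @dominated_convergence _ _ _ mu setT measurableT
    (fun n x => (F n x)%:E) (fun x => (f x)%:E) (EFin \o g) _ _ _ gi _.
- by move=> n; apply/measurable_EFinP.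
- exact/measurable_EFinP.
- by apply: filterS cF => x cx _; apply: cvg_EFin => //; exact: nearW.
- by apply: aeW => x n _; rewrite /= lee_fin.
move=> fi _ cv; apply: fine_cvg; rewrite fineK//.
exact: integrable_fin_num fi.
Qed.

Lemma cvg_cint (F : nat -> T -> R[i]) f (g : T -> R) : (forall n, cmeas (F n)) -> cmeas f ->
  mu.-integrable setT (EFin \o g) -> (forall n x, cmod (F n x) <= g x) ->
  (forall x, complex.Re (F n x) @[n --> \oo] --> complex.Re (f x)) ->
  (forall x, complex.Im (F n x) @[n --> \oo] --> complex.Im (f x)) ->
  complex.Re (cint (F n)) @[n --> \oo] --> complex.Re (cint f) /\
  complex.Im (cint (F n)) @[n --> \oo] --> complex.Im (cint f).
Proof.
move=> mF [f1 f2] gi Fg cR cI; split => /=; apply: (cvg_Rintegral _ _ gi) => //.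
- by move=> n; case: (mF n).
- by move=> n x; exact: le_trans (normRe_le _) (Fg n x).
- exact: aeW.
- by move=> n; case: (mF n).
- by move=> n x; exact: le_trans (normIm_le _) (Fg n x).
- exact: aeW.
Qed.

End complex_integral.

(** * Fubini's theorem for complex-valued functions *)

Section parametrized_integrals.
Context {R : realType} d1 d2 (T1 : measurableType d1) (T2 : measurableType d2).
Variable m1 : {sigma_finite_measure set T1 -> \bar R}.
Variable m2 : {sigma_finite_measure set T2 -> \bar R}.

Lemma measurable_Rintegral_fst (f : T1 * T2 -> R) : measurable_fun setT f ->
  measurable_fun setT (fun x => (\int[m2]_y f (x, y))%R).
Proof.
move=> mf; apply: (@measurableT_comp _ _ _ _ _ _ fine) => //.
under eq_fun do rewrite integralE.
have mEf : measurable_fun setT (EFin \o f) by exact/measurable_EFinP.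
apply: emeasurable_funB.
- under eq_fun do under eq_integral do rewrite (funepos_comp (EFin \o f) (pair _)).
  by apply: (measurable_fun_fubini_tonelli_F (EFin \o f)^\+%E) => //; exact: measurable_funepos.
- under eq_fun do under eq_integral do rewrite (funeneg_comp (EFin \o f) (pair _)).
  by apply: (measurable_fun_fubini_tonelli_F (EFin \o f)^\-%E) => //; exact: measurable_funeneg.
Qed.

Lemma measurable_Rintegral_snd (f : T1 * T2 -> R) : measurable_fun setT f ->
  measurable_fun setT (fun y => (\int[m1]_x f (x, y))%R).
Proof.
move=> mf; apply: (@measurableT_comp _ _ _ _ _ _ fine) => //.
under eq_fun do rewrite integralE.
have mEf : measurable_fun setT (EFin \o f) by exact/measurable_EFinP.
apply: emeasurable_funB.
- under eq_fun do under eq_integral do rewrite (funepos_comp (EFin \o f) (pair^~ _)).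
  by apply: (measurable_fun_fubini_tonelli_G (EFin \o f)^\+%E) => //; exact: measurable_funepos.
- under eq_fun do under eq_integral do rewrite (funeneg_comp (EFin \o f) (pair^~ _)).
  by apply: (measurable_fun_fubini_tonelli_G (EFin \o f)^\-%E) => //; exact: measurable_funeneg.
Qed.

Lemma cmeas_cint_fst (f : T1 * T2 -> R[i]) : cmeas f ->
  cmeas (fun x => cint m2 (fun y => f (x, y))).
Proof.
move=> [f1 f2]; split => /=.
  exact: (measurable_Rintegral_fst f1).
exact: (measurable_Rintegral_fst f2).
Qed.

Lemma Rintegral12 (f : T1 * T2 -> R) : (m1 \x m2)%E.-integrable setT (EFin \o f) ->
  (\int[m1]_x \int[m2]_y f (x, y) = \int[(m1 \x m2)%E]_z f z)%R.
Proof.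
move=> fi; have mf : measurable_fun setT f by apply/measurable_EFinP; exact: measurable_int fi.
rewrite /Rintegral -(integral12_prod_meas1 fi); congr fine.
apply: ae_eq_integral => //.
- by apply/measurable_EFinP; exact: measurable_Rintegral_fst mf.
- exact: measurable_int (integrable_fubini_F fi).
- apply: filterS (ae_integrable1 fi) => x xi _; rewrite /= fineK//.
  exact: integrable_fin_num xi.
Qed.

Lemma Rintegral21 (f : T1 * T2 -> R) : (m1 \x m2)%E.-integrable setT (EFin \o f) ->
  (\int[m2]_y \int[m1]_x f (x, y) = \int[(m1 \x m2)%E]_z f z)%R.
Proof.
move=> fi; have mf : measurable_fun setT f by apply/measurable_EFinP; exact: measurable_int fi.
rewrite /Rintegral -(integral21_prod_meas1 fi); congr fine.
apply: ae_eq_integral => //.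
- by apply/measurable_EFinP; exact: measurable_Rintegral_snd mf.
- exact: measurable_fubini_G fi.
- apply: filterS (ae_integrable2 fi) => x xi _; rewrite /= fineK//.
  exact: integrable_fin_num xi.
Qed.

Lemma Rintegral_swap (f : T1 * T2 -> R) : (m1 \x m2)%E.-integrable setT (EFin \o f) ->
  (\int[m1]_x \int[m2]_y f (x, y) = \int[m2]_y \int[m1]_x f (x, y))%R.
Proof. by move=> fi; rewrite Rintegral12// Rintegral21. Qed.

Lemma cint12 (f : T1 * T2 -> R[i]) : cintegrable (m1 \x m2)%E f ->
  cint m1 (fun x => cint m2 (fun y => f (x, y))) = cint (m1 \x m2)%E f.
Proof.
move=> fi; apply: complex_ext => /=.
  exact: (Rintegral12 (cintegrable_Re fi)).
exact: (Rintegral12 (cintegrable_Im fi)).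
Qed.

Lemma cint21 (f : T1 * T2 -> R[i]) : cintegrable (m1 \x m2)%E f ->
  cint m2 (fun y => cint m1 (fun x => f (x, y))) = cint (m1 \x m2)%E f.
Proof.
move=> fi; apply: complex_ext => /=.
  exact: (Rintegral21 (cintegrable_Re fi)).
exact: (Rintegral21 (cintegrable_Im fi)).
Qed.

End parametrized_integrals.

(** * Bessel's inequality for characters orthogonal under a weight *)

Section bessel.
Context {R : realType} d (T : measurableType d) (mu : {measure set T -> \bar R}).

(** The square of the L^2 norm. *)
Definition nrm2 (f : T -> R[i]) : \bar R := (\int[mu]_x (sqm (f x))%:E)%E.

Lemma nrm2_ge0 f : (0 <= nrm2 f)%E.
Proof. by apply: integral_ge0 => x _; rewrite lee_fin sqm_ge0. Qed.

Lemma integrable_sqm f : cmeas f -> (nrm2 f < +oo)%E ->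
  mu.-integrable setT (EFin \o (fun x => sqm (f x))).
Proof.
move=> mf fi; apply/integrableP; split; first by apply/measurable_EFinP; exact: measurable_sqm.
by under eq_integral do rewrite /= ger0_norm ?sqm_ge0//.
Qed.

Lemma EFin_Rintegral_sqm f : cmeas f -> (nrm2 f < +oo)%E ->
  ((\int[mu]_x sqm (f x))%R)%:E = nrm2 f.
Proof.
move=> mf fi; rewrite fineK//; exact: integrable_fin_num (integrable_sqm mf fi).
Qed.

Lemma cmod_le1sqm (z : R[i]) : cmod z <= 2^-1 * (1 + sqm z).
Proof. by rewrite -cmod_sqr; have := sqr_ge0 (cmod z - 1); nra. Qed.

(** A square-integrable function supported where an integrable weight is bounded
    below is integrable, because |f| <= (1 + |f|^2) / 2. *)
Lemma cintegrable_L2 (w : T -> R) (w0 : R) f : 0 < w0 -> (forall x, 0 <= w x) ->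
  mu.-integrable setT (EFin \o w) -> cmeas f -> (nrm2 f < +oo)%E ->
  (forall x, f x != 0 -> w0 <= w x) -> cintegrable mu f.
Proof.
move=> w0_gt0 w_ge0 wi mf fi fw.
apply: (@cintegrable_le _ _ _ _ _ (fun x => 2^-1 * (w0^-1 * w x + sqm (f x)))) => //.
  have := integrableZl measurableT (2^-1) (integrableD measurableT
    (integrableZl measurableT w0^-1 wi) (integrable_sqm mf fi)).
  by apply: eq_integrable.
move=> x; have [->|fx0] := eqVneq (f x) 0.
  by rewrite cmod0 sqm0 addr0 !mulr_ge0 ?invr_ge0// ltW.
apply: le_trans (cmod_le1sqm _) _; rewrite ler_pM2l ?invr_gt0// lerD2r.
by rewrite ler_pdivlMl// mulr1 fw.
Qed.

Lemma sqm_sum n (a : 'I_n -> R[i]) :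
  sqm (\sum_j a j) = complex.Re (\sum_j \sum_k a j * ((a k)^*)%C).
Proof.
have -> : \sum_j \sum_k a j * ((a k)^*)%C = (\sum_j a j) * ((\sum_j a j)^*)%C.
  by rewrite rmorph_sum mulr_suml; apply: eq_bigr => j _; rewrite mulr_sumr.
by case: (\sum_j a j) => x y; rewrite /sqm /=; ring.
Qed.

Lemma conjc_cisM (z : R[i]) (a : R) : (((z^*)%C * cis a)^*)%C = z * cis (- a).
Proof. by case: z => x y; apply: complex_ext => /=; rewrite cosN sinN; ring. Qed.

Lemma Re_conjcM (z : R[i]) (x : R) : complex.Re ((z^*)%C * z * x%:C%C) = x * sqm z.
Proof. by case: z => a b; rewrite /sqm /=; ring. Qed.

(** With c_j the j-th coefficient, the sum s of the |c_j|^2 is the integral of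
    V h for V = \sum_j conj(c_j) cis p_j, and the orthogonality gives
    \int |V|^2 w = M s. Where h does not vanish,
    |V h| <= (w |V|^2 / M + M |h|^2 / w0) / 2; integrating, s is at most
    (s + M / w0 \int |h|^2) / 2. *)
Lemma bessel n (p : 'I_n -> T -> R) (w : T -> R) (M w0 : R) (h : T -> R[i]) :
  0 < w0 -> 0 < M -> (forall x, 0 <= w x) ->
  mu.-integrable setT (EFin \o w) -> (\int[mu]_x w x)%R = M ->
  (forall j, measurable_fun setT (p j)) ->
  (forall j k, j != k -> cint mu (fun x => cis (p j x - p k x) * ((w x)%:C)%C) = 0) ->
  cmeas h -> (nrm2 h < +oo)%E -> (forall x, h x != 0 -> w0 <= w x) ->
  \sum_j sqm (cint mu (fun x => cis (p j x) * h x)) <= M / w0 * \int[mu]_x sqm (h x).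
Proof.
move=> w0_gt0 M_gt0 w_ge0 wi wM mp orth mh hi hw.
have ch : cintegrable mu h by exact: cintegrable_L2 hi hw.
have chj j : cintegrable mu (fun x => cis (p j x) * h x).
  by apply: (cintegrableM (C := 1)) => // [|x]; [exact: cmeas_cis|rewrite cmod_cis].
set c := fun j => cint mu (fun x => cis (p j x) * h x).
set s := \sum_j _; change s with (\sum_j sqm (c j)) in s.
(* V is the test function dual to the coefficients. *)
pose V x := \sum_j (c j)^*%C * cis (p j x).
have mV : cmeas V.
  by apply: cmeas_sum => j; apply: cmeasM; [exact: cmeas_cst|exact: cmeas_cis].
have VhE x : V x * h x = \sum_j (c j)^*%C * (cis (p j x) * h x).
  by rewrite mulr_suml; apply: eq_bigr => j _; rewrite mulrA.
have cVh : cintegrable mu (fun x => V x * h x).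
  by under eq_fun do rewrite VhE; apply: cintegrable_sum => j; exact: cintegrableZ.
have sE : s = \int[mu]_x complex.Re (V x * h x).
  transitivity (complex.Re (cint mu (fun x => V x * h x))) => //.
  under eq_fun do rewrite VhE.
  rewrite cint_sum; last by move=> j; exact: cintegrableZ.
  rewrite Re_sum; apply: eq_bigr => j _; rewrite cintZ// -/(c j).
  by case: (c j) => a b; rewrite /sqm /=; ring.
have cw j k : cintegrable mu (fun x => cis (p j x - p k x) * ((w x)%:C)%C).
  apply: (cintegrableM (C := 1)).
  - by apply: cmeas_cis; exact: measurable_funB.
  - by move=> x; rewrite cmod_cis.
  - apply: (cintegrable_le _ wi) => [|x]; last by rewrite cmod_real.
    by apply: cmeas_real; apply/measurable_EFinP; exact: measurable_int wi.
pose G x := \sum_j \sum_k ((c j)^*%C * c k) * (cis (p j x - p k x) * ((w x)%:C)%C).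
have VG x : sqm (V x) * w x = complex.Re (G x).
  rewrite /V sqm_sum /G.
  have -> : \sum_j \sum_k (c j)^*%C * c k * (cis (p j x - p k x) * ((w x)%:C)%C) =
    (\sum_j \sum_k (c j)^*%C * cis (p j x) * (((c k)^*%C * cis (p k x))^*)%C) * ((w x)%:C)%C.
    rewrite mulr_suml; apply: eq_bigr => j _; rewrite mulr_suml; apply: eq_bigr => k _.
    rewrite conjc_cisM cisD; ring.
  by rewrite ReM /= mulr0 subr0.
have cG : cintegrable mu G.
  by apply: cintegrable_sum => j; apply: cintegrable_sum => k; exact: cintegrableZ.
have GE : \int[mu]_x complex.Re (G x) = M * s.
  transitivity (complex.Re (cint mu G)) => //.
  rewrite cint_sum; last by move=> j; apply: cintegrable_sum => k; exact: cintegrableZ.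
  rewrite Re_sum mulr_sumr; apply: eq_bigr => j _.
  rewrite cint_sum; last by move=> k; exact: cintegrableZ.
  rewrite (bigD1 j)// big1; last first.
    by move=> k /andP[_ kj]; rewrite cintZ// orth ?mulr0// eq_sym.
  rewrite cintZ//.
  have -> : cint mu (fun x => cis (p j x - p j x) * ((w x)%:C)%C) = M%:C%C.
    apply: complex_ext => /=.
      by rewrite -wM; apply: eq_Rintegral => x _; rewrite subrr cos0 sin0; ring.
    transitivity (\int[mu]_x (cst (0 : R)) x); last by rewrite Rintegral_cst// mul0r.
    by apply: eq_Rintegral => x _; rewrite subrr cos0 sin0 /cst; ring.
  by rewrite [X in complex.Re X]addr0; exact: Re_conjcM.
have h2i := integrable_sqm mh hi.
have pw x : complex.Re (V x * h x) <= 2^-1 * (M^-1 * complex.Re (G x) + M / w0 * sqm (h x)).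
  apply: le_trans (ler_norm _) _; apply: le_trans (normRe_le _) _.
  rewrite -VG; have [->|hx0] := eqVneq (h x) 0.
    rewrite mulr0 cmod0 sqm0 mulr0 addr0 !mulr_ge0 ?sqm_ge0//; first by rewrite invr_ge0 ltW.
  rewrite cmodM -!cmod_sqr.
  have wx := hw _ hx0.
  apply: (@le_trans _ _ (2^-1 * (M^-1 * (cmod (V x) ^+ 2 * w0) + M / w0 * cmod (h x) ^+ 2))).
    have := sqr_ge0 (w0 * cmod (V x) - M * cmod (h x)).
    rewrite -(@ler_pM2l _ (2 * (M * w0))) ?mulr_gt0// => hh.
    rewrite -(@ler_pM2l _ (2 * (M * w0))) ?mulr_gt0//.
    have -> : 2 * (M * w0) * (2^-1 * (M^-1 * (cmod (V x) ^+ 2 * w0) + M / w0 * cmod (h x) ^+ 2))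
       = (w0 * cmod (V x)) ^+ 2 + (M * cmod (h x)) ^+ 2.
      by field; rewrite !gt_eqF.
    have := sqr_ge0 (w0 * cmod (V x) - M * cmod (h x)); nra.
  rewrite ler_pM2l ?invr_gt0// lerD2r ler_pM2l ?invr_gt0//.
  by rewrite ler_wpM2l// sqr_ge0.
have : s <= 2^-1 * (M^-1 * (M * s) + M / w0 * \int[mu]_x sqm (h x)).
  rewrite {1}sE -GE.
  apply: le_trans (le_Rintegral measurableT (cintegrable_Re cVh) _ (fun x _ => pw x)) _.
    have := integrableZl measurableT (2^-1) (integrableD measurableT
      (integrableZl measurableT M^-1 (cintegrable_Re cG)) (integrableZl measurableT (M / w0) h2i)).
    by apply: eq_integrable.
  have i1 := integrableZl measurableT M^-1 (cintegrable_Re cG).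
  have i2 := integrableZl measurableT (M / w0) h2i.
  rewrite RintegralZl//; last by have := integrableD measurableT i1 i2; apply: eq_integrable.
  by rewrite RintegralD// !RintegralZl//; exact: cintegrable_Re.
rewrite mulrA mulVf ?gt_eqF// mul1r; lra.
Qed.

End bessel.

(** * Invariance of Lebesgue measure on the line and on the plane *)

Section translation_reflection.
Context {R : realType}.
Local Notation mu := (@lebesgue_measure R).

Definition translation (c : R) (x : measurableTypeR R) : measurableTypeR R :=
  (x : R) + c.

Lemma measurable_translation (c : R) : measurable_fun setT (translation c).
Proof. exact: measurable_funD. Qed.

HB.instance Definition _ (c : R) :=
  isMeasurableFun.Build _ _ _ _ (translation c) (measurable_translation c).

Lemma lebesgue_measureD (c : R) (A : set R) : measurable A ->
  pushforward mu (translation c) A = mu A.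
Proof.
move=> mA; apply/esym/lebesgue_measure_unique => //= _ [[a b]] _ <-.
rewrite /pushforward.
have -> : translation c @^-1` `]a, b] = `]a - c, b - c]%classic.
  by apply/seteqP; split => x /=; rewrite !in_itv/= ltrBlDr lerBrDr.
rewrite !lebesgue_measure_itv/= !lte_fin ltrD2r -EFinD.
by case: ifP => // _; congr EFin; ring.
Qed.

Lemma ge0_integral_shift (f : R -> \bar R) (c : R) :
  measurable_fun setT f -> (forall x, 0 <= f x)%E ->
  (\int[mu]_x f (x + c)%R = \int[mu]_x f x)%E.
Proof.
move=> mf f0.
transitivity (\int[pushforward mu (translation c)]_x f x)%E.
  by rewrite ge0_integral_pushforward//=.
by apply: eq_measure_integral => /= A mA _; exact: lebesgue_measureD.
Qed.

Lemma ge0_integral_oppr (f : R -> \bar R) :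
  measurable_fun setT f -> (forall x, 0 <= f x)%E ->
  (\int[mu]_x f (- x)%R = \int[mu]_x f x)%E.
Proof.
move=> mf f0.
transitivity (\int[pushforward mu (-%R : _ -> measurableTypeR R)]_x f x)%E.
  by rewrite ge0_integral_pushforward//=.
by apply: eq_measure_integral => /= A mA _; exact: lebesgue_measureN.
Qed.

End translation_reflection.

(** The product measure under a name of its own, which can carry the structure
    of a sigma-finite measure needed to form products over R^2 x R^2. *)
Definition leb2 {R : realType} := (@lebesgue_measure R \x @lebesgue_measure R)%E.

HB.instance Definition _ (R : realType) := Measure.on (@leb2 R).

Lemma sigma_finite_leb2 (R : realType) : sigma_finite setT (@leb2 R).
Proof.
have /sigma_finiteP[F [TF ndF Foo]] := sigma_finiteT (@lebesgue_measure R).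
exists (fun n => F n `*` F n).
  rewrite -setXTT TF predeqE => -[x y]; split.
    move=> [/= [n _ Fnx] [k _ Gky]]; exists (maxn n k) => //; split.
    - by move: x Fnx; exact/subsetPset/ndF/leq_maxl.
    - by move: y Gky; exact/subsetPset/ndF/leq_maxr.
  by move=> [n _ []/= ? ?]; split; exists n.
move=> k; have [? ?] := Foo k; split; first exact: measurableX.
by rewrite /leb2 product_measure1E// lte_mul_pinfty// ge0_fin_numE.
Qed.

HB.instance Definition _ (R : realType) :=
  Measure_isSigmaFinite.Build _ _ _ (@leb2 R) (@sigma_finite_leb2 R).

Section plane.
Context {R : realType}.
Local Notation mu := (@lebesgue_measure R).
Local Notation mu2 := (@leb2 R).

Lemma measurable_addp d (T : measurableType d) (f g : T -> R * R) :
  measurable_fun setT f -> measurable_fun setT g ->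
  measurable_fun setT (fun x => f x + g x).
Proof.
move=> mf mg; apply/measurable_fun_pairP; split => /=.
  by apply: measurable_funD; exact: measurableT_comp.
by apply: measurable_funD; exact: measurableT_comp.
Qed.

Lemma measurable_oppp d (T : measurableType d) (f : T -> R * R) :
  measurable_fun setT f -> measurable_fun setT (fun x => - f x).
Proof.
move=> mf; apply/measurable_fun_pairP; split => /=.
  exact: (measurable_funN (measurableT_comp measurable_fst mf)).
exact: (measurable_funN (measurableT_comp measurable_snd mf)).
Qed.

Lemma tonelli_xy (f : R * R -> \bar R) :
  measurable_fun setT f -> (forall x, 0 <= f x)%E ->
  (\int[mu2]_z f z = \int[mu]_x \int[mu]_y f (x, y))%E.
Proof. by move=> mf f0; exact: (@fubini_tonelli1 _ _ _ _ _ mu mu f mf f0). Qed.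

Lemma tonelli_yx (f : R * R -> \bar R) :
  measurable_fun setT f -> (forall x, 0 <= f x)%E ->
  (\int[mu2]_z f z = \int[mu]_y \int[mu]_x f (x, y))%E.
Proof. by move=> mf f0; exact: (@fubini_tonelli2 _ _ _ _ _ mu mu f mf f0). Qed.

Lemma measurable_tonelli_x (f : R * R -> \bar R) :
  measurable_fun setT f -> (forall x, 0 <= f x)%E ->
  measurable_fun setT (fun x => \int[mu]_y f (x, y) : \bar R)%E.
Proof. by move=> mf f0; exact: (@measurable_fun_fubini_tonelli_F _ _ _ _ _ mu f mf f0). Qed.

Lemma measurable_tonelli_y (f : R * R -> \bar R) :
  measurable_fun setT f -> (forall x, 0 <= f x)%E ->
  measurable_fun setT (fun y => \int[mu]_x f (x, y) : \bar R)%E.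
Proof. by move=> mf f0; exact: (@measurable_fun_fubini_tonelli_G _ _ _ _ _ mu f mf f0). Qed.

Lemma ge0_integral_shift2 (f : R * R -> \bar R) (c : R * R) :
  measurable_fun setT f -> (forall x, 0 <= f x)%E ->
  (\int[mu2]_z f (z + c)%R = \int[mu2]_z f z)%E.
Proof.
move=> mf f0.
have mfc : measurable_fun setT (fun z : R * R => f (z + c)).
  by apply: measurableT_comp => //; exact: measurable_addp.
rewrite (tonelli_xy mfc (fun z => f0 _)) (tonelli_xy mf f0).
transitivity (\int[mu]_x \int[mu]_y f (x + c.1, y)%R)%E.
  apply: eq_integral => x _.
  apply: (@ge0_integral_shift _ (fun y => f (x + c.1, y)) c.2) => //.
  exact: (measurable_fun_pair2 _ mf).
apply: (@ge0_integral_shift _ (fun x => \int[mu]_y f (x, y))%E c.1) => //.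
  exact: measurable_tonelli_x.
by move=> x; exact: integral_ge0.
Qed.

Lemma Rintegral_shift2 (f : R * R -> R) (c : R * R) : measurable_fun setT f ->
  (\int[mu2]_z f (z + c)%R = \int[mu2]_z f z)%R.
Proof.
move=> mf; have mEf : measurable_fun setT (EFin \o f) by exact/measurable_EFinP.
rewrite /Rintegral [in LHS]integralE [in RHS]integralE; congr (fine (_ - _)%E).
  under eq_integral do rewrite (funepos_comp (EFin \o f) (fun z : R * R => z + c)).
  by apply: ge0_integral_shift2 => //; exact: measurable_funepos.
under eq_integral do rewrite (funeneg_comp (EFin \o f) (fun z : R * R => z + c)).
by apply: ge0_integral_shift2 => //; exact: measurable_funeneg.
Qed.

Lemma cint_shift2 (f : R * R -> R[i]) (c : R * R) : cmeas f ->
  cint mu2 (fun z : R * R => f (z + c)) = cint mu2 f.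
Proof.
move=> [f1 f2]; apply: complex_ext => /=.
  exact: (Rintegral_shift2 c f1).
exact: (Rintegral_shift2 c f2).
Qed.

End plane.

(** * The fundamental theorem of calculus and the Abel-summed cosine integral *)

Section fundamental_theorem.
Context {R : realType}.
Local Notation mu := (@lebesgue_measure R).
Implicit Types f F : R -> R.

Lemma is_derive_continuous f F : (forall x : R, is_derive x 1 F (f x)) -> continuous F.
Proof.
move=> dF x; apply: differentiable_continuous; apply/derivable1_diffP.
by case: (dF x).
Qed.

Lemma ftc_halfline f F (l a : R) : (forall x : R, is_derive x 1 F (f x)) -> continuous f ->
  (forall x, 0 <= f x) -> F x @[x --> +oo] --> l ->
  (\int[mu]_(x in `[a, +oo[) (f x)%:E = (l - F a)%:E)%E.
Proof.
move=> dF cf f0 Fl; rewrite (@ge0_continuous_FTC2y _ _ F a l)//.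
- exact: continuous_subspaceT.
- by apply: cvg_at_right_filter; exact: is_derive_continuous dF a.
- by move=> x _; rewrite derive1E; case: (dF x).
Qed.

Lemma ftc_segment f F (a b : R) : a < b -> (forall x : R, is_derive x 1 F (f x)) -> continuous f ->
  (\int[mu]_(x in `[a, b]) (f x)%:E = (F b - F a)%:E)%E.
Proof.
move=> ab dF cf; rewrite (@continuous_FTC2 _ _ F a b)//.
- exact: continuous_subspaceT.
- have cF := is_derive_continuous dF; split.
  + by move=> x _; case: (dF x).
  + by apply: cvg_at_right_filter; exact: cF.
  + by apply: cvg_at_left_filter; exact: cF.
- by move=> x _; rewrite derive1E; case: (dF x).
Qed.

Lemma cvgr_expRM (e : R) : 0 < e -> expR (- (e * x)) @[x --> +oo] --> (0 : R).
Proof.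
move=> e0; apply: (@cvg_comp _ _ _ (fun x => e * x) (fun y => expR (- y))); last exact: cvgr_expR.
exact: gt0_cvgMry.
Qed.

Lemma continuous_expRM (e : R) : continuous (fun x : R => expR (- (e * x))).
Proof.
move=> x; apply: (@continuous_comp _ _ _ (fun x : R => - (e * x)) expR);
  last exact: continuous_expR.
by apply: continuousN; apply: continuousM => //; exact: cvg_cst.
Qed.

Lemma continuous_cosM (y : R) : continuous (fun x : R => cos (x * y)).
Proof.
move=> x; apply: (@continuous_comp _ _ _ (fun x : R => x * y) cos);
  last exact: continuous_cos.
by apply: continuousM => //; exact: cvg_cst.
Qed.

Lemma continuous_exp_cos (h : R -> R) (e y : R) : continuous h ->
  continuous (fun x : R => expR (- (e * h x)) * (1 + cos (x * y))).
Proof.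
move=> ch x; apply: cvgM.
  apply: (@continuous_comp _ _ _ h (fun x => expR (- (e * x)))); first exact: ch.
  exact: continuous_expRM.
by apply: cvgD; [exact: cvg_cst|exact: continuous_cosM].
Qed.

Lemma is_derive_mulr (y x : R) : is_derive x 1 (fun x : R => x * y) y.
Proof.
have -> : (fun x : R => x * y) = y *: (id : R -> R^o) by apply/funext => z; exact: mulrC.
by apply: is_derive_eq; exact: mulr1.
Qed.

(** A primitive of exp (- e x) (1 + cos (x y)), found by integrating by parts twice. *)
Definition exp_cos_primitive (e y x : R) : R :=
  expR (- (e * x)) * ((y * sin (x * y) - e * cos (x * y)) / (e ^+ 2 + y ^+ 2) - e^-1).

Lemma is_derive_exp_cos_primitive (e y x : R) : 0 < e ->
  is_derive x 1 (exp_cos_primitive e y) (expR (- (e * x)) * (1 + cos (x * y))).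
Proof.
move=> e0; rewrite /exp_cos_primitive.
have d0 : e ^+ 2 + y ^+ 2 != 0 by rewrite gt_eqF// ltr_wpDr ?sqr_ge0// exprn_gt0.
have dE : is_derive x 1 (fun x => expR (- (e * x))) (expR (- (e * x)) * (- e)).
  apply: (@is_derive1_comp _ expR (fun x => - (e * x))).
  apply: is_derive_eq; rewrite scaler1; ring.
have dS : is_derive x 1 (fun x => sin (x * y)) (cos (x * y) * y).
  apply: (@is_derive1_comp _ sin (fun x => x * y)).
  exact: is_derive_mulr.
have dC : is_derive x 1 (fun x => cos (x * y)) (- sin (x * y) * y).
  apply: (@is_derive1_comp _ cos (fun x => x * y)).
  exact: is_derive_mulr.
apply: is_derive_eq; rewrite /GRing.scale /=; field.
by rewrite d0 gt_eqF.
Qed.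

Lemma exp_cos_primitive_cvg (e y : R) : 0 < e -> exp_cos_primitive e y x @[x --> +oo] --> (0 : R).
Proof.
move=> e0; have d0 : 0 < e ^+ 2 + y ^+ 2 by rewrite ltr_wpDr ?sqr_ge0// exprn_gt0.
pose C := (`|y| + e) / (e ^+ 2 + y ^+ 2) + e^-1.
have bnd x : `|exp_cos_primitive e y x| <= expR (- (e * x)) * C.
  rewrite normrM ger0_norm ?expR_ge0// ler_wpM2l ?expR_ge0//.
  apply: le_trans (ler_normB _ _) _; apply: lerD; last by rewrite ger0_norm// invr_ge0 ltW.
  rewrite normrM (@ger0_norm _ (_^-1)) ?invr_ge0 ?(ltW d0)// ler_pM2r ?invr_gt0//.
  apply: le_trans (ler_normB _ _) _; rewrite !normrM; apply: lerD.
    by rewrite ler_piMr// ler_norml sin_geN1 sin_le1.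
  by rewrite (ger0_norm (ltW e0)) ler_piMr ?(ltW e0)// ler_norml cos_geN1 cos_le1.
have cC (k : R) : expR (- (e * x)) * k @[x --> +oo] --> (0 : R).
  by rewrite -[X in _ --> X](mul0r k); apply: cvgM; [exact: cvgr_expRM|exact: cvg_cst].
apply: (squeeze_cvgr _ (cC (- C)) (cC C)).
by apply: nearW => x; move: (bnd x); rewrite ler_norml mulrN.
Qed.

Lemma integral_exp_cos_half (e y : R) : 0 < e ->
  (\int[mu]_(x in `[0%R, +oo[) (expR (- (e * x)) * (1 + cos (x * y)))%:E =
   (e^-1 + e / (e ^+ 2 + y ^+ 2))%:E)%E.
Proof.
move=> e0; rewrite (@ftc_halfline _ (exp_cos_primitive e y) 0 0
  (fun x => is_derive_exp_cos_primitive y x e0) _ _ (exp_cos_primitive_cvg y e0)).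
- congr EFin; rewrite /exp_cos_primitive mulr0 mul0r oppr0 expR0 sin0 cos0; ring.
- by apply: (@continuous_exp_cos id e y) => x; exact: cvg_id.
- by move=> x; rewrite mulr_ge0 ?expR_ge0// -lerBlDl sub0r cos_geN1.
Qed.

(** The factor 1 + cos makes the integrand nonnegative, so that the fundamental
    theorem on a half-line applies without proving integrability beforehand;
    the case y = 0 then separates the two summands. *)
Lemma integral_exp_cos (e y : R) : 0 < e ->
  (\int[mu]_x (expR (- (e * `|x|)) * (1 + cos (x * y)))%:E =
   (2 * (e^-1 + e / (e ^+ 2 + y ^+ 2)))%:E)%E.
Proof.
move=> e0; rewrite ge0_symfun_integralT.
- rewrite EFinM; congr (_ * _)%E; rewrite -(integral_exp_cos_half y e0) set_itvcy.
  by apply: eq_integral => x; rewrite inE /= => x0; rewrite ger0_norm.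
- by move=> x; rewrite mulr_ge0 ?expR_ge0// -lerBlDl sub0r cos_geN1.
- exact: (@continuous_exp_cos (fun x => `|x|) e y norm_continuous).
- by move=> x; rewrite /= normrN mulNr cosN.
Qed.

End fundamental_theorem.

(** * Integrability of products *)

Section integrability_tools.
Context {R : realType}.

Lemma integrableM_bounded d (T : measurableType d) (mu : {measure set T -> \bar R})
    (C : R) (k f : T -> R) :
  measurable_fun setT k -> (forall x, `|k x| <= C) -> mu.-integrable setT (EFin \o f) ->
  mu.-integrable setT (EFin \o (fun x => k x * f x)).
Proof.
move=> mk kC fi; have mf : measurable_fun setT f by apply/measurable_EFinP; exact: measurable_int fi.
have := integrableZl measurableT C (integrable_norm fi).
apply: le_integrable => //; first by apply/measurable_EFinP; exact: measurable_funM.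
move=> x _ /=; rewrite lee_fin normrM [leRHS]normrM normr_id.
rewrite ler_wpM2r// (le_trans (kC x))// ler_norm//.
Qed.

Lemma integrable_tensor d1 d2 (T1 : measurableType d1) (T2 : measurableType d2)
    (m1 : {sigma_finite_measure set T1 -> \bar R})
    (m2 : {sigma_finite_measure set T2 -> \bar R}) (f : T1 -> R) (g : T2 -> R)
    (k : T1 * T2 -> R) :
  m1.-integrable setT (EFin \o f) -> m2.-integrable setT (EFin \o g) ->
  measurable_fun setT k -> (forall x y, `|k (x, y)| <= `|f x * g y|) ->
  (m1 \x m2)%E.-integrable setT (EFin \o k).
Proof.
move=> fi gi mk kfg; have mEk : measurable_fun setT (EFin \o k) by exact/measurable_EFinP.
apply/integrable12ltyP => //.
have mAk : measurable_fun setT (fun z => `|(k z)%:E|)%E by exact: measurableT_comp.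
have [mf fi'] := integrableP _ _ _ fi; have [mg gi'] := integrableP _ _ _ gi.
have mAf : measurable_fun setT (fun x => `|(f x)%:E|)%E by exact: measurableT_comp.
have mAg : measurable_fun setT (fun x => `|(g x)%:E|)%E by exact: measurableT_comp.
have G0 : (0 <= \int[m2]_y `|(g y)%:E|)%E by exact: integral_ge0.
apply: (@le_lt_trans _ _ (\int[m1]_x (`|(f x)%:E| * \int[m2]_y `|(g y)%:E|))%E).
  apply: ge0_le_integral => //.
  - by move=> x _; exact: integral_ge0.
  - exact: (@measurable_fun_fubini_tonelli_F _ _ _ _ _ m2 _ mAk (fun z => abse_ge0 _)).
  - by apply: emeasurable_funM.
  - move=> x _; rewrite -ge0_integralZl//.
    apply: ge0_le_integral => //.
    + exact: (measurableT_comp mAk (pair1_measurable x)).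
    + by apply: emeasurable_funM.
    + by move=> y _; rewrite -abseM lee_fin.
rewrite ge0_integralZr// lte_mul_pinfty//; first exact: integral_ge0.
by rewrite ge0_fin_numE//; exact: integral_ge0.
Qed.

End integrability_tools.

(** * The Poisson kernel *)

Section poisson_kernel.
Context {R : realType}.
Local Notation mu := (@lebesgue_measure R).

Definition abel_weight (e x : R) : R := expR (- (e * `|x|)).
Definition poisson_kernel (e y : R) : R := 2 * e / (e ^+ 2 + y ^+ 2).

Lemma poisson_den_gt0 (e y : R) : 0 < e -> 0 < e ^+ 2 + y ^+ 2.
Proof. by move=> e0; rewrite ltr_wpDr ?sqr_ge0// exprn_gt0. Qed.

Lemma poisson_kernel_ge0 (e y : R) : 0 < e -> 0 <= poisson_kernel e y.
Proof. by move=> e0; rewrite divr_ge0 ?ltW ?poisson_den_gt0// mulr_gt0. Qed.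

Lemma poisson_kernelN (e y : R) : poisson_kernel e (- y) = poisson_kernel e y.
Proof. by rewrite /poisson_kernel sqrrN. Qed.

Lemma abel_weight_ge0 (e x : R) : 0 <= abel_weight e x.
Proof. exact: expR_ge0. Qed.

Lemma abel_weight_le1 (e x : R) : 0 < e -> abel_weight e x <= 1.
Proof. by move=> e0; rewrite -expR0 ler_expR oppr_le0 mulr_ge0// ltW. Qed.

Lemma continuous_abel_weight (e : R) : continuous (abel_weight e).
Proof.
move=> x; apply: (@continuous_comp _ _ _ (fun x : R => `|x|) (fun x => expR (- (e * x)))).
  exact: norm_continuous.
exact: continuous_expRM.
Qed.

Lemma measurable_abel_weight (e : R) : measurable_fun setT (abel_weight e).
Proof. by apply: continuous_measurable_fun; exact: continuous_abel_weight. Qed.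

Lemma integrable_abel_weight (e : R) : 0 < e -> mu.-integrable setT (EFin \o abel_weight e).
Proof.
move=> e0; apply/integrableP; split; first by apply/measurable_EFinP; exact: measurable_abel_weight.
apply: (@le_lt_trans _ _ (\int[mu]_x (expR (- (e * `|x|)) * (1 + cos (x * 0)))%:E)%E); last first.
  by rewrite integral_exp_cos// ltry.
apply: ge0_le_integral => //.
- by apply: measurableT_comp => //; apply/measurable_EFinP; exact: measurable_abel_weight.
- apply/measurable_EFinP; apply: continuous_measurable_fun.
  exact: (@continuous_exp_cos _ (fun x => `|x|) e 0 norm_continuous).
- move=> x _; rewrite lee_fin mulr0 cos0 ger0_norm ?expR_ge0//.
  by rewrite ler_peMr ?expR_ge0// lerDl.
Qed.

Lemma measurable_cosM (y : R) : measurable_fun setT (fun x : R => cos (x * y)).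
Proof. by apply: continuous_measurable_fun; exact: continuous_cosM. Qed.

Lemma integrable_abel_cos (e y : R) : 0 < e ->
  mu.-integrable setT (EFin \o (fun x => cos (x * y) * abel_weight e x)).
Proof.
move=> e0; apply: (integrableM_bounded (C := 1)) => //.
- exact: measurable_cosM.
- by move=> x; rewrite ler_norml cos_geN1 cos_le1.
- exact: integrable_abel_weight.
Qed.

Lemma abel_cos_half (e y : R) : 0 < e ->
  (\int[mu]_x abel_weight e x + \int[mu]_x (cos (x * y) * abel_weight e x) =
   2 * (e^-1 + e / (e ^+ 2 + y ^+ 2)))%R.
Proof.
move=> e0; rewrite -RintegralD//; [|exact: integrable_abel_weight|exact: integrable_abel_cos].
rewrite -[RHS]/(fine _%:E) -integral_exp_cos// /Rintegral; congr fine.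
by apply: eq_integral => x _; rewrite mulrDr mulr1 [X in (_ + X)%R]mulrC.
Qed.

Lemma abel_cos (e y : R) : 0 < e ->
  (\int[mu]_x (cos (x * y) * abel_weight e x) = poisson_kernel e y)%R.
Proof.
move=> e0; have := abel_cos_half y e0; have := abel_cos_half 0 e0.
under [X in _ + X = _ -> _]eq_Rintegral do rewrite mulr0 cos0 mul1r.
rewrite /poisson_kernel expr0n addr0 /= => h1 h2.
have en0 : e != 0 by rewrite gt_eqF.
have h3 : e / e ^+ 2 = e^-1 by field.
rewrite h3 in h1.
have -> : 2 * e / (e ^+ 2 + y ^+ 2) = 2 * (e / (e ^+ 2 + y ^+ 2)) by rewrite mulrA.
lra.
Qed.

Lemma is_derive_poisson_atan (e s y : R) : 0 < e ->
  is_derive y 1 (fun y => 2 * atan ((y - s) / e)) (poisson_kernel e (y - s)).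
Proof.
move=> e0; have en0 : e != 0 by rewrite gt_eqF.
have d0 : e ^+ 2 + (y - s) ^+ 2 != 0 by rewrite gt_eqF// poisson_den_gt0.
have d1 : is_derive y 1 (fun y => (y - s) / e) e^-1.
  apply: is_derive_eq; rewrite /GRing.scale /= ; field => //.
have d2 := @is_derive1_comp _ atan (fun y => (y - s) / e) y _ _ (is_derive1_atan _) d1.
apply: is_derive_eq; rewrite /GRing.scale /= /poisson_kernel; field.
by rewrite d0 en0.
Qed.

Lemma continuous_poisson_kernel (e s : R) : 0 < e ->
  continuous (fun y => poisson_kernel e (y - s)).
Proof.
move=> e0 x; apply: cvgM; first exact: cvg_cst.
apply: cvgV; first by rewrite gt_eqF// poisson_den_gt0.
apply: cvgD; first exact: cvg_cst.
by apply: cvgM; (apply: cvgB; [exact: cvg_id|exact: cvg_cst]).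
Qed.

Lemma measurable_poisson_kernel (e : R) : 0 < e -> measurable_fun setT (poisson_kernel e).
Proof.
move=> e0; apply: continuous_measurable_fun.
have := @continuous_poisson_kernel e 0 e0.
by under eq_fun do rewrite subr0.
Qed.

Lemma integral_poisson_segment (e s a b : R) : 0 < e -> a < b ->
  (\int[mu]_(y in `[a, b]) (poisson_kernel e (y - s))%:E =
   (2 * atan ((b - s) / e) - 2 * atan ((a - s) / e))%:E)%E.
Proof.
move=> e0 ab.
rewrite (@ftc_segment _ _ (fun y => 2 * atan ((y - s) / e)) a b ab
  (fun y => is_derive_poisson_atan s y e0))//.
exact: continuous_poisson_kernel.
Qed.

Lemma integral_poisson (e : R) : 0 < e ->
  (\int[mu]_y (poisson_kernel e y)%:E = (2 * pi)%:E)%E.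
Proof.
move=> e0; have cP : continuous (poisson_kernel e).
  by have := @continuous_poisson_kernel e 0 e0; under eq_fun do rewrite subr0.
rewrite ge0_symfun_integralT//; last first.
- by move=> x /=; rewrite poisson_kernelN.
- by move=> x; exact: poisson_kernel_ge0.
rewrite EFinM; congr (_ * _)%E; rewrite -set_itvcy.
have dP (y : R) : is_derive y 1 (fun y => 2 * atan ((y - 0) / e)) (poisson_kernel e y).
  by have := is_derive_poisson_atan 0 y e0; rewrite subr0.
rewrite (@ftc_halfline _ _ (fun y => 2 * atan ((y - 0) / e)) (2 * (pi / 2)) 0 dP)//.
- by congr EFin; rewrite subrr mul0r atan0 mulr0 subr0 mulrC divfK.
- by move=> x; exact: poisson_kernel_ge0.
- apply: cvgM; first exact: cvg_cst.
  apply: (@cvg_comp _ _ _ (fun y => (y - 0) / e) atan); last exact: cvgy_atan.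
  under eq_fun do rewrite subr0.
  have e1 : 0 < e^-1 by rewrite invr_gt0.
  exact: (gt0_cvgMly e1 cvg_id).
Qed.

Lemma integral_poisson_shift (e z : R) : 0 < e ->
  (\int[mu]_y (poisson_kernel e (y - z))%:E = (2 * pi)%:E)%E.
Proof.
move=> e0; rewrite -(integral_poisson e0).
apply: (@ge0_integral_shift _ (fun y => (poisson_kernel e y)%:E) (- z)).
  by apply/measurable_EFinP; exact: measurable_poisson_kernel.
by move=> x; rewrite lee_fin poisson_kernel_ge0.
Qed.

End poisson_kernel.

(** * Cosine and sine transforms and their Abel means *)

Section cosine_sine_transforms.
Context {R : realType}.
Local Notation mu := (@lebesgue_measure R).
Implicit Types g : R -> R.

Definition cosT g x : R := (\int[mu]_y (cos (x * y) * g y))%R.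
Definition sinT g x : R := (\int[mu]_y (sin (x * y) * g y))%R.
(** 2 pi times the Poisson integral of g, a smoothing of 2 pi g that the Abel
    means of its Fourier transform compute exactly. *)
Definition poissonT e g z : R := (\int[mu]_y (poisson_kernel e (y - z) * g y))%R.

Lemma measurable_cos_comp d (T : measurableType d) (f : T -> R) :
  measurable_fun setT f -> measurable_fun setT (fun x => cos (f x)).
Proof.
by move=> mf; apply: measurableT_comp => //; apply: continuous_measurable_fun; exact: continuous_cos.
Qed.

Lemma measurable_sin_comp d (T : measurableType d) (f : T -> R) :
  measurable_fun setT f -> measurable_fun setT (fun x => sin (f x)).
Proof.
by move=> mf; apply: measurableT_comp => //; apply: continuous_measurable_fun; exact: continuous_sin.
Qed.

Lemma norm_cos_le1 (x : R) : `|cos x| <= 1.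
Proof. by rewrite ler_norml cos_geN1 cos_le1. Qed.

Lemma norm_sin_le1 (x : R) : `|sin x| <= 1.
Proof. by rewrite ler_norml sin_geN1 sin_le1. Qed.

Lemma integrable_cosM g x : mu.-integrable setT (EFin \o g) ->
  mu.-integrable setT (EFin \o (fun y => cos (x * y) * g y)).
Proof.
apply: (integrableM_bounded (C := 1)) => [|y]; last exact: norm_cos_le1.
by apply: measurable_cos_comp; exact: measurable_funM.
Qed.

Lemma integrable_sinM g x : mu.-integrable setT (EFin \o g) ->
  mu.-integrable setT (EFin \o (fun y => sin (x * y) * g y)).
Proof.
apply: (integrableM_bounded (C := 1)) => [|y]; last exact: norm_sin_le1.
by apply: measurable_sin_comp; exact: measurable_funM.
Qed.

Lemma measurable_prod_fst (f : R -> R) : measurable_fun setT f ->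
  measurable_fun setT (fun z : R * R => f z.1).
Proof. by move=> mf; exact: measurableT_comp. Qed.

Lemma measurable_prod_snd (f : R -> R) : measurable_fun setT f ->
  measurable_fun setT (fun z : R * R => f z.2).
Proof. by move=> mf; exact: measurableT_comp. Qed.

Lemma measurable_cosT g : measurable_fun setT g -> measurable_fun setT (cosT g).
Proof.
move=> mg; apply: (@measurable_Rintegral_fst _ _ _ _ _ mu (fun z : R * R => cos (z.1 * z.2) * g z.2)).
apply: measurable_funM; last exact: measurable_prod_snd.
by apply: measurable_cos_comp; apply: measurable_funM.
Qed.

Lemma measurable_sinT g : measurable_fun setT g -> measurable_fun setT (sinT g).
Proof.
move=> mg; apply: (@measurable_Rintegral_fst _ _ _ _ _ mu (fun z : R * R => sin (z.1 * z.2) * g z.2)).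
apply: measurable_funM; last exact: measurable_prod_snd.
by apply: measurable_sin_comp; apply: measurable_funM.
Qed.

Lemma norm_Rintegral_bounded (k g : R -> R) : measurable_fun setT k ->
  (forall y, `|k y| <= 1) -> mu.-integrable setT (EFin \o g) ->
  `|\int[mu]_y (k y * g y)| <= \int[mu]_y `|g y|.
Proof.
move=> mk k1 gi; have kgi := integrableM_bounded (mu := mu) mk k1 gi.
apply: le_trans (le_normr_Rintegral _ kgi) _ => //.
apply: le_Rintegral => //.
- by have := integrable_norm kgi.
- by have := integrable_norm gi.
- by move=> y _; rewrite normrM ler_piMl.
Qed.

Lemma cosT_bounded g x : mu.-integrable setT (EFin \o g) -> `|cosT g x| <= \int[mu]_y `|g y|.
Proof.
apply: norm_Rintegral_bounded => [|y]; last exact: norm_cos_le1.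
by apply: measurable_cos_comp; exact: measurable_funM.
Qed.

Lemma sinT_bounded g x : mu.-integrable setT (EFin \o g) -> `|sinT g x| <= \int[mu]_y `|g y|.
Proof.
apply: norm_Rintegral_bounded => [|y]; last exact: norm_sin_le1.
by apply: measurable_sin_comp; exact: measurable_funM.
Qed.

Lemma measurable_EFinW (f : R -> R) : mu.-integrable setT (EFin \o f) -> measurable_fun setT f.
Proof. by move=> fi; apply/measurable_EFinP; exact: measurable_int fi. Qed.

(** Exchanging the integrals is legitimate thanks to the Abel weight, and the
    addition formula for the cosine leaves the Fourier transform of that
    weight at y - z. *)
Lemma abel_inversion g e z : 0 < e -> mu.-integrable setT (EFin \o g) ->
  (\int[mu]_x (abel_weight e x * (cosT g x * cos (x * z) + sinT g x * sin (x * z))) =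
   poissonT e g z)%R.
Proof.
move=> e0 gi; have mg := measurable_EFinW gi.
pose k (p : R * R) : R := abel_weight e p.1 * (cos (p.1 * (p.2 - z)) * g p.2).
have mk : measurable_fun setT k.
  apply: measurable_funM; first by apply: measurable_prod_fst; exact: measurable_abel_weight.
  apply: measurable_funM; last exact: measurable_prod_snd.
  by apply: measurable_cos_comp; apply: measurable_funM => //; exact: measurable_funB.
have ki : (mu \x mu)%E.-integrable setT (EFin \o k).
  apply: (integrable_tensor (integrable_abel_weight e0) gi mk) => x y.
  rewrite /k /= normrM [leRHS]normrM ler_wpM2l// normrM ler_piMl//.
  exact: norm_cos_le1.
transitivity (\int[mu]_x \int[mu]_y k (x, y)).
  apply: eq_Rintegral => x _.
  have ci := integrable_cosM x gi; have si := integrable_sinM x gi.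
  rewrite /k /=; transitivity (\int[mu]_y (abel_weight e x * cos (x * z) * (cos (x * y) * g y) +
      abel_weight e x * sin (x * z) * (sin (x * y) * g y))).
    rewrite RintegralD//.
    - by rewrite !RintegralZl// -/(cosT g x) -/(sinT g x); ring.
    - by have := integrableZl measurableT (abel_weight e x * cos (x * z)) ci.
    - by have := integrableZl measurableT (abel_weight e x * sin (x * z)) si.
  by apply: eq_Rintegral => y _; rewrite mulrBr cosB; ring.
rewrite (Rintegral_swap ki); apply: eq_Rintegral => y _.
rewrite /k /= -(abel_cos (y - z) e0).
rewrite -RintegralZr//; last exact: integrable_abel_cos.
by apply: eq_Rintegral => x _; ring.
Qed.

(** The inversion formula paired with g. It expresses the weighted energy of the
    transform through a quadratic form in g with a positive kernel. *)
Lemma abel_energy g e : 0 < e -> mu.-integrable setT (EFin \o g) ->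
  (\int[mu]_x (abel_weight e x * (cosT g x ^+ 2 + sinT g x ^+ 2)) =
   \int[mu]_z (g z * poissonT e g z))%R.
Proof.
move=> e0 gi; have mg := measurable_EFinW gi.
set I := (\int[mu]_y `|g y|).
have I0 : 0 <= I by exact: Rintegral_ge0.
have mc := measurable_cosT mg; have ms := measurable_sinT mg.
pose h (p : R * R) := cosT g p.1 * cos (p.1 * p.2) + sinT g p.1 * sin (p.1 * p.2).
have mh : measurable_fun setT h.
  apply: measurable_funD; apply: measurable_funM; try exact: measurable_prod_fst.
    by apply: measurable_cos_comp; apply: measurable_funM.
  by apply: measurable_sin_comp; apply: measurable_funM.
have hI p : `|h p| <= I + I.
  apply: le_trans (ler_normD _ _) _; rewrite !normrM; apply: lerD.
    by rewrite -[leRHS]mulr1 ler_pM ?cosT_bounded ?norm_cos_le1.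
  by rewrite -[leRHS]mulr1 ler_pM ?sinT_bounded ?norm_sin_le1.
pose k (p : R * R) : R := abel_weight e p.1 * h p * g p.2.
have mk : measurable_fun setT k.
  apply: measurable_funM; last exact: measurable_prod_snd.
  by apply: measurable_funM => //; apply: measurable_prod_fst; exact: measurable_abel_weight.
have wi : mu.-integrable setT (EFin \o (fun x => (I + I) * abel_weight e x)).
  by have := integrableZl measurableT (I + I) (integrable_abel_weight e0).
have ki : (mu \x mu)%E.-integrable setT (EFin \o k).
  apply: (integrable_tensor wi gi mk) => x y.
  rewrite /k /= normrM [leRHS]normrM ler_wpM2r// mulrC !normrM ler_wpM2r//.
  exact: le_trans (hI _) (ler_norm _).
transitivity (\int[mu]_x \int[mu]_y k (x, y)).
  apply: eq_Rintegral => x _.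
  have ci := integrable_cosM x gi; have si := integrable_sinM x gi.
  rewrite /k /h /=; transitivity (\int[mu]_y (abel_weight e x * cosT g x * (cos (x * y) * g y) +
      abel_weight e x * sinT g x * (sin (x * y) * g y))).
    rewrite RintegralD//.
    - by rewrite !RintegralZl// -/(cosT g x) -/(sinT g x); ring.
    - by have := integrableZl measurableT (abel_weight e x * cosT g x) ci.
    - by have := integrableZl measurableT (abel_weight e x * sinT g x) si.
  by apply: eq_Rintegral => y _; ring.
rewrite (Rintegral_swap ki); apply: eq_Rintegral => z _.
rewrite -(abel_inversion z e0 gi) mulrC -RintegralZr//.
have := integrableM_bounded (mu := mu) (C := I + I) _ _ (integrable_abel_weight e0).
move=> /(_ (fun x => h (x, z))) hh.
apply: eq_integrable (hh _ _) => //.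
- by move=> x _; rewrite /= mulrC.
- exact: measurableT_comp mh (pair2_measurable z).
Qed.

End cosine_sine_transforms.

(** * Plancherel's upper bound on the line *)

Section fatou_bound.
Context {R : realType} d (T : measurableType d) (mu : {measure set T -> \bar R}).

Lemma fatou_le (F : nat -> T -> R) (f : T -> R) (B : \bar R) :
  (forall n, measurable_fun setT (F n)) -> measurable_fun setT f ->
  (forall n x, 0 <= F n x) -> (forall x, 0 <= f x) ->
  {ae mu, forall x, F n x @[n --> \oo] --> f x} ->
  (forall n, \int[mu]_x (F n x)%:E <= B)%E -> (\int[mu]_x (f x)%:E <= B)%E.
Proof.
move=> mF mf F0 f0 Ff FB.
have mEF n : measurable_fun setT (fun x => (F n x)%:E) by exact/measurable_EFinP.
have EF0 n x : (0 <= (F n x)%:E)%E by rewrite lee_fin.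
have liminf0 (x : T) : (0 <= limn_einf (fun n => (F n x)%:E))%E.
  rewrite limn_einf_lim; apply: lime_ge; first exact: is_cvg_einfs.
  by apply: nearW => n; apply: le_ereal_inf_tmp => _ [m _ <-].
apply: (@le_trans _ _ (\int[mu]_x limn_einf (fun n => (F n x)%:E))%E).
  apply: ae_ge0_le_integral => //.
  - by move=> x _; rewrite lee_fin.
  - exact/measurable_EFinP.
  - under eq_fun do rewrite limn_einf_lim.
    apply: (emeasurable_fun_cvg (fun n x => einfs (fun m => (F m x)%:E) n)) => //.
      by move=> n; exact: measurable_fun_einfs.
    by move=> x _; exact: is_cvg_einfs.
  - apply: filterS Ff => x Fx _.
    have : (F n x)%:E @[n --> \oo] --> (f x)%:E by apply: cvg_EFin => //; exact: nearW.
    by move=> /cvg_limn_einf_sup[-> _].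
apply: le_trans (fatou _ measurableT mEF (fun n x _ => EF0 n x)) _.
rewrite limn_einf_lim; apply: lime_le; first exact: is_cvg_einfs.
by apply: nearW => n; apply: le_trans (FB n); apply: ereal_inf_lbound; exists n => /=.
Qed.

End fatou_bound.

Section plancherel_upper.
Context {R : realType}.
Local Notation mu := (@lebesgue_measure R).
Implicit Types g : R -> R.

Definition sqint g : \bar R := (\int[mu]_x (g x ^+ 2)%:E)%E.

Lemma abel_weight_cvg1 (x : R) : abel_weight n.+1%:R^-1 x @[n --> \oo] --> (1 : R).
Proof.
rewrite -[X in _ --> X]expR0 -[X in _ --> expR X]oppr0 -[X in _ --> expR (- X)](mul0r `|x|).
apply: (@cvg_comp _ _ _ (fun n : nat => - (n.+1%:R^-1 * `|x|)) expR); last exact: continuous_expR.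
by apply: cvgN; apply: cvgM; [exact: cvg_harmonic|exact: cvg_cst].
Qed.

(** Schur's test: the kernel is symmetric, nonnegative and of mass 2 pi in each
    variable, and |g(x) g(y)| <= (g(x)^2 + g(y)^2) / 2. *)
Lemma poisson_form_le g e : 0 < e -> mu.-integrable setT (EFin \o g) -> (sqint g < +oo)%E ->
  ((\int[mu]_z (g z * poissonT e g z))%R%:E <= (2 * pi)%:E * sqint g)%E.
Proof.
move=> e0 gi g2; have mg := measurable_EFinW gi.
pose P (z : R * R) := poisson_kernel e (z.2 - z.1).
have mP : measurable_fun setT P.
  apply: measurableT_comp; first exact: measurable_poisson_kernel.
  exact: measurable_funB.
pose q (z : R * R) := g z.1 * (P z * g z.2).
have mq : measurable_fun setT q.
  apply: measurable_funM; first exact: measurable_prod_fst.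
  by apply: measurable_funM => //; exact: measurable_prod_snd.
have P0 z : 0 <= P z by exact: poisson_kernel_ge0.
have PC z : `|P z| <= 2 / e.
  rewrite ger0_norm// /P /poisson_kernel ler_pdivrMr ?poisson_den_gt0//.
  have -> : 2 / e * (e ^+ 2 + (z.2 - z.1) ^+ 2) = 2 * e + 2 / e * (z.2 - z.1) ^+ 2.
    by field; rewrite gt_eqF.
  by rewrite lerDl mulr_ge0 ?sqr_ge0// divr_ge0// ltW.
have gC : mu.-integrable setT (EFin \o (fun x => 2 / e * g x)).
  by have := integrableZl measurableT (2 / e) gi.
have qi : (mu \x mu)%E.-integrable setT (EFin \o q).
  apply: (integrable_tensor gC gi mq) => x y.
  rewrite /q /= (normrM (g x)) (normrM (P (x, y))) (normrM (2 / e * g x)) (normrM (2 / e)).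
  rewrite mulrA ler_wpM2r// mulrC ler_wpM2r//.
  by apply: le_trans (PC (x, y)) _; exact: ler_norm.
have -> : \int[mu]_z (g z * poissonT e g z) = \int[mu]_x \int[mu]_y q (x, y).
  apply: eq_Rintegral => x _; rewrite /q /P /= RintegralZl//.
  apply: (integrableM_bounded (C := 2 / e)) => // [|y]; last exact: (PC (x, y)).
  exact: measurableT_comp mP (pair1_measurable x).
rewrite Rintegral12// fineK; last exact: integrable_fin_num qi.
pose Q (z : R * R) := (P z * (2^-1 * g z.1 ^+ 2))%:E.
pose Q' (z : R * R) := (P z * (2^-1 * g z.2 ^+ 2))%:E.
have mQ : measurable_fun setT Q.
  apply/measurable_EFinP; apply: measurable_funM => //; apply: measurable_funM => //.
  by apply: measurable_funX; exact: measurable_prod_fst.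
have mQ' : measurable_fun setT Q'.
  apply/measurable_EFinP; apply: measurable_funM => //; apply: measurable_funM => //.
  by apply: measurable_funX; exact: measurable_prod_snd.
have Q0 z : (0 <= Q z)%E by rewrite lee_fin mulr_ge0// mulr_ge0// sqr_ge0.
have Q0' z : (0 <= Q' z)%E by rewrite lee_fin mulr_ge0// mulr_ge0// sqr_ge0.
have gm2 : measurable_fun setT (fun x => (g x ^+ 2)%:E).
  by apply/measurable_EFinP; exact: measurable_funX.
have IP (x : R) : (\int[mu]_y (poisson_kernel e (y - x))%:E = (2 * pi)%:E)%E.
  exact: integral_poisson_shift.
have half : (\int[mu]_x ((2 * pi)%:E * (2^-1 * g x ^+ 2)%:E) = (2 * pi)%:E * ((2^-1)%:E * sqint g))%E.
  rewrite ge0_integralZl_EFin//.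
  - by congr (_ * _)%E; under eq_integral do rewrite EFinM; rewrite ge0_integralZl_EFin// => x _; rewrite lee_fin sqr_ge0.
  - by move=> x _; rewrite lee_fin mulr_ge0// sqr_ge0.
  - by apply/measurable_EFinP; apply: measurable_funM => //; exact: measurable_funX.
  - by rewrite mulr_ge0// pi_ge0.
have mPx (x : R) : measurable_fun setT (fun y : R => (poisson_kernel e (y - x))%:E).
  apply/measurable_EFinP; apply: measurableT_comp; first exact: measurable_poisson_kernel.
  exact: measurable_funB.
have sq0 x : (0 <= (2^-1 * g x ^+ 2)%:E)%E by rewrite lee_fin mulr_ge0// sqr_ge0.
have p0 x y : (0 <= (poisson_kernel e (y - x))%:E)%E by rewrite lee_fin poisson_kernel_ge0.
have IQ : (\int[(mu \x mu)]_z Q z = (2 * pi)%:E * ((2^-1)%:E * sqint g))%E.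
  rewrite (tonelli_xy mQ Q0) -half; apply: eq_integral => x _.
  rewrite /Q /P /=; under eq_integral do rewrite EFinM.
  rewrite ge0_integralZr//; first by rewrite IP.
  exact: mPx.
have IQ' : (\int[(mu \x mu)]_z Q' z = (2 * pi)%:E * ((2^-1)%:E * sqint g))%E.
  rewrite (tonelli_yx mQ' Q0') -half; apply: eq_integral => y _.
  rewrite /Q' /P /=; under eq_integral do rewrite EFinM -opprB poisson_kernelN.
  rewrite ge0_integralZr//; first by rewrite IP.
  exact: mPx.
have -> : ((2 * pi)%:E * sqint g = \int[(mu \x mu)]_z (Q z + Q' z))%E.
  rewrite ge0_integralD// IQ IQ' -ge0_muleDr.
  - have h2 : (2^-1 + 2^-1 : R) = 1 by field.
    by rewrite -ge0_muleDl ?lee_fin ?invr_ge0// -EFinD h2 mul1e.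
  - by rewrite mule_ge0// ?lee_fin ?invr_ge0//; apply: integral_ge0 => x _; rewrite lee_fin sqr_ge0.
  - by rewrite mule_ge0// ?lee_fin ?invr_ge0//; apply: integral_ge0 => x _; rewrite lee_fin sqr_ge0.
apply: le_trans (_ : \int[(mu \x mu)]_z `|(q z)%:E| <= _)%E.
  by apply: le_trans (lee_abs _) _; apply: le_abse_integral => //; exact/measurable_EFinP.
apply: ge0_le_integral => //.
- by apply: measurableT_comp => //; exact/measurable_EFinP.
- exact: emeasurable_funD.
- move=> z _; rewrite /q /Q /Q' abse_EFin -EFinD lee_fin (normrM (g z.1)) (normrM (P z)) (ger0_norm (P0 z)).
  rewrite -mulrDr mulrCA ler_wpM2l// -(real_normK (num_real (g z.1))) -(real_normK (num_real (g z.2))).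
  by have := sqr_ge0 (`|g z.1| - `|g z.2|); nra.
Qed.

Lemma integrable_bounded_abel (C e : R) (f : R -> R) : 0 < e -> measurable_fun setT f ->
  (forall x, `|f x| <= C) -> mu.-integrable setT (EFin \o (fun x => abel_weight e x * f x)).
Proof.
move=> e0 mf fC.
have := integrableM_bounded (mu := mu) mf fC (integrable_abel_weight e0).
by apply: eq_integrable => // x _; rewrite /= mulrC.
Qed.

Lemma sqr_le_norm (a b : R) : `|a| <= b -> a ^+ 2 <= b ^+ 2.
Proof. by rewrite ler_norml => /andP[]; nra. Qed.

(** The quadratic form bounds the Abel-weighted energy uniformly in the weight,
    and Fatou's lemma removes the weight. *)
Lemma plancherel_upper g : mu.-integrable setT (EFin \o g) -> (sqint g < +oo)%E ->
  (\int[mu]_x (cosT g x ^+ 2 + sinT g x ^+ 2)%:E <= (2 * pi)%:E * sqint g)%E.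
Proof.
move=> gi g2; have mg := measurable_EFinW gi.
have mc := measurable_cosT mg; have ms := measurable_sinT mg.
have mcs : measurable_fun setT (fun x => cosT g x ^+ 2 + sinT g x ^+ 2).
  by apply: measurable_funD; exact: measurable_funX.
pose F n x := abel_weight n.+1%:R^-1 x * (cosT g x ^+ 2 + sinT g x ^+ 2).
have e0 n : 0 < n.+1%:R^-1 :> R by rewrite invr_gt0.
apply: (@fatou_le _ _ _ mu F).
- by move=> n; apply: measurable_funM => //; exact: measurable_abel_weight.
- by [].
- by move=> n x; rewrite mulr_ge0 ?abel_weight_ge0// addr_ge0// sqr_ge0.
- by move=> x; rewrite addr_ge0// sqr_ge0.
- apply: aeW => x; rewrite -[X in _ --> X]mul1r /F.
  by apply: cvgM; [exact: abel_weight_cvg1|exact: cvg_cst].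
- move=> n; apply: le_trans (poisson_form_le (e0 n) gi g2).
  rewrite -abel_energy// fineK//.
  set I := \int[mu]_y `|g y|.
  have I0 : 0 <= I by exact: Rintegral_ge0.
  apply: integrable_fin_num; first by [].
  apply: (integrable_bounded_abel (C := I ^+ 2 + I ^+ 2)) => // x.
  rewrite ger0_norm ?addr_ge0 ?sqr_ge0//; apply: lerD.
    by apply: sqr_le_norm; exact: cosT_bounded.
  by apply: sqr_le_norm; exact: sinT_bounded.
Qed.

End plancherel_upper.

(** * Averages over short intervals *)

Section averages.
Context {R : realType}.
Local Notation mu := (@lebesgue_measure R).
Implicit Types f g : R -> R.

Definition window (r u : R) : R := \1_(`[- r, r]%classic) u.

Definition average (r : R) f (z : R) : R := (2 * r)^-1 * \int[mu]_y (window r (y - z) * f y).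

Lemma windowE (r y z : R) : window r (y - z) = \1_(`[z - r, z + r]%classic) y.
Proof.
rewrite /window !indicE; congr (_%:R); congr nat_of_bool; apply/idP/idP;
  rewrite !inE /= !in_itv /=; lra.
Qed.

Lemma windowN (r u : R) : window r (- u) = window r u.
Proof.
rewrite /window !indicE; congr (_%:R); congr nat_of_bool; apply/idP/idP;
  rewrite !inE /= !in_itv /=; lra.
Qed.

Lemma window_ge0 (r u : R) : 0 <= window r u.
Proof. by rewrite /window indicE. Qed.

Lemma measurable_window (r : R) : measurable_fun setT (window r).
Proof. exact: measurable_indic. Qed.

Lemma measurable_window2 (r : R) : measurable_fun setT (fun z : R * R => window r (z.2 - z.1)).
Proof.
apply: measurableT_comp; first exact: measurable_window.
exact: measurable_funB.
Qed.

Lemma ge0_integral_window (r z : R) (f : R -> \bar R) : (forall y, 0 <= f y)%E ->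
  (\int[mu]_y ((window r (y - z))%:E * f y) = \int[mu]_(y in `[(z - r)%R, (z + r)%R]) f y)%E.
Proof.
move=> f0; rewrite [RHS]integral_mkcond; apply: eq_integral => y _.
rewrite patchE windowE indicE; case: ifPn => _; first by rewrite mul1e.
by rewrite mul0e.
Qed.

Lemma Rintegral_window (r z : R) f :
  \int[mu]_y (window r (y - z) * f y) = \int[mu]_(y in `[z - r, z + r]) f y.
Proof.
rewrite [RHS]Rintegral_mkcond; apply: eq_Rintegral => y _.
rewrite patchE windowE indicE; case: ifPn => _; first by rewrite mul1r.
by rewrite mul0r.
Qed.

Lemma integral_window (r z : R) : 0 < r ->
  (\int[mu]_y (window r (y - z))%:E = (2 * r)%:E)%E.
Proof.
move=> r0; under eq_integral do rewrite -[X in (X)%:E]mulr1 EFinM.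
rewrite (ge0_integral_window r z (f := cst 1%E))// integral_cst//= mul1e lebesgue_measure_itv/= lte_fin.
by rewrite ifT ?EFinB; [congr (_%:E)%E; ring|lra].
Qed.

Lemma integrable_window (r z : R) f : mu.-integrable setT (EFin \o f) ->
  mu.-integrable setT (EFin \o (fun y => window r (y - z) * f y)).
Proof.
apply: (integrableM_bounded (C := 1)).
  by apply: measurableT_comp; [exact: measurable_window|exact: measurable_funB].
by move=> y; rewrite /window indicE; case: (_ \in _); rewrite ?normr1// normr0.
Qed.

Lemma measurable_average (r : R) f : measurable_fun setT f -> measurable_fun setT (average r f).
Proof.
move=> mf; apply: measurable_funM => //.
apply: (@measurable_Rintegral_fst _ _ _ _ _ mu (fun z : R * R => window r (z.2 - z.1) * f z.2)).
by apply: measurable_funM; [exact: measurable_window2|exact: measurable_prod_snd].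
Qed.

Lemma norm_le_1sqr (a : R) : `|a| <= 1 + a ^+ 2.
Proof. by rewrite ler_norml; have := sqr_ge0 (a - 2^-1); have := sqr_ge0 (a + 2^-1); nra. Qed.

Lemma locally_integrable_L2 (r z : R) f : 0 < r -> measurable_fun setT f ->
  (sqint f < +oo)%E -> mu.-integrable setT (EFin \o (fun y => window r (y - z) * f y)).
Proof.
move=> r0 mf f2; apply/integrableP; split.
  apply/measurable_EFinP; apply: measurable_funM => //.
  by apply: measurableT_comp; [exact: measurable_window|exact: measurable_funB].
have mw : measurable_fun setT (fun y : R => window r (y - z)).
  by apply: measurableT_comp; [exact: measurable_window|exact: measurable_funB].
apply: (@le_lt_trans _ _ (\int[mu]_y ((window r (y - z))%:E + (f y ^+ 2)%:E))%E).
  apply: ge0_le_integral => //.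
  - by apply: measurableT_comp => //; apply/measurable_EFinP; exact: measurable_funM.
  - by apply: emeasurable_funD; apply/measurable_EFinP => //; exact: measurable_funX.
  - move=> y _ /=; rewrite -EFinD lee_fin /window indicE; case: (_ \in _).
      by rewrite mul1r; exact: norm_le_1sqr.
    by rewrite mul0r normr0 add0r sqr_ge0.
rewrite ge0_integralD//.
- by rewrite integral_window// lte_add_pinfty// ltry.
- by move=> y _; rewrite lee_fin window_ge0.
- exact/measurable_EFinP.
- by move=> y _; rewrite lee_fin sqr_ge0.
- by apply/measurable_EFinP; exact: measurable_funX.
Qed.

(** Jensen's inequality for the square, in the form that a variance is nonnegative. *)
Lemma average_sqr_le (r z : R) f : 0 < r -> measurable_fun setT f -> (sqint f < +oo)%E ->
  ((average r f z ^+ 2)%:E <= (2 * r)^-1%:E * \int[mu]_y ((window r (y - z))%:E * (f y ^+ 2)%:E))%E.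
Proof.
move=> r0 mf f2; set m := average r f z.
have mw : measurable_fun setT (fun y : R => window r (y - z)).
  by apply: measurableT_comp; [exact: measurable_window|exact: measurable_funB].
have mf2 : measurable_fun setT (fun y => f y ^+ 2) by exact: measurable_funX.
have f2i : mu.-integrable setT (EFin \o (fun y => f y ^+ 2)).
  apply/integrableP; split; first exact/measurable_EFinP.
  by under eq_integral do rewrite /= ger0_norm ?sqr_ge0//.
have wfi := locally_integrable_L2 z r0 mf f2.
have wf2i := integrable_window r z f2i.
have wi : mu.-integrable setT (EFin \o (fun y => window r (y - z))).
  apply/integrableP; split; first exact/measurable_EFinP.
  by under eq_integral do rewrite /= ger0_norm ?window_ge0//; rewrite integral_window// ltry.
have Iw : \int[mu]_y window r (y - z) = 2 * r by rewrite /Rintegral integral_window.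
have Iwf : \int[mu]_y (window r (y - z) * f y) = 2 * r * m.
  by rewrite /m /average mulrA mulfV ?mul1r// gt_eqF// mulr_gt0.
have : 0 <= \int[mu]_y (window r (y - z) * (f y - m) ^+ 2).
  by apply: Rintegral_ge0 => y _; rewrite mulr_ge0 ?window_ge0// sqr_ge0.
have -> : \int[mu]_y (window r (y - z) * (f y - m) ^+ 2) =
    \int[mu]_y (window r (y - z) * f y ^+ 2 + (m ^+ 2 * window r (y - z) - (2 * m) * (window r (y - z) * f y))).
  by apply: eq_Rintegral => y _; ring.
have i1 : mu.-integrable setT (EFin \o (fun y => m ^+ 2 * window r (y - z))).
  by have := integrableZl measurableT (m ^+ 2) wi.
have i2 : mu.-integrable setT (EFin \o (fun y => (2 * m) * (window r (y - z) * f y))).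
  by have := integrableZl measurableT (2 * m) wfi.
rewrite RintegralD//; last by have := integrableB measurableT i1 i2.
rewrite RintegralB// !RintegralZl// Iw Iwf => h.
have -> : (\int[mu]_y ((window r (y - z))%:E * (f y ^+ 2)%:E) =
    (\int[mu]_y (window r (y - z) * f y ^+ 2))%:E)%E.
  rewrite fineK; last exact: integrable_fin_num wf2i.
  by apply: eq_integral => y _; rewrite EFinM.
rewrite -EFinM lee_fin ler_pdivlMl ?mulr_gt0//; nra.
Qed.

Lemma sqint_average_le (r : R) f : 0 < r -> measurable_fun setT f ->
  (sqint (average r f) <= sqint f)%E.
Proof.
move=> r0 mf; have [f2|] := ltP (sqint f) +oo%E; last by rewrite leye_eq => /eqP ->; rewrite leey.
have mf2 : measurable_fun setT (fun y => (f y ^+ 2)%:E).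
  by apply/measurable_EFinP; exact: measurable_funX.
pose k (p : R * R) := ((window r (p.2 - p.1))%:E * (f p.2 ^+ 2)%:E)%E.
have mk : measurable_fun setT k.
  apply: emeasurable_funM; first by apply/measurable_EFinP; exact: measurable_window2.
  exact: (measurableT_comp mf2 measurable_snd).
have k0 p : (0 <= k p)%E by rewrite mule_ge0// lee_fin ?window_ge0// sqr_ge0.
have r2 : (0 <= (2 * r)^-1)%R by rewrite invr_ge0 mulr_ge0// ltW.
apply: (@le_trans _ _ (\int[mu]_z ((2 * r)^-1%:E * \int[mu]_y k (z, y)))%E).
  apply: ge0_le_integral => //.
  - by move=> z _; rewrite lee_fin sqr_ge0.
  - by apply/measurable_EFinP; apply: measurable_funX; exact: measurable_average.
  - by apply: emeasurable_funM => //; exact: measurable_tonelli_x.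
  - by move=> z _; exact: average_sqr_le.
rewrite ge0_integralZl_EFin//; last 2 first.
- by move=> z _; exact: integral_ge0.
- exact: measurable_tonelli_x.
rewrite -(tonelli_xy mk k0) (tonelli_yx mk k0).
have kE y : (\int[mu]_x k (x, y) = (2 * r)%:E * (f y ^+ 2)%:E)%E.
  rewrite /k /= ge0_integralZr//; last 3 first.
  - apply/measurable_EFinP; apply: measurableT_comp; first exact: measurable_window.
    exact: measurable_funB.
  - by move=> x _; rewrite lee_fin window_ge0.
  - by rewrite lee_fin sqr_ge0.
  congr (_ * _)%E; under eq_integral do rewrite -windowN opprB.
  exact: integral_window.
under eq_integral do rewrite kE.
rewrite ge0_integralZl_EFin//; last 2 first.
- by move=> y _; rewrite lee_fin sqr_ge0.
- by rewrite mulr_ge0// ltW.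
by rewrite muleA -EFinM mulVf ?mul1e// gt_eqF// mulr_gt0.
Qed.

(** Lebesgue's differentiation theorem. *)
Lemma average_cvg f : mu.-integrable setT (EFin \o f) ->
  {ae mu, forall z, average n.+1%:R^-1 f z @[n --> \oo] --> f z}.
Proof.
move=> fi; have lf : locally_integrable setT f by apply: open_integrable_locally => //; exact: openT.
pose E (x : R) n : set R := `[x - n.+1%:R^-1, x + n.+1%:R^-1]%classic.
have hE x : nicely_shrinking x (E x).
  split; first by move=> n; exact: measurable_itv.
  exists (2, fun n => (2 / n.+1%:R)%:pos%R); split => //=.
  - by rewrite -[X in _ --> X](mulr0 2); apply: cvgM; [exact: cvg_cst|exact: cvg_harmonic].
  - move=> n y; rewrite /E /= in_itv /= ball_itv /= in_itv/=.
    have : 0 < n.+1%:R^-1 :> R by rewrite invr_gt0.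
    by move: (n.+1%:R^-1) => s s0 /andP[]; lra.
  - move=> n; rewrite lebesgue_measure_ball//= lebesgue_measure_itv /= lte_fin.
    have n0 : 0 < n.+1%:R^-1 :> R by rewrite invr_gt0.
    move: (n.+1%:R^-1) n0 => s s0; rewrite ifT; last by lra.
    by rewrite -EFinB -EFinM lee_fin; lra.
have := lebesgue_differentiation lf; apply: filterS; first exact: (ae_filter_ringOfSetsType mu).
move=> z /(nice_lebesgue_differentiation hE lf).
move=> /fine_cvg; apply: cvg_trans; apply: near_eq_cvg; apply: nearW => n.
have n0 : 0 < n.+1%:R^-1 :> R by rewrite invr_gt0.
have mE : mu (E z n) = (2 * n.+1%:R^-1)%:E.
  rewrite /E lebesgue_measure_itv /= lte_fin.
  by move: (n.+1%:R^-1) n0 => s s0; rewrite ifT ?EFinB; [congr (_%:E)%E; ring|lra].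
have fiE : mu.-integrable (E z n) (EFin \o f).
  by apply: integrableS fi => //; exact: measurable_itv.
rewrite /= mE inver gt_eqF ?mulr_gt0// fineM//; last first.
  by apply: integrable_fin_num fiE; exact: measurable_itv.
by rewrite /average Rintegral_window.
Qed.

End averages.

(** * Plancherel's lower bound on the line *)

Section plancherel_lower.
Context {R : realType}.
Local Notation mu := (@lebesgue_measure R).
Implicit Types f g : R -> R.

Lemma measurable_poissonT (e : R) g : 0 < e -> measurable_fun setT g ->
  measurable_fun setT (poissonT e g).
Proof.
move=> e0 mg.
apply: (@measurable_Rintegral_fst _ _ _ _ _ mu (fun z : R * R => poisson_kernel e (z.2 - z.1) * g z.2)).
apply: measurable_funM; last exact: measurable_prod_snd.
apply: measurableT_comp; first exact: measurable_poisson_kernel.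
exact: measurable_funB.
Qed.

Lemma measurable_energy g : measurable_fun setT g ->
  measurable_fun setT (fun x => (cosT g x ^+ 2 + sinT g x ^+ 2)%:E).
Proof.
move=> mg; apply/measurable_EFinP; apply: measurable_funD; apply: measurable_funX.
  exact: measurable_cosT.
exact: measurable_sinT.
Qed.

Lemma sqint_add_le f f1 f2 (A B : R -> \bar R) : measurable_fun setT f ->
  measurable_fun setT A -> measurable_fun setT B ->
  (forall x, 0 <= A x)%E -> (forall x, 0 <= B x)%E -> (forall x, f x = f1 x + f2 x) ->
  (forall x, (f1 x ^+ 2)%:E <= A x)%E -> (forall x, (f2 x ^+ 2)%:E <= B x)%E ->
  (sqint f <= 2%:E * (\int[mu]_x A x + \int[mu]_x B x))%E.
Proof.
move=> mf mA mB A0 B0 fE fA fB.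
have mAB : measurable_fun setT (fun x => A x + B x)%E by exact: emeasurable_funD.
rewrite -ge0_integralD// -ge0_integralZl_EFin//; last by move=> x _; rewrite adde_ge0.
apply: ge0_le_integral => //.
- by move=> x _; rewrite lee_fin sqr_ge0.
- by apply/measurable_EFinP; exact: measurable_funX.
- exact: emeasurable_funM.
- move=> x _; apply: le_trans (_ : 2%:E * ((f1 x ^+ 2)%:E + (f2 x ^+ 2)%:E) <= _)%E.
    by rewrite -EFinD -EFinM lee_fin fE; have := sqr_ge0 (f1 x - f2 x); nra.
  by rewrite lee_pmul2l// leeD.
Qed.

Lemma two_pi_sum_le (a b c : \bar R) : (0 <= a)%E -> (0 <= b)%E -> (a + b <= c)%E ->
  (2%:E * ((2 * pi)%:E * a + (2 * pi)%:E * b) <= (4 * pi)%:E * c)%E.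
Proof.
move=> a0 b0 abc; rewrite -ge0_muleDr// muleA -EFinM mulrA -natrM.
by rewrite lee_wpmul2l// lee_fin mulr_ge0// pi_ge0.
Qed.

Lemma lte_summandl (a b c : \bar R) : (0 <= b)%E -> (a + b <= c)%E -> (c < +oo)%E -> (a < +oo)%E.
Proof. by move=> b0 abc; apply: le_lt_trans; apply: le_trans abc; rewrite leeDl. Qed.

(** By the inversion formula the Poisson integral of g is itself a sum of two
    transforms, of the Abel-weighted cosine and sine transforms of g, to which
    the upper bound applies. The factor 4 pi is 2 (2 pi), the 2 being lost on
    the sum of two squares. *)
Lemma sqint_poissonT_le (e : R) g : 0 < e -> mu.-integrable setT (EFin \o g) ->
  (sqint g < +oo)%E ->
  (sqint (poissonT e g) <= (4 * pi)%:E * \int[mu]_x (cosT g x ^+ 2 + sinT g x ^+ 2)%:E)%E.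
Proof.
move=> e0 gi g2; have mg := measurable_EFinW gi.
have mc := measurable_cosT mg; have ms := measurable_sinT mg.
have mw := measurable_abel_weight e.
set X := (\int[mu]_x _)%E.
have Xfin : (X < +oo)%E.
  apply: le_lt_trans (plancherel_upper gi g2) _.
  by rewrite lte_mul_pinfty// lee_fin mulr_ge0// pi_ge0.
pose H1 x := abel_weight e x * cosT g x; pose H2 x := abel_weight e x * sinT g x.
have mH1 : measurable_fun setT H1 by exact: measurable_funM.
have mH2 : measurable_fun setT H2 by exact: measurable_funM.
have i1 : mu.-integrable setT (EFin \o H1).
  by apply: (integrable_bounded_abel e0 mc) => x; exact: cosT_bounded.
have i2 : mu.-integrable setT (EFin \o H2).
  by apply: (integrable_bounded_abel e0 ms) => x; exact: sinT_bounded.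
have w2 x (a : R) : (abel_weight e x * a) ^+ 2 <= a ^+ 2.
  rewrite exprMn ler_piMl ?sqr_ge0//.
  by rewrite expr_le1// ?abel_weight_ge0 ?abel_weight_le1.
have hE : (sqint H1 + sqint H2 <= X)%E.
  rewrite -ge0_integralD//; last 4 first.
  - by move=> x _; rewrite lee_fin sqr_ge0.
  - by apply/measurable_EFinP; exact: measurable_funX.
  - by move=> x _; rewrite lee_fin sqr_ge0.
  - by apply/measurable_EFinP; exact: measurable_funX.
  apply: ge0_le_integral => //.
  - by move=> x _; rewrite -EFinD lee_fin addr_ge0// sqr_ge0.
  - by apply: emeasurable_funD; apply/measurable_EFinP; exact: measurable_funX.
  - by apply/measurable_EFinP; apply: measurable_funD; exact: measurable_funX.
  - by move=> x _; rewrite -EFinD lee_fin lerD// w2.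
have s10 : (0 <= sqint H1)%E by apply: integral_ge0 => x _; rewrite lee_fin sqr_ge0.
have s20 : (0 <= sqint H2)%E by apply: integral_ge0 => x _; rewrite lee_fin sqr_ge0.
have f1 : (sqint H1 < +oo)%E by exact: lte_summandl s20 hE Xfin.
have f2 : (sqint H2 < +oo)%E by apply: lte_summandl s10 _ Xfin; rewrite addeC.
have KE z : poissonT e g z = cosT H1 z + sinT H2 z.
  rewrite -(abel_inversion z e0 gi) -RintegralD//; last 2 first.
  - exact: integrable_cosM.
  - exact: integrable_sinM.
  by apply: eq_Rintegral => x _; rewrite /H1 /H2 [z * x]mulrC; ring.
have m1 := measurable_cosT mH1; have m2 := measurable_sinT mH2.
apply: le_trans (sqint_add_le (measurable_poissonT e0 mg) (measurable_energy mH1)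
  (measurable_energy mH2) _ _ KE _ _) _.
- by move=> x; rewrite lee_fin addr_ge0// sqr_ge0.
- by move=> x; rewrite lee_fin addr_ge0// sqr_ge0.
- by move=> x; rewrite lee_fin lerDl sqr_ge0.
- by move=> x; rewrite lee_fin lerDr sqr_ge0.
apply: le_trans (lee_wpmul2l _ (leeD (plancherel_upper i1 f1) (plancherel_upper i2 f2))) _.
  by rewrite lee_fin.
exact: (two_pi_sum_le s10 s20 hE).
Qed.

(** The integral over [a, b] of the Poisson kernel centred at y. *)
Definition atan_step (e a b y : R) : R := 2 * atan ((b - y) / e) - 2 * atan ((a - y) / e).

(** Averaging before passing to the limit: the average of the kernel is a
    difference of arctangents, which converges pointwise and boundedly to
    2 pi times an indicator, whereas the kernel itself only converges as a
    measure. *)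
Lemma average_poissonT (e r z : R) g : 0 < e -> 0 < r -> mu.-integrable setT (EFin \o g) ->
  average r (poissonT e g) z =
  (2 * r)^-1 * \int[mu]_y (atan_step e (z - r) (z + r) y * g y).
Proof.
move=> e0 r0 gi; have mg := measurable_EFinW gi; congr (_ * _).
have wi : mu.-integrable setT (EFin \o (fun y => 2 / e * window r (y - z))).
  have : mu.-integrable setT (EFin \o (fun y : R => window r (y - z))).
    apply/integrableP; split.
      apply/measurable_EFinP; apply: measurableT_comp; first exact: measurable_window.
      exact: measurable_funB.
    by under eq_integral do rewrite /= ger0_norm ?window_ge0//; rewrite integral_window// ltry.
  by move=> /(integrableZl measurableT (2 / e)).
pose k (p : R * R) := window r (p.1 - z) * (poisson_kernel e (p.2 - p.1) * g p.2).
have mP : measurable_fun setT (fun p : R * R => poisson_kernel e (p.2 - p.1)).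
  by apply: measurableT_comp; [exact: measurable_poisson_kernel|exact: measurable_funB].
have mk : measurable_fun setT k.
  apply: measurable_funM.
    by apply: measurableT_comp; [exact: measurable_window|exact: measurable_funB].
  by apply: measurable_funM => //; exact: measurable_prod_snd.
have PC u : `|poisson_kernel e u| <= 2 / e.
  rewrite ger0_norm ?poisson_kernel_ge0// /poisson_kernel ler_pdivrMr ?poisson_den_gt0//.
  have -> : 2 / e * (e ^+ 2 + u ^+ 2) = 2 * e + 2 / e * u ^+ 2.
    by field; rewrite gt_eqF.
  by rewrite lerDl mulr_ge0 ?sqr_ge0// divr_ge0// ltW.
have ki : (mu \x mu)%E.-integrable setT (EFin \o k).
  apply: (integrable_tensor wi gi mk) => x y.
  rewrite /k /= (normrM (window _ _)) (normrM (poisson_kernel _ _)) (normrM (2 / e * _)) (normrM (2 / e)).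
  rewrite mulrCA mulrA ler_wpM2r// ler_wpM2r//.
  exact: le_trans (PC _) (ler_norm _).
have Pi x : mu.-integrable setT (EFin \o (fun y => poisson_kernel e (y - x) * g y)).
  apply: (integrableM_bounded (C := 2 / e)) => //.
  exact: measurableT_comp mP (pair1_measurable x).
transitivity (\int[mu]_x \int[mu]_y k (x, y)).
  by apply: eq_Rintegral => x _; rewrite /k /= RintegralZl.
rewrite (Rintegral_swap ki); apply: eq_Rintegral => y _.
rewrite /k /=.
have -> : atan_step e (z - r) (z + r) y = \int[mu]_x (window r (x - z) * poisson_kernel e (x - y)).
  rewrite Rintegral_window /Rintegral integral_poisson_segment//; lra.
rewrite -RintegralZr//.
  by apply: eq_Rintegral => x _; rewrite -[y - x]opprB poisson_kernelN mulrA.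
have Wi : mu.-integrable setT (EFin \o (fun x => poisson_kernel e (x - y))).
  apply/integrableP; split.
    apply/measurable_EFinP; apply: measurableT_comp; first exact: measurable_poisson_kernel.
    exact: measurable_funB.
  under eq_integral do rewrite /= ger0_norm ?poisson_kernel_ge0//.
  by rewrite integral_poisson_shift// ltry.
exact: integrable_window.
Qed.

Lemma cvg_atan_natM (t : R) : 0 < t -> atan (t / n.+1%:R^-1) @[n --> \oo] --> pi / 2.
Proof.
move=> t0; under eq_fun do rewrite invrK.
apply: (@cvg_comp _ _ _ (fun n : nat => t * n.+1%:R) atan); last exact: cvgy_atan.
have c : (fun n : nat => n.+1%:R : R) @ \oo --> +oo.
  by rewrite (cvg_shiftS (fun n : nat => n%:R : R)); exact: cvgr_idn.
exact: (cvg_comp _ _ c (gt0_cvgMry t0 cvg_id)).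
Qed.

Lemma norm_atan_step_le (e a b y : R) : `|atan_step e a b y| <= 2 * pi.
Proof.
rewrite /atan_step ler_norml.
have := atan_gtNpi2 ((b - y) / e); have := atan_ltpi2 ((b - y) / e).
have := atan_gtNpi2 ((a - y) / e); have := atan_ltpi2 ((a - y) / e); lra.
Qed.

Lemma cvg_atan_step (a b y : R) : a < b -> y != a -> y != b ->
  atan_step n.+1%:R^-1 a b y @[n --> \oo] --> 2 * pi * \1_(`[a, b]%classic) y.
Proof.
move=> ab ya yb.
have key (c : R) : c != y -> 2 * atan ((c - y) / n.+1%:R^-1) @[n --> \oo] --> (if y < c then pi else - pi).
  move=> cy; have -> : (if y < c then pi else - pi) = 2 * (if y < c then pi / 2 else - (pi / 2)) :> R.
    by case: ifP => _; lra.
  apply: cvgM; first exact: cvg_cst.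
  case: ltP => h; first by apply: cvg_atan_natM; rewrite subr_gt0.
  under eq_fun do rewrite -[X in atan X]opprK atanN -mulNr opprB.
  by apply: cvgN; apply: cvg_atan_natM; rewrite subr_gt0 lt_neqAle h cy.
have -> : 2 * pi * \1_(`[a, b]%classic) y = (if y < b then pi else - pi) - (if y < a then pi else - pi) :> R.
  rewrite indicE; have -> : (y \in `[a, b]%classic) = (a <= y) && (y <= b).
    by apply/idP/idP; rewrite inE /= in_itv.
  case: (ltgtP y a) ya => // h _; case: (ltgtP y b) yb => // h' _ /=; lra.
by apply: cvgB; apply: key; rewrite eq_sym.
Qed.

Lemma measurable_atan_step (e a b : R) : measurable_fun setT (atan_step e a b).
Proof.
have ma (c : R) : measurable_fun setT (fun y : R => atan ((c - y) / e)).
  apply: measurableT_comp.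
    by apply: continuous_measurable_fun => x; exact: continuous_atan.
  by apply: measurable_funM => //; exact: measurable_funB.
by apply: measurable_funB; exact: measurable_funM.
Qed.

Lemma ae_neq2 (a b : R) : {ae mu, forall y, y != a /\ y != b}.
Proof.
exists ([set a] `|` [set b]); split.
- by apply: measurableU; exact: measurable_set1.
- apply/eqP; rewrite -measure_le0 (le_trans (measureU2 _ _ _))//=; try exact: measurable_set1.
  by rewrite !lebesgue_measure_set1 adde0.
- by move=> y /= /not_andP[] /negP; rewrite negbK => /eqP ->; [left|right].
Qed.

(** The averages of the Poisson integrals are bounded in L^2 by the energy of the
    transform. They converge to the averages of 2 pi g as the Poisson parameter
    tends to 0, and these to 2 pi g almost everywhere as the intervals shrink;
    Fatou's lemma is used for each of the two limits. *)
Lemma plancherel_lower g : mu.-integrable setT (EFin \o g) -> (sqint g < +oo)%E ->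
  (((2 * pi) ^+ 2)%:E * sqint g <= (4 * pi)%:E * \int[mu]_x (cosT g x ^+ 2 + sinT g x ^+ 2)%:E)%E.
Proof.
move=> gi g2; have mg := measurable_EFinW gi.
set B := ((4 * pi)%:E * _)%E.
have e0 n : 0 < n.+1%:R^-1 :> R by rewrite invr_gt0.
have -> : (((2 * pi) ^+ 2)%:E * sqint g = sqint (fun x => (2 * pi * g x)%R))%E.
  rewrite /sqint; under [RHS]eq_integral do rewrite exprMn EFinM.
  rewrite ge0_integralZl_EFin//; last 2 first.
  - by apply/measurable_EFinP; exact: measurable_funX.
  - by rewrite sqr_ge0.
  by move=> x _; rewrite lee_fin sqr_ge0.
(* The limit in the Poisson parameter, at a fixed length of the intervals. *)
have step (r : R) : 0 < r -> (sqint (fun z => (2 * pi * average r g z)%R) <= B)%E.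
  move=> r0; apply: (@fatou_le _ _ _ mu (fun n z => average r (poissonT n.+1%:R^-1 g) z ^+ 2)).
  - by move=> n; apply: measurable_funX; apply: measurable_average; exact: measurable_poissonT.
  - by apply: measurable_funX; apply: measurable_funM => //; exact: measurable_average.
  - by move=> n x; rewrite sqr_ge0.
  - by move=> x; rewrite sqr_ge0.
  - apply: aeW => z.
    have c : average r (poissonT n.+1%:R^-1 g) z @[n --> \oo] --> 2 * pi * average r g z.
      under eq_fun do rewrite average_poissonT//.
      rewrite /average mulrCA; apply: cvgM; first exact: cvg_cst.
      rewrite -RintegralZl//; last exact: integrable_window.
      have gpi : mu.-integrable setT (EFin \o (fun y => (2 * pi) * `|g y|)).
        by have := integrableZl measurableT (2 * pi) (integrable_norm gi).
      apply: (cvg_Rintegral _ _ gpi).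
      + move=> n; apply: measurable_funM => //; exact: measurable_atan_step.
      + apply: measurable_funM => //; apply: measurable_funM => //.
        by apply: measurableT_comp; [exact: measurable_window|exact: measurable_funB].
      + move=> n y; rewrite normrM ler_wpM2r//; exact: norm_atan_step_le.
      + have rr : z - r < z + r by lra.
        apply: filterS (ae_neq2 (z - r) (z + r)); first exact: (ae_filter_ringOfSetsType mu).
        move=> y [ya yb].
        rewrite windowE mulrA; apply: cvgM; last exact: cvg_cst.
        exact: cvg_atan_step.
    by apply: cvgM.
  - move=> n; apply: le_trans (sqint_poissonT_le (e0 n) gi g2).
    by apply: sqint_average_le => //; exact: measurable_poissonT.
apply: (@fatou_le _ _ _ mu (fun n z => (2 * pi * average n.+1%:R^-1 g z) ^+ 2)).
- by move=> n; apply: measurable_funX; apply: measurable_funM => //; exact: measurable_average.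
- by apply: measurable_funX; exact: measurable_funM.
- by move=> n x; rewrite sqr_ge0.
- by move=> x; rewrite sqr_ge0.
- apply: filterS (average_cvg gi); first exact: (ae_filter_ringOfSetsType mu).
  move=> z cz.
  by apply: cvgM; (apply: cvgM; [exact: cvg_cst|exact: cz]).
- by move=> n; exact: step.
Qed.

End plancherel_lower.

(** * The two Plancherel bounds for complex functions, on the line and on the plane *)

Section fourier1.
Context {R : realType}.
Local Notation mu := (@lebesgue_measure R).
Implicit Types g : R -> R[i].

Definition fourier1 g (x : R) : R[i] := cint mu (fun y => cis (x * y) * g y).

Lemma cosTN (g : R -> R) x : cosT g (- x) = cosT g x.
Proof. by apply: eq_Rintegral => y _; rewrite (mulNr x y) cosN. Qed.

Lemma sinTN (g : R -> R) x : mu.-integrable setT (EFin \o g) -> sinT g (- x) = - sinT g x.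
Proof.
move=> gi; rewrite -[RHS]mulN1r.
transitivity (\int[mu]_y (-1 * (sin (x * y) * g y))).
  by apply: eq_Rintegral => y _; rewrite (mulNr x y) sinN; ring.
by apply: RintegralZl => //; exact: integrable_sinM.
Qed.

Lemma fourier1_Re g x : cintegrable mu g -> complex.Re (fourier1 g x) =
  cosT (fun y => complex.Re (g y)) x - sinT (fun y => complex.Im (g y)) x.
Proof.
move=> gi; rewrite /= -RintegralB//.
- by apply: eq_Rintegral => y _; rewrite ReM.
- by apply: integrable_cosM; exact: cintegrable_Re.
- by apply: integrable_sinM; exact: cintegrable_Im.
Qed.

Lemma fourier1_Im g x : cintegrable mu g -> complex.Im (fourier1 g x) =
  cosT (fun y => complex.Im (g y)) x + sinT (fun y => complex.Re (g y)) x.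
Proof.
move=> gi; rewrite /= -RintegralD//.
- by apply: eq_Rintegral => y _; rewrite ImM.
- by apply: integrable_cosM; exact: cintegrable_Im.
- by apply: integrable_sinM; exact: cintegrable_Re.
Qed.

Lemma cmeas_fourier1 g : cmeas g -> cmeas (fourier1 g).
Proof.
move=> mg; apply: (@cmeas_cint_fst _ _ _ _ _ mu (fun z : R * R => cis (z.1 * z.2) * g z.2)).
apply: cmeasM; first by apply: cmeas_cis; exact: measurable_funM.
by case: mg => m1 m2; split; [exact: (measurable_prod_snd m1)|exact: (measurable_prod_snd m2)].
Qed.

Lemma ge0_integral_even_part (f h : R -> \bar R) : measurable_fun setT f -> measurable_fun setT h ->
  (forall x, 0 <= f x)%E -> (forall x, 0 <= h x)%E ->
  (forall x, f x + f (- x)%R = 2%:E * h x)%E -> (\int[mu]_x f x = \int[mu]_x h x)%E.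
Proof.
move=> mf mh f0 h0 fh.
have mfN : measurable_fun setT (fun x : R => f (- x)) by exact: measurableT_comp.
have e : (\int[mu]_x (f x + f (- x)%R) = 2%:E * \int[mu]_x h x)%E.
  by rewrite -ge0_integralZl_EFin//; apply: eq_integral => x _; exact: fh.
rewrite ge0_integralD// ge0_integral_oppr// in e.
have : ((2^-1)%:E * (\int[mu]_x f x + \int[mu]_x f x) = (2^-1)%:E * (2%:E * \int[mu]_x h x))%E.
  by rewrite e.
rewrite muleA -EFinM mulVf// mul1e => <-.
have I0 : (0 <= \int[mu]_x f x)%E by exact: integral_ge0.
have h2 : (2^-1 + 2^-1 : R) = 1 by field.
by rewrite ge0_muleDr// -ge0_muleDl ?lee_fin ?invr_ge0// -EFinD h2 mul1e.
Qed.

Lemma nrm2_ReIm d (T : measurableType d) (m : {measure set T -> \bar R}) (g : T -> R[i]) : cmeas g ->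
  nrm2 m g = (\int[m]_x (complex.Re (g x) ^+ 2)%:E + \int[m]_x (complex.Im (g x) ^+ 2)%:E)%E.
Proof.
move=> [g1 g2]; rewrite /nrm2; under eq_integral do rewrite EFinD.
rewrite ge0_integralD//.
- by move=> x _; rewrite lee_fin sqr_ge0.
- by apply/measurable_EFinP; exact: measurable_funX.
- by move=> x _; rewrite lee_fin sqr_ge0.
- by apply/measurable_EFinP; exact: measurable_funX.
Qed.

(** For g = a + i b the cross terms of |g^|^2 are odd in the frequency, since
    cosine transforms of real functions are even and sine transforms odd. So
    they cancel in the integral and the real case applies to a and to b. *)
Lemma nrm2_fourier1 g : cintegrable mu g -> nrm2 mu (fourier1 g) =
  (\int[mu]_x (cosT (fun y => complex.Re (g y)) x ^+ 2 + sinT (fun y => complex.Re (g y)) x ^+ 2)%:E +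
   \int[mu]_x (cosT (fun y => complex.Im (g y)) x ^+ 2 + sinT (fun y => complex.Im (g y)) x ^+ 2)%:E)%E.
Proof.
move=> gi; have mg := gi.1; have [m1 m2] := mg.
have i1 := cintegrable_Re gi; have i2 := cintegrable_Im gi.
rewrite -ge0_integralD//; last 4 first.
- by move=> x _; rewrite lee_fin addr_ge0// sqr_ge0.
- exact: measurable_energy.
- by move=> x _; rewrite lee_fin addr_ge0// sqr_ge0.
- exact: measurable_energy.
apply: ge0_integral_even_part.
- by apply/measurable_EFinP; apply: measurable_sqm; exact: cmeas_fourier1.
- by apply: emeasurable_funD; exact: measurable_energy.
- by move=> x; rewrite lee_fin sqm_ge0.
- by move=> x; rewrite -EFinD lee_fin !addr_ge0// sqr_ge0.
- move=> x; rewrite -!EFinD -EFinM; congr EFin.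
  by rewrite /sqm !fourier1_Re// !fourier1_Im// !cosTN !sinTN//; ring.
Qed.

Lemma sqint_le_nrm2 d (T : measurableType d) (m : {measure set T -> \bar R}) (g : T -> R[i]) :
  cmeas g -> (nrm2 m g < +oo)%E ->
  (\int[m]_x (complex.Re (g x) ^+ 2)%:E < +oo)%E /\ (\int[m]_x (complex.Im (g x) ^+ 2)%:E < +oo)%E.
Proof.
move=> mg; rewrite nrm2_ReIm// => h.
have a0 : (0 <= \int[m]_x (complex.Re (g x) ^+ 2)%:E)%E by apply: integral_ge0 => x _; rewrite lee_fin sqr_ge0.
have b0 : (0 <= \int[m]_x (complex.Im (g x) ^+ 2)%:E)%E by apply: integral_ge0 => x _; rewrite lee_fin sqr_ge0.
split; first exact: lte_summandl b0 _ h.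
by apply: lte_summandl a0 _ h; rewrite addeC.
Qed.

Lemma fourier1_upper g : cintegrable mu g ->
  (nrm2 mu (fourier1 g) <= (2 * pi)%:E * nrm2 mu g)%E.
Proof.
move=> gi; have pi2 : 0 < 2 * pi :> R by rewrite mulr_gt0// pi_gt0.
have [g2|] := ltP (nrm2 mu g) +oo%E; last first.
  by rewrite leye_eq => /eqP ->; rewrite gt0_muley ?lte_fin// leey.
have [s1 s2] := sqint_le_nrm2 gi.1 g2.
rewrite nrm2_fourier1// (nrm2_ReIm _ gi.1) ge0_muleDr; last 2 first.
- by apply: integral_ge0 => x _; rewrite lee_fin sqr_ge0.
- by apply: integral_ge0 => x _; rewrite lee_fin sqr_ge0.
apply: leeD.
- exact: (plancherel_upper (cintegrable_Re gi) s1).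
- exact: (plancherel_upper (cintegrable_Im gi) s2).
Qed.

Lemma fourier1_lower g : cintegrable mu g -> (nrm2 mu g < +oo)%E ->
  (pi%:E * nrm2 mu g <= nrm2 mu (fourier1 g))%E.
Proof.
move=> gi g2; have pi0 : 0 < pi :> R by exact: pi_gt0.
have [s1 s2] := sqint_le_nrm2 gi.1 g2.
have key (s X : \bar R) : (((2 * pi) ^+ 2)%:E * s <= (4 * pi)%:E * X -> pi%:E * s <= X)%E.
  move=> h; rewrite -(@lee_pmul2l _ (4 * pi)%:E) ?lte_fin ?mulr_gt0//.
  by rewrite muleA -EFinM; have -> : 4 * pi * pi = (2 * pi) ^+ 2 :> R by ring.
rewrite nrm2_fourier1// (nrm2_ReIm _ gi.1) ge0_muleDr; last 2 first.
- by apply: integral_ge0 => x _; rewrite lee_fin sqr_ge0.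
- by apply: integral_ge0 => x _; rewrite lee_fin sqr_ge0.
apply: leeD; apply: key.
- exact: (plancherel_lower (cintegrable_Re gi) s1).
- exact: (plancherel_lower (cintegrable_Im gi) s2).
Qed.

End fourier1.

Section slices.
Context {R : realType} d1 d2 (T1 : measurableType d1) (T2 : measurableType d2).
Variable m1 : {sigma_finite_measure set T1 -> \bar R}.
Variable m2 : {sigma_finite_measure set T2 -> \bar R}.

Lemma integrable_Rintegral_fst (f : T1 * T2 -> R) : (m1 \x m2)%E.-integrable setT (EFin \o f) ->
  m1.-integrable setT (EFin \o (fun x => \int[m2]_y f (x, y))).
Proof.
move=> fi; have mf : measurable_fun setT f by apply/measurable_EFinP; exact: measurable_int fi.
have Fi := integrable_fubini_F fi.
apply: le_integrable Fi => //.
  by apply/measurable_EFinP; exact: measurable_Rintegral_fst mf.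
by move=> x _; rewrite /= /Rintegral /fubini_F /=; case: (integral _ _ _) => //=; rewrite normr0 ?lee_fin// leey.
Qed.

Lemma cintegrable_cint_fst (f : T1 * T2 -> R[i]) : cintegrable (m1 \x m2)%E f ->
  cintegrable m1 (fun x => cint m2 (fun y => f (x, y))).
Proof.
move=> fi; have i1 := integrable_Rintegral_fst (cintegrable_Re fi).
have i2 := integrable_Rintegral_fst (cintegrable_Im fi).
apply: (cintegrable_le (g := fun x => `|\int[m2]_y complex.Re (f (x, y))| +
  `|\int[m2]_y complex.Im (f (x, y))|)).
- exact: cmeas_cint_fst fi.1.
- by have := integrableD measurableT (integrable_norm i1) (integrable_norm i2).
- by move=> x; exact: cmod_le_ReIm.
Qed.

Lemma cintegrable_slice_fst (f : T1 * T2 -> R[i]) : cintegrable (m1 \x m2)%E f ->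
  {ae m1, forall x, cintegrable m2 (fun y => f (x, y))}.
Proof.
move=> fi; apply: filterS (ae_integrable1 fi.2) => x xi; split => //.
have [f1 f2] := fi.1; split.
  exact: (measurableT_comp f1 (pair1_measurable x)).
exact: (measurableT_comp f2 (pair1_measurable x)).
Qed.

Lemma ae_lty_fst (f : T1 * T2 -> \bar R) : measurable_fun setT f -> (forall z, 0 <= f z)%E ->
  (\int[(m1 \x m2)%E]_z f z < +oo)%E -> {ae m1, forall x, (\int[m2]_y f (x, y) < +oo)%E}.
Proof.
move=> mf f0; rewrite (fubini_tonelli1 f mf f0) => foo.
have Fi : m1.-integrable setT (fun x => \int[m2]_y f (x, y))%E.
  apply/integrableP; split; first exact: measurable_fun_fubini_tonelli_F.
  by under eq_integral do rewrite gee0_abs ?integral_ge0//.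
apply: filterS (integrable_ae measurableT Fi) => x /(_ I) h.
by rewrite -ge0_fin_numE// integral_ge0.
Qed.

End slices.

Section fourier2.
Context {R : realType}.
Local Notation mu := (@lebesgue_measure R).
Local Notation mu2 := (@leb2 R).
Implicit Types g : R * R -> R[i].

Definition fourier2 g (x : R * R) : R[i] := cint mu2 (fun xi => cis (dot2 x xi) * g xi).

Definition half_fourier g (p : R * R) : R[i] := fourier1 (fun y => g (p.1, y)) p.2.

Lemma measurable_dot2 d (T : measurableType d) (f h : T -> R * R) :
  measurable_fun setT f -> measurable_fun setT h -> measurable_fun setT (fun x => dot2 (f x) (h x)).
Proof.
move=> mf mh; apply: measurable_funD; apply: measurable_funM; exact: measurableT_comp.
Qed.

Lemma cmeas_comp d d' (T : measurableType d) (T' : measurableType d') (f : T -> T') (g : T' -> R[i]) :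
  measurable_fun setT f -> cmeas g -> cmeas (fun x => g (f x)).
Proof. by move=> mf [g1 g2]; split; [exact: (measurableT_comp g1 mf)|exact: (measurableT_comp g2 mf)]. Qed.

Lemma cmeas_fourier2 g : cmeas g -> cmeas (fourier2 g).
Proof.
move=> mg; apply: (@cmeas_cint_fst _ _ _ _ _ mu2
  (fun z : (R * R) * (R * R) => cis (dot2 z.1 z.2) * g z.2)).
apply: cmeasM; last exact: cmeas_comp measurable_snd mg.
by apply: cmeas_cis; exact: measurable_dot2.
Qed.

Lemma cmeas_half_fourier g : cmeas g -> cmeas (half_fourier g).
Proof.
move=> mg; apply: (@cmeas_cint_fst _ _ _ _ _ mu
  (fun z : (R * R) * R => cis (z.1.2 * z.2) * g (z.1.1, z.2))).
have m11 : measurable_fun setT (fun z : (R * R) * R => z.1.1).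
  exact: (measurableT_comp measurable_fst measurable_fst).
have m12 : measurable_fun setT (fun z : (R * R) * R => z.1.2).
  exact: (measurableT_comp measurable_snd measurable_fst).
apply: cmeasM; first by apply: cmeas_cis; exact: measurable_funM.
by apply: (cmeas_comp (f := fun z : (R * R) * R => (z.1.1, z.2)) _ mg); exact: measurable_fun_pair.
Qed.

Lemma cintegrable_cisM d (T : measurableType d) (m : {measure set T -> \bar R}) (p : T -> R)
    (f : T -> R[i]) : measurable_fun setT p -> cintegrable m f ->
  cintegrable m (fun x => cis (p x) * f x).
Proof.
move=> mp; apply: (cintegrableM (C := 1)) => [|x]; last by rewrite cmod_cis.
exact: cmeas_cis.
Qed.

Lemma cintegrable_half_fourier g (x2 : R) : cintegrable mu2 g ->
  cintegrable mu (fun y => half_fourier g (y, x2)).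
Proof.
move=> gi; apply: (@cintegrable_cint_fst _ _ _ _ _ mu mu (fun z : R * R => cis (x2 * z.2) * g z)).
by apply: cintegrable_cisM gi; apply: measurable_funM.
Qed.

(** The plane transform is the transform on the line taken in one variable and
    then in the other, so the bounds on the line iterate. *)
Lemma fourier2_iter g (x1 x2 : R) : cintegrable mu2 g ->
  fourier2 g (x1, x2) = fourier1 (fun y => half_fourier g (y, x2)) x1.
Proof.
move=> gi; have dgi : cintegrable mu2 (fun xi => cis (dot2 (x1, x2) xi) * g xi).
  by apply: cintegrable_cisM gi; apply: measurable_dot2.
rewrite /fourier2 -(@cint12 _ _ _ _ _ mu mu _ dgi).
have ae1 : {ae mu, forall y, cintegrable mu (fun z => g (y, z))}.
  exact: (@cintegrable_slice_fst _ _ _ _ _ mu mu g gi).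
apply: ae_eq_cint.
- exact: (@cmeas_cint_fst _ _ _ _ _ mu _ dgi.1).
- apply: cmeasM; last exact: (cintegrable_half_fourier x2 gi).1.
  by apply: cmeas_cis; exact: measurable_funM.
- apply: filterS ae1; first exact: (ae_filter_ringOfSetsType mu).
  move=> y yi; rewrite /half_fourier /fourier1 /= -cintZ.
    by apply: eq_cint => z; rewrite /dot2 /= cisD mulrA.
  by apply: cintegrable_cisM yi; exact: measurable_funM.
Qed.

End fourier2.

Section plancherel2.
Context {R : realType}.
Local Notation mu := (@lebesgue_measure R).
Local Notation mu2 := (@leb2 R).
Implicit Types g : R * R -> R[i].

Lemma measurable_sqmE d (T : measurableType d) (g : T -> R[i]) : cmeas g ->
  measurable_fun setT (fun x => (sqm (g x))%:E).
Proof. by move=> mg; apply/measurable_EFinP; exact: measurable_sqm. Qed.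

Lemma sqmE_ge0 T (g : T -> R[i]) x : (0 <= (sqm (g x))%:E)%E.
Proof. by rewrite lee_fin sqm_ge0. Qed.

Lemma nrm2_xy g : cmeas g -> nrm2 mu2 g = (\int[mu]_x nrm2 mu (fun y => g (x, y)))%E.
Proof. by move=> mg; rewrite /nrm2 (tonelli_xy (measurable_sqmE mg) (sqmE_ge0 g)). Qed.

Lemma nrm2_yx g : cmeas g -> nrm2 mu2 g = (\int[mu]_y nrm2 mu (fun x => g (x, y)))%E.
Proof. by move=> mg; rewrite /nrm2 (tonelli_yx (measurable_sqmE mg) (sqmE_ge0 g)). Qed.

Lemma measurable_nrm2_x g : cmeas g -> measurable_fun setT (fun x => nrm2 mu (fun y => g (x, y)) : \bar R).
Proof. by move=> mg; exact: measurable_tonelli_x (measurable_sqmE mg) (sqmE_ge0 g). Qed.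

Lemma measurable_nrm2_y g : cmeas g -> measurable_fun setT (fun y => nrm2 mu (fun x => g (x, y)) : \bar R).
Proof. by move=> mg; exact: measurable_tonelli_y (measurable_sqmE mg) (sqmE_ge0 g). Qed.

Lemma ae_imply (P Q : R -> Prop) : {ae mu, forall x, P x} -> (forall x, P x -> Q x) ->
  {ae mu, forall x, Q x}.
Proof.
move=> [A [mA A0 sA]] PQ; exists A; split => // x nQ; apply: sA => Px.
exact: nQ (PQ _ Px).
Qed.

Lemma ae_imply2 (P P' Q : R -> Prop) : {ae mu, forall x, P x} -> {ae mu, forall x, P' x} ->
  (forall x, P x -> P' x -> Q x) -> {ae mu, forall x, Q x}.
Proof.
move=> hP hP' PQ; have := hP; apply: filterS2 hP'; first exact: (ae_filter_ringOfSetsType mu).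
by move=> x p' p; exact: PQ.
Qed.

Lemma nrm2_half_fourier_le g : cintegrable mu2 g ->
  (nrm2 mu2 (half_fourier g) <= (2 * pi)%:E * nrm2 mu2 g)%E.
Proof.
move=> gi; have pi2 : 0 <= 2 * pi :> R by rewrite mulr_ge0// pi_ge0.
have mh := cmeas_half_fourier gi.1; have m1 := measurable_nrm2_x mh; have m2 := measurable_nrm2_x gi.1.
rewrite (nrm2_xy mh) (nrm2_xy gi.1) -ge0_integralZl_EFin//; last by move=> x _; exact: nrm2_ge0.
apply: ae_ge0_le_integral => //.
- by move=> x _; exact: nrm2_ge0.
- by move=> x _; rewrite mule_ge0// nrm2_ge0.
- exact: emeasurable_funM.
- apply: (ae_imply (@cintegrable_slice_fst _ _ _ _ _ mu mu g gi)).
  by move=> x xi _; exact: fourier1_upper xi.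
Qed.

Lemma nrm2_half_fourier_ge g : cintegrable mu2 g -> (nrm2 mu2 g < +oo)%E ->
  (pi%:E * nrm2 mu2 g <= nrm2 mu2 (half_fourier g))%E.
Proof.
move=> gi g2; have pi0 : 0 <= pi :> R by exact: pi_ge0.
have mh := cmeas_half_fourier gi.1; have m1 := measurable_nrm2_x mh; have m2 := measurable_nrm2_x gi.1.
have := @ae_lty_fst _ _ _ _ _ mu mu _ (measurable_sqmE gi.1) (sqmE_ge0 g) g2 => ae2.
rewrite (nrm2_xy mh) (nrm2_xy gi.1) -ge0_integralZl_EFin//; last by move=> x _; exact: nrm2_ge0.
apply: ae_ge0_le_integral => //.
- by move=> x _; rewrite mule_ge0// nrm2_ge0.
- exact: emeasurable_funM.
- by move=> x _; exact: nrm2_ge0.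
- apply: (ae_imply2 ae2 (@cintegrable_slice_fst _ _ _ _ _ mu mu g gi)).
  by move=> x x2 xi _; exact: fourier1_lower xi x2.
Qed.

Lemma fourier2_upper g : cintegrable mu2 g ->
  (nrm2 mu2 (fourier2 g) <= ((2 * pi) ^+ 2)%:E * nrm2 mu2 g)%E.
Proof.
move=> gi; have pi2 : 0 <= 2 * pi :> R by rewrite mulr_ge0// pi_ge0.
have mh := cmeas_half_fourier gi.1; have mF := cmeas_fourier2 gi.1.
have mh1 := measurable_nrm2_y mh; have mF1 := measurable_nrm2_y mF.
apply: (@le_trans _ _ ((2 * pi)%:E * nrm2 mu2 (half_fourier g))%E); last first.
  rewrite expr2 (EFinM (2 * pi) (2 * pi)) -muleA lee_wpmul2l ?lee_fin//.
  exact: nrm2_half_fourier_le.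
rewrite (nrm2_yx mF) (nrm2_yx mh) -ge0_integralZl_EFin//; last by move=> x _; exact: nrm2_ge0.
apply: ge0_le_integral => //.
- by move=> x _; exact: nrm2_ge0.
- exact: emeasurable_funM.
- move=> y _; have := fourier1_upper (cintegrable_half_fourier y gi).
  have -> : fourier1 (fun x => half_fourier g (x, y)) = (fun x => fourier2 g (x, y)).
    by apply/funext => x; rewrite fourier2_iter.
  exact.
Qed.

Lemma fourier2_lower g : cintegrable mu2 g -> (nrm2 mu2 g < +oo)%E ->
  ((pi ^+ 2)%:E * nrm2 mu2 g <= nrm2 mu2 (fourier2 g))%E.
Proof.
move=> gi g2; have pi0 : 0 <= pi :> R by exact: pi_ge0.
have pi2 : 0 <= 2 * pi :> R by rewrite mulr_ge0.
have mh := cmeas_half_fourier gi.1; have mF := cmeas_fourier2 gi.1.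
have mh1 := measurable_nrm2_y mh; have mF1 := measurable_nrm2_y mF.
have h2 : (nrm2 mu2 (half_fourier g) < +oo)%E.
  by apply: le_lt_trans (nrm2_half_fourier_le gi) _; rewrite lte_mul_pinfty// lee_fin.
apply: (@le_trans _ _ (pi%:E * nrm2 mu2 (half_fourier g))%E).
  rewrite expr2 (EFinM pi pi) -muleA lee_wpmul2l ?lee_fin//.
  exact: nrm2_half_fourier_ge.
have mhs : cmeas (fun z : R * R => half_fourier g (z.2, z.1)).
  by apply: (cmeas_comp (f := fun z : R * R => (z.2, z.1)) _ mh); exact: measurable_fun_pair.
have h2' : (\int[mu2]_z (sqm (half_fourier g (z.2, z.1)))%:E < +oo)%E.
  rewrite (tonelli_xy (measurable_sqmE mhs) (fun z => sqmE_ge0 _ _)).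
  by move: h2; rewrite (nrm2_yx mh).
have := @ae_lty_fst _ _ _ _ _ mu mu _ (measurable_sqmE mhs) (fun z => sqmE_ge0 _ _) h2' => ae2.
rewrite (nrm2_yx mF) (nrm2_yx mh) -ge0_integralZl_EFin//; last by move=> x _; exact: nrm2_ge0.
apply: ae_ge0_le_integral => //.
- by move=> x _; rewrite mule_ge0// nrm2_ge0.
- exact: emeasurable_funM.
- by move=> x _; exact: nrm2_ge0.
- apply: (ae_imply ae2).
  move=> y y2 _; have := fourier1_lower (cintegrable_half_fourier y gi) y2.
  have -> : fourier1 (fun x => half_fourier g (x, y)) = (fun x => fourier2 g (x, y)).
    by apply/funext => x; rewrite fourier2_iter.
  exact.
Qed.

End plancherel2.

(** * The Schrodinger evolution of an admissible datum *)

Section schrodinger_basics.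
Context {R : realType}.
Local Notation mu := (@lebesgue_measure R).
Local Notation mu2 := (@leb2 R).
Implicit Types g : R * R -> R[i].

Lemma dot2_ge0 (x : R * R) : 0 <= dot2 x x.
Proof. by rewrite /dot2 -!expr2 addr_ge0// sqr_ge0. Qed.

Lemma enorm2_sqr (x : R * R) : enorm2 x ^+ 2 = dot2 x x.
Proof. by rewrite sqr_sqrtr// dot2_ge0. Qed.

Lemma enorm2_ge0 (x : R * R) : 0 <= enorm2 x.
Proof. exact: sqrtr_ge0. Qed.

Lemma annulus1P (x : R * R) : annulus1 x <-> 4^-1 <= dot2 x x <= 1.
Proof.
rewrite /annulus1 /= -enorm2_sqr; have := enorm2_ge0 x; set n := enorm2 x => n0.
have h4 : (4^-1 : R) = 2^-1 ^+ 2 by field.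
by rewrite h4; split => /andP[a b]; apply/andP; split; nra.
Qed.

Lemma schrodingerE g t x :
  schrodinger g t x = fourier2 (fun xi => cis (t * dot2 xi xi) * g xi) x.
Proof.
rewrite /schrodinger /fourier2; apply: (@eq_cint _ _ _ mu2) => xi.
by rewrite enorm2_sqr cisD mulrA.
Qed.

Lemma integrable_indicator d (T : measurableType d) (m : {measure set T -> \bar R}) (A : set T) :
  measurable A -> (m A < +oo)%E -> m.-integrable setT (EFin \o (\1_A : T -> R)).
Proof.
move=> mA Aoo; apply/integrableP; split; first by apply/measurable_EFinP; exact: measurable_indic.
under eq_integral do rewrite /= ger0_norm//.
by rewrite integral_indic ?setIT.
Qed.

Lemma leb2_box (a b c d : R) : a <= b -> c <= d ->
  mu2 (`[a, b]%classic `*` `[c, d]%classic) = ((b - a) * (d - c))%:E.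
Proof.
have E (u v : R) : u <= v -> mu (`[u, v]%classic) = (v - u)%:E.
  move=> uv; rewrite lebesgue_measure_itv /= lte_fin lt_neqAle uv andbT.
  by case: eqP => [->|_] //=; rewrite subrr.
move=> ab cd; have -> : mu2 (`[a, b]%classic `*` `[c, d]%classic) = (mu `[a, b]%classic * mu `[c, d]%classic)%E.
  by apply: product_measure1E; exact: measurable_itv.
by rewrite !E.
Qed.

Definition unit_box : set (R * R) := `[-1, 1]%classic `*` `[-1, 1]%classic.

Lemma measurable_unit_box : measurable (unit_box : set (measurableTypeR R * measurableTypeR R)).
Proof. by apply: measurableX. Qed.

Lemma integrable_unit_box : mu2.-integrable setT (EFin \o (\1_unit_box : R * R -> R)).
Proof.
apply: integrable_indicator; first exact: measurable_unit_box.
have h : -1 <= 1 :> R by lra.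
by apply: (@le_lt_trans _ _ ((1 - -1) * (1 - -1))%:E); [rewrite -(leb2_box h h)|exact: ltry].
Qed.

Lemma annulus1_unit_box (x : R * R) : annulus1 x -> unit_box x.
Proof. by move/annulus1P; rewrite /dot2 /unit_box /= !in_itv /= => h; split; nra. Qed.

(** Square-integrable Fourier transforms that vanish pointwise outside the
    annulus. Being integrable, they have an evolution defined by an absolutely
    convergent integral at every point and time. *)
Definition admissible g := [/\ cmeas g, (nrm2 mu2 g < +oo)%E & forall xi, ~ annulus1 xi -> g xi = 0].

Lemma admissible_cintegrable g : admissible g -> cintegrable mu2 g.
Proof.
move=> [mg g2 gs]; apply: (cintegrable_L2 ltr01 _ integrable_unit_box mg g2).
  by move=> x; rewrite indicE.
move=> x gx; rewrite indicE mem_set//; apply: annulus1_unit_box; apply: contrapT => /gs gx0.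
by rewrite gx0 eqxx in gx.
Qed.

Lemma measurable_annulus1 : measurable (annulus1 : set (measurableTypeR R * measurableTypeR R)).
Proof.
have mf : measurable_fun setT (fun x : R * R => dot2 x x) by exact: measurable_dot2.
have -> : annulus1 = (fun x : R * R => dot2 x x) @^-1` `[4^-1, 1]%classic.
  by apply/seteqP; split => x; rewrite /= in_itv /=; move/annulus1P.
by rewrite -[X in measurable X]setTI; apply: mf => //.
Qed.

Lemma cmeas_schrodinger g t : cmeas g -> cmeas (schrodinger g t).
Proof.
move=> mg; have -> : schrodinger g t = fourier2 (fun xi => cis (t * dot2 xi xi) * g xi).
  by apply/funext => x; exact: schrodingerE.
apply: cmeas_fourier2; apply: cmeasM => //; apply: cmeas_cis.
by apply: measurable_funM => //; exact: measurable_dot2.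
Qed.

Lemma sqm_cisM_nrm2 g (p : R * R -> R) : nrm2 mu2 (fun x => cis (p x) * g x) = nrm2 mu2 g.
Proof. by apply: eq_integral => x _; rewrite sqm_cisM. Qed.

Lemma admissible_cisM g (p : R * R -> R) : measurable_fun setT p -> admissible g ->
  admissible (fun x => cis (p x) * g x).
Proof.
move=> mp [mg g2 gs]; split; first by apply: cmeasM => //; exact: cmeas_cis.
- by rewrite sqm_cisM_nrm2.
- by move=> x /gs ->; rewrite mulr0.
Qed.

(** An enumeration of times in [0, T] that contains a dense subset of it. *)
Definition dense_time (T : R) (n : nat) : R :=
  if unpickle n is Some (i, j) then Num.min T (i%:R / (j : nat).+1%:R) else 0.

Lemma dense_time_itv (T : R) n : 0 <= T -> 0 <= dense_time T n <= T.
Proof.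
move=> T0; rewrite /dense_time; case: unpickle => [[i j]|]; last by rewrite lexx.
by rewrite le_min T0 divr_ge0//= ge_min lexx.
Qed.

Lemma dense_time_cvg (T t : R) : 0 <= t <= T ->
  dense_time T (pickle (Num.truncn (t * j.+1%:R), j)) @[j --> \oo] --> t.
Proof.
move=> /andP[t0 tT].
have c : t - j.+1%:R^-1 @[j --> \oo] --> t.
  by rewrite -[X in _ --> X]subr0; apply: cvgB; [exact: cvg_cst|exact: cvg_harmonic].
apply: (squeeze_cvgr _ c (cvg_cst t)); apply: nearW => j.
have j0 : 0 < j.+1%:R :> R by [].
have tj : 0 <= t * j.+1%:R by rewrite mulr_ge0.
have /andP[h1 h2] := truncn_itv tj.
set i := Num.truncn _ in h1 h2 *.
rewrite /dense_time pickleK.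
have it : i%:R / j.+1%:R <= t by rewrite ler_pdivrMr.
have -> : Num.min T (i%:R / j.+1%:R) = i%:R / j.+1%:R :> R.
  by apply/min_idPr; exact: le_trans it tT.
rewrite it andbT lerBlDr.
have -> : i%:R / j.+1%:R + j.+1%:R^-1 = i.+1%:R / j.+1%:R :> R.
  by rewrite -[i.+1%:R]natr1 mulrDl mul1r.
by rewrite ler_pdivlMr// ltW.
Qed.

(** The squared maximal function with the times restricted to a countable set,
    which makes it measurable without further argument. *)
Definition sup_sqm (T : R) g (x : R * R) : \bar R :=
  ereal_sup (range (fun n => (sqm (schrodinger g (dense_time T n) x))%:E)).

Lemma sup_sqm_ge0 T g x : (0 <= sup_sqm T g x)%E.
Proof. by apply: ereal_sup_ge; exists (sqm (schrodinger g (dense_time T 0) x))%:E; [exists 0%N|rewrite lee_fin sqm_ge0]. Qed.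

Lemma measurable_sup_sqm T g : cmeas g -> measurable_fun setT (sup_sqm T g).
Proof.
move=> mg.
have -> : sup_sqm T g = (fun x => esups (fun n => (sqm (schrodinger g (dense_time T n) x))%:E) 0).
  apply/funext => x; rewrite /sup_sqm /esups; congr ereal_sup.
  by apply/seteqP; split => [_ [n _ <-]|_ [n _ <-]]; exists n.
by apply: measurable_fun_esups => n; apply: measurable_sqmE; exact: cmeas_schrodinger.
Qed.

Lemma cvg_comp_real (h : R -> R) (u : nat -> R) (l : R) : continuous h ->
  u n @[n --> \oo] --> l -> h (u n) @[n --> \oo] --> h l.
Proof. by move=> ch ul; exact: (cvg_comp u h ul (ch l)). Qed.

Lemma schrodinger_time_cvg g x (t : R) (s : nat -> R) : admissible g -> s j @[j --> \oo] --> t ->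
  sqm (schrodinger g (s j) x) @[j --> \oo] --> sqm (schrodinger g t x).
Proof.
move=> ag st; have gi := admissible_cintegrable ag; have [mg _ _] := ag.
pose F (a : R) xi := cis (dot2 x xi + a * dot2 xi xi) * g xi.
have FE a : schrodinger g a x = cint mu2 (F a).
  by apply: (@eq_cint _ _ _ mu2) => xi; rewrite /F enorm2_sqr.
have mF a : cmeas (F a).
  apply: cmeasM => //; apply: cmeas_cis; apply: measurable_funD; first exact: measurable_dot2.
  by apply: measurable_funM => //; exact: measurable_dot2.
have cph xi : dot2 x xi + s j * dot2 xi xi @[j --> \oo] --> dot2 x xi + t * dot2 xi xi.
  by apply: cvgD; [exact: cvg_cst|apply: cvgM; [exact: st|exact: cvg_cst]].
have [|||cR cI] := @cvg_cint _ _ _ mu2 (fun j => F (s j)) (F t) (fun xi => cmod (g xi))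
  (fun j => mF (s j)) (mF t) gi.2.
- by move=> j xi; rewrite /F cmodM cmod_cis mul1r.
- move=> xi; rewrite /F; under eq_fun do rewrite ReM; rewrite ReM.
  apply: cvgB; (apply: cvgM; last exact: cvg_cst).
    by apply: cvg_comp_real (cph xi); exact: continuous_cos.
  by apply: cvg_comp_real (cph xi); exact: continuous_sin.
- move=> xi; rewrite /F; under eq_fun do rewrite ImM; rewrite ImM.
  apply: cvgD; (apply: cvgM; last exact: cvg_cst).
    by apply: cvg_comp_real (cph xi); exact: continuous_cos.
  by apply: cvg_comp_real (cph xi); exact: continuous_sin.
rewrite (_ : (fun j => _) = (fun j => sqm (cint mu2 (F (s j))))); last first.
  by apply/funext => j; rewrite FE.
by rewrite FE; apply: cvgD; apply: cvgM.
Qed.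

(** The evolution is continuous in time by dominated convergence, so the dense
    times have the same supremum as the whole interval. *)
Lemma sup_sqm_ub (T t : R) g x : admissible g -> 0 <= t <= T ->
  ((sqm (schrodinger g t x))%:E <= sup_sqm T g x)%E.
Proof.
move=> ag tT; have st := dense_time_cvg tT.
have := sup_sqm_ge0 T g x; case E : (sup_sqm T g x) => [r| |] //= r0; last by rewrite leey.
have c := schrodinger_time_cvg (x := x) ag st.
rewrite lee_fin -(cvg_lim _ c)//; apply: limr_le; first by apply/cvg_ex; eexists; exact: c.
apply: nearW => j; rewrite -lee_fin -E; apply: ereal_sup_ubound.
by exists (pickle (Num.truncn (t * j.+1%:R), j)).
Qed.

End schrodinger_basics.

(** * From norms of maximal functions to squared estimates on the Fourier side, and back *)

Section squared_estimates.
Context {R : realType}.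
Local Notation mu := (@lebesgue_measure R).
Local Notation mu2 := (@leb2 R).
Implicit Types g F : R * R -> R[i].

Lemma poweR_sqrtK (x : \bar R) : (0 <= x -> (x `^ 2^-1) `^ 2 = x)%E.
Proof. by move=> x0; rewrite -poweRrM mulVf// poweRe1. Qed.

Lemma poweR_sqrK (x : \bar R) : (0 <= x -> (x `^ 2) `^ 2^-1 = x)%E.
Proof. by move=> x0; rewrite -poweRrM mulfV// poweRe1. Qed.

Lemma le_poweR (r : R) (x y : \bar R) : 0 <= r -> (0 <= x)%E -> (x <= y)%E -> (x `^ r <= y `^ r)%E.
Proof.
move=> r0 x0 xy; apply: gt0_ler_poweR => //; rewrite in_itv /= leey andbT//.
exact: le_trans xy.
Qed.

Lemma poweR_cmod (z : R[i]) : (((cmod z)%:E `^ 2) = (sqm z)%:E)%E.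
Proof. by rewrite poweR_EFin powR_mulrn ?cmod_ge0// cmod_sqr. Qed.

Lemma L2normE (f : R * R -> R[i]) : L2norm f = (nrm2 mu2 f `^ 2^-1)%E.
Proof.
rewrite /L2norm unlock; congr (_ `^ _)%E; apply: eq_integral => x _.
by rewrite gee0_abs ?lee_fin ?cmod_ge0// poweR_cmod.
Qed.

Lemma schrodinger_max_sqr g T x : 0 <= T -> admissible g ->
  ((schrodinger_max g T x) `^ 2 = sup_sqm T g x)%E.
Proof.
move=> T0 ag; have S0 := sup_sqm_ge0 T g x.
have M0 : (0 <= schrodinger_max g T x)%E.
  apply: ereal_sup_ge; exists (cmod (schrodinger g 0 x))%:E; last by rewrite lee_fin cmod_ge0.
  by exists 0 => //=; rewrite in_itv /= lexx.
apply/eqP; rewrite eq_le; apply/andP; split.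
  rewrite -[leRHS]poweR_sqrtK//; apply: le_poweR => //.
  apply: ge_ereal_sup => _ [t /= tT <-].
  rewrite -[leLHS]poweR_sqrK ?lee_fin ?cmod_ge0//.
  apply: le_poweR; rewrite ?invr_ge0 ?poweR_ge0// poweR_cmod.
  by apply: sup_sqm_ub => //; move: tT; rewrite in_itv.
apply: ge_ereal_sup => _ [n _ <-]; rewrite -poweR_cmod.
apply: le_poweR; rewrite ?lee_fin ?cmod_ge0//; apply: ereal_sup_ubound.
by exists (dense_time T n) => //=; rewrite in_itv /=; exact: dense_time_itv.
Qed.

Lemma measurable_eball2 (r : R) :
  measurable (eball2 0 r : set (measurableTypeR R * measurableTypeR R)).
Proof.
have mf : measurable_fun setT (fun x : R * R => enorm2 x).
  have ms : measurable_fun setT (Num.sqrt : R -> R).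
    by apply: continuous_measurable_fun; exact: sqrt_continuous.
  have md : measurable_fun setT (fun x : R * R => dot2 x x) by exact: measurable_dot2.
  exact: (measurableT_comp ms md).
have -> : eball2 0 r = (fun x : R * R => enorm2 x) @^-1` `]-oo, r[%classic.
  by apply/seteqP; split => x; rewrite /eball2 /= in_itv /= subr0.
by rewrite -[X in measurable X]setTI; apply: mf.
Qed.

Lemma Lnorm_schrodinger_max g T r : 0 <= T -> admissible g ->
  ('N[mu2]_2%:E[schrodinger_max g T \_ (eball2 0%R r)] =
   (\int[mu2]_(x in eball2 0%R r) sup_sqm T g x) `^ 2^-1)%E.
Proof.
move=> T0 ag; rewrite unlock; congr (_ `^ _)%E.
rewrite [RHS]integral_mkcond; apply: eq_integral => x _; rewrite !patchE.
case: ifPn => _; last by rewrite abse0 poweR0r.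
rewrite -(schrodinger_max_sqr x T0 ag) gee0_abs//.
apply: ereal_sup_ge; exists (cmod (schrodinger g 0 x))%:E; last by rewrite lee_fin cmod_ge0.
by exists 0 => //=; rewrite in_itv /= lexx.
Qed.

Lemma ae_supported_fourier2 g (r : R) x : admissible g -> 1 < r ->
  cintegral (eball2 0 r) (fun xi => cis (dot2 x xi) * g xi) = fourier2 g x.
Proof.
move=> [mg g2 gs] r1.
have E xi : ~ eball2 0 r xi -> cis (dot2 x xi) * g xi = 0.
  move=> nb; rewrite gs ?mulr0// => /andP[_ h]; apply: nb.
  by rewrite /eball2 /= subr0 (le_lt_trans h).
apply: complex_ext => /=; rewrite Rintegral_mkcond; apply: eq_Rintegral => xi _;
  rewrite patchE; case: ifPn => // /negP h; rewrite E// => b; apply: h; exact/mem_set.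
Qed.

Lemma inL2P (f : R * R -> R[i]) : cmeas f -> (nrm2 mu2 f < +oo)%E -> inL2 f.
Proof.
move=> [f1 f2] foo; split; [exact: f1|exact: f2|].
by rewrite L2normE; exact: poweR_lty.
Qed.

Lemma fourier_transform_of_fourier2 g : admissible g -> fourier_transform_of (fourier2 g) g.
Proof.
move=> ag; have [mg g2 gs] := ag; have gi := admissible_cintegrable ag.
split.
- apply: inL2P; first exact: cmeas_fourier2.
  by apply: le_lt_trans (fourier2_upper gi) _; rewrite lte_mul_pinfty// lee_fin sqr_ge0.
- exact: inL2P.
- apply: (@cvg_trans _ (cst 0%E @ +oo)); last exact: cvg_cst.
  apply: near_eq_cvg; near=> r.
  have r1 : 1 < r by near: r; exact: nbhs_pinfty_gt.
  rewrite /cst L2normE /nrm2 integral0_eq ?poweR0r// => x _.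
  by rewrite (ae_supported_fourier2 _ ag r1) subrr sqm0.
Unshelve. all: by end_near.
Qed.

(** The maximal estimate squared, in terms of the Fourier transform of the datum:
    in this form the contributions of several data can be added. *)
Definition square_estimate (T r Q : R) := forall g, admissible g ->
  (\int[mu2]_(x in eball2 0%R r) sup_sqm T g x <= Q%:E * nrm2 mu2 g)%E.

Lemma int_sup_sqm_ge0 T g (D : set (R * R)) : (0 <= \int[mu2]_(x in D) sup_sqm T g x)%E.
Proof. by apply: integral_ge0 => x _; exact: sup_sqm_ge0. Qed.

(** An admissible g is the Fourier transform of the integral [fourier2 g], whose
    norm the upper Plancherel bound controls. *)
Lemma maximal_square_estimate (T r K : R) : 0 <= T -> 0 <= K ->
  maximal_estimate T r K -> square_estimate T r ((K * (2 * pi)) ^+ 2).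
Proof.
move=> T0 K0 hK g ag; have [mg g2 gs] := ag; have gi := admissible_cintegrable ag.
have supp : ae_supported annulus1 g by apply: aeW.
have := hK _ _ (fourier_transform_of_fourier2 ag) supp.
rewrite (Lnorm_schrodinger_max _ T0 ag) L2normE => h.
have I0 := int_sup_sqm_ge0 T g (eball2 0 r).
rewrite -[leLHS]poweR_sqrtK//; apply: le_trans (le_poweR _ (poweR_ge0 _ _) h) _ => //.
rewrite poweRM ?lee_fin ?poweR_ge0// poweR_sqrtK ?nrm2_ge0// poweR_EFin powR_mulrn//.
rewrite exprMn (EFinM (K ^+ 2)) -muleA lee_wpmul2l ?lee_fin ?sqr_ge0//.
exact: fourier2_upper.
Qed.

End squared_estimates.

Section from_square_estimates.
Context {R : realType}.
Local Notation mu := (@lebesgue_measure R).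
Local Notation mu2 := (@leb2 R).
Implicit Types f g F : R * R -> R[i].

Definition cut (S : set (R * R)) g (xi : R * R) : R[i] := ((\1_S xi : R)%:C)%C * g xi.

Lemma cut_in S g xi : S xi -> cut S g xi = g xi.
Proof. by move=> h; rewrite /cut indicE mem_set// mul1r. Qed.

Lemma cut_out S g xi : ~ S xi -> cut S g xi = 0.
Proof. by move=> h; rewrite /cut indicE memNset// mul0r. Qed.

Lemma cmeas_cut (S : set (R * R)) g :
  measurable (S : set (measurableTypeR R * measurableTypeR R)) -> cmeas g -> cmeas (cut S g).
Proof. by move=> mS mg; apply: cmeasM => //; apply: cmeas_real; exact: measurable_indic. Qed.

Lemma sqm_cut_le S g xi : sqm (cut S g xi) <= sqm (g xi).
Proof.
have [h|h] := pselect (S xi); first by rewrite cut_in.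
by rewrite cut_out// sqm0 sqm_ge0.
Qed.

Lemma le_nrm2 d (T : measurableType d) (m : {measure set T -> \bar R}) (h h' : T -> R[i]) :
  cmeas h -> cmeas h' -> (forall x, sqm (h x) <= sqm (h' x)) -> (nrm2 m h <= nrm2 m h')%E.
Proof.
move=> mh mh' le; apply: ge0_le_integral => //.
- by move=> x _; rewrite lee_fin sqm_ge0.
- exact: measurable_sqmE.
- exact: measurable_sqmE.
- by move=> x _; rewrite lee_fin.
Qed.

Lemma nrm2_cut_le S g : measurable (S : set (measurableTypeR R * measurableTypeR R)) -> cmeas g ->
  (nrm2 mu2 (cut S g) <= nrm2 mu2 g)%E.
Proof. by move=> mS mg; apply: le_nrm2 => //; [exact: cmeas_cut|move=> x; exact: sqm_cut_le]. Qed.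

Lemma inL2_cmeas f : inL2 f -> cmeas f /\ (nrm2 mu2 f < +oo)%E.
Proof.
move=> [f1 f2 f3]; split; first by split; [exact: f1|exact: f2].
by move: f3; rewrite L2normE; apply: lty_poweRy; rewrite invr_neq0.
Qed.

Lemma cmeasN d (T : measurableType d) (h : T -> R[i]) : cmeas h -> cmeas (fun x => - h x).
Proof.
move=> [h1 h2]; split.
  by under eq_fun do rewrite ReN; exact: measurable_funN h1.
by under eq_fun do rewrite ImN; exact: measurable_funN h2.
Qed.

Lemma nrm2_sub_eq0 f g : cmeas f -> cmeas g -> nrm2 mu2 (fun x => f x - g x) = 0%E ->
  nrm2 mu2 f = nrm2 mu2 g.
Proof.
move=> mf mg h0; have mfg := cmeasD mf (cmeasN mg).
have mE := measurable_sqmE mfg.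
have : (\int[mu2]_x `|(sqm (f x - g x))%:E| = 0)%E.
  by rewrite -[RHS]h0; apply: eq_integral => x _; rewrite gee0_abs ?lee_fin ?sqm_ge0.
move/(ae_eq_integral_abs mu2 measurableT mE) => [A [mA A0 sA]].
apply: ge0_ae_eq_integral => //.
- exact: measurable_sqmE.
- exact: measurable_sqmE.
- by move=> x _; exact: sqmE_ge0.
- by move=> x _; exact: sqmE_ge0.
- exists A; split => // x nx; apply: sA => /= hx; apply: nx => _.
  by have /sqm_eq0/subr0_eq -> : sqm (f x - g x) = 0 by case: (hx I).
Qed.

(** The support condition and the Fourier inversion formula hold only almost
    everywhere and in the L^2 sense. So the transform is first replaced by its
    cut-off to the annulus, which changes no integral; the datum then agrees
    almost everywhere with the transform of the cut-off, and the lower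
    Plancherel bound compares the norms. *)
Lemma square_maximal_estimate (T r Q K : R) : 0 <= T -> 0 <= K ->
  Q <= (K * pi) ^+ 2 -> square_estimate T r Q -> maximal_estimate T r K.
Proof.
move=> T0 K0 QK hQ f fhat [fL2 hL2 fcvg] supp.
have [mf foo] := inL2_cmeas fL2; have [mh hoo] := inL2_cmeas hL2.
(* g has an honest pointwise support, and equals fhat almost everywhere. *)
pose g := cut annulus1 fhat.
have mA := @measurable_annulus1 R.
have mg : cmeas g by exact: cmeas_cut.
have ag : admissible g.
  split => //; first exact: le_lt_trans (nrm2_cut_le mA mh) hoo.
  by move=> xi; exact: cut_out.
have gi := admissible_cintegrable ag.
have gE xi : (~ annulus1 xi -> fhat xi = 0) -> fhat xi = g xi.
  move=> h; have [a|a] := pselect (annulus1 xi); first by rewrite /g cut_in.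
  by rewrite /g cut_out// h.
have ghae (p : R * R -> R) : {ae mu2, forall xi, cis (p xi) * fhat xi = cis (p xi) * g xi}.
  move: supp => [A [mA' A0 sA]]; exists A; split => // xi nx; apply: sA => /= h; apply: nx.
  by rewrite /= -(gE _ h).
have eqcint (p : R * R -> R) : measurable_fun setT p ->
    cint mu2 (fun xi => cis (p xi) * fhat xi) = cint mu2 (fun xi => cis (p xi) * g xi).
  move=> mp; apply: ae_eq_cint; try (apply: cmeasM => //; exact: cmeas_cis).
  exact: ghae.
have md (x : R * R) : measurable_fun setT (fun xi => dot2 x xi) by exact: measurable_dot2.
have Sg t x : schrodinger fhat t x = schrodinger g t x.
  rewrite !schrodingerE.
  have E h : fourier2 (fun xi => cis (t * dot2 xi xi) * h xi) x =
      cint mu2 (fun xi => cis (dot2 x xi + t * dot2 xi xi) * h xi).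
    by apply: eq_cint => xi; rewrite cisD mulrA.
  rewrite !E; apply: eqcint; apply: measurable_funD => //.
  by apply: measurable_funM => //; exact: measurable_dot2.
have Mg : schrodinger_max fhat T = schrodinger_max g T.
  apply/funext => x; rewrite /schrodinger_max; congr ereal_sup.
  by apply/seteqP; split => _ [t tT <-]; exists t; rewrite // Sg.
have cutball (s : R) x : 1 < s ->
    cintegral (eball2 0 s) (fun xi => cis (dot2 x xi) * fhat xi) = fourier2 g x.
  move=> s1; rewrite -(ae_supported_fourier2 x ag s1).
  have mb := @measurable_eball2 R s.
  have E h : cmeas h -> cintegral (eball2 0 s) (fun xi => cis (dot2 x xi) * h xi) =
      cint mu2 (fun xi => cis (dot2 x xi) * cut (eball2 0 s) h xi).
    move=> _; apply: complex_ext => /=; rewrite Rintegral_mkcond; apply: eq_Rintegral => xi _;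
      rewrite patchE; case: ifPn => b.
    - by rewrite cut_in//; exact/set_mem.
    - by rewrite cut_out ?mulr0// => b'; move/negP: b; apply; exact/mem_set.
    - by rewrite cut_in//; exact/set_mem.
    - by rewrite cut_out ?mulr0// => b'; move/negP: b; apply; exact/mem_set.
  rewrite !E//; apply: ae_eq_cint.
  - by apply: cmeasM; [exact: cmeas_cis (md x)|exact: cmeas_cut].
  - by apply: cmeasM; [exact: cmeas_cis (md x)|exact: cmeas_cut].
  - move: supp => [A [mA' A0 sA]]; exists A; split => // xi nx; apply: sA => /= h; apply: nx.
    by rewrite /= /cut -/(cut annulus1 fhat xi) -/(g xi) -(gE _ h).
have fg : nrm2 mu2 (fun x => f x - fourier2 g x) = 0%E.
  have c2 : L2norm (fun x => f x - cintegral (eball2 0 s) (fun xi => cis (dot2 x xi) * fhat xi))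
      @[s --> +oo] --> L2norm (fun x => f x - fourier2 g x).
    apply: (@cvg_trans _ (cst (L2norm (fun x => f x - fourier2 g x)) @ +oo)); last exact: cvg_cst.
    apply: near_eq_cvg; near=> s.
    have s1 : 1 < s by near: s; exact: nbhs_pinfty_gt.
    by rewrite /cst; congr L2norm; apply/funext => x; rewrite cutball.
  have : L2norm (fun x => f x - fourier2 g x) = 0%E.
    by apply: (cvg_unique _ c2 fcvg); exact: ereal_hausdorff.
  by rewrite L2normE; apply: poweR_eq0_eq0; exact: nrm2_ge0.
have fE := nrm2_sub_eq0 mf (cmeas_fourier2 mg) fg.
rewrite Mg (Lnorm_schrodinger_max _ T0 ag) L2normE fE.
have -> : (K%:E * nrm2 mu2 (fourier2 g) `^ 2^-1 = ((K ^+ 2)%:E * nrm2 mu2 (fourier2 g)) `^ 2^-1)%E.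
  rewrite poweRM ?lee_fin ?sqr_ge0 ?nrm2_ge0//; congr (_ * _)%E.
  by rewrite -[LHS]poweR_sqrK ?lee_fin// poweR_EFin powR_mulrn.
apply: le_poweR; rewrite ?invr_ge0 ?int_sup_sqm_ge0//.
apply: le_trans (hQ _ ag) _.
apply: (@le_trans _ _ (((K * pi) ^+ 2)%:E * nrm2 mu2 g)%E).
  by apply: lee_wpmul2r; rewrite ?nrm2_ge0// lee_fin.
rewrite exprMn (EFinM (K ^+ 2)) -muleA lee_wpmul2l ?lee_fin ?sqr_ge0//.
by have [_ g2 _] := ag; exact: fourier2_lower.
Unshelve. all: by end_near.
Qed.

End from_square_estimates.

(** * The exponential series with geometric control *)

Section exponential_series.
Context {R : realType}.

(** The m-th term of the exponential series of i th, whose real and imaginary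
    parts are the terms of the cosine and sine series. *)
Definition cis_coeff (m : nat) (th : R) : R[i] := Complex (cos_coeff th m) (sin_coeff th m).

Lemma cis_coeffM (m : nat) (s th : R) : cis_coeff m (s * th) = ((s ^+ m)%:C)%C * cis_coeff m th.
Proof.
apply: complex_ext; rewrite ?ReM ?ImM /= /cos_coeff /sin_coeff /= exprMn; ring.
Qed.

Lemma cmod_cis_coeff (m : nat) (th : R) : cmod (cis_coeff m th) <= `|th| ^+ m.
Proof.
apply: cmod_le; first by rewrite exprn_ge0.
have f0 : 0 < m`!%:R :> R by rewrite ltr0n fact_gt0.
have f1 : 1 <= m`!%:R :> R by rewrite ler1n fact_gt0.
have i1 : (m`!%:R : R)^-1 <= 1 by rewrite invf_le1.
have i0 : 0 < (m`!%:R : R)^-1 by rewrite invr_gt0.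
have i2 : (m`!%:R^-1 : R) ^+ 2 <= 1 by rewrite expr_le1// ltW.
have sgn k : ((-1) ^+ k : R) ^+ 2 = 1 by rewrite sqrr_sign.
have sgn' k : (((-1) ^ (k : nat)) : R) ^+ 2 = 1 by rewrite -[(-1) ^ k]/((-1) ^+ k) sqrr_sign.
rewrite -normrX real_normK ?num_real// /sqm /cis_coeff /= /cos_coeff /sin_coeff /=.
have p0 : 0 <= (th ^+ m) ^+ 2 by rewrite sqr_ge0.
by case: (odd m) => /=; rewrite !mul0r ?mul1r ?expr0n /= ?add0r ?addr0 !exprMn ?sgn ?sgn' mul1r ler_piMr.
Qed.

Lemma Re_cis_coeff_sum (th : R) :
  complex.Re (\sum_(m < M) cis_coeff m th) @[M --> \oo] --> cos th.
Proof.
under eq_fun do rewrite Re_sum /=.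
rewrite cos.unlock; have := @is_cvg_series_cos_coeff R th.
rewrite /series /=; under eq_fun do rewrite big_mkord.
exact.
Qed.

Lemma Im_cis_coeff_sum (th : R) :
  complex.Im (\sum_(m < M) cis_coeff m th) @[M --> \oo] --> sin th.
Proof.
under eq_fun do rewrite Im_sum /=.
rewrite sin.unlock; have := @is_cvg_series_sin_coeff R th.
rewrite /series /=; under eq_fun do rewrite big_mkord.
exact.
Qed.

Lemma cmod_sum_le (M : nat) (a : nat -> R[i]) :
  cmod (\sum_(m < M) a m) <= \sum_(m < M) cmod (a m).
Proof.
elim: M => [|M ih]; first by rewrite !big_ord0 cmod0.
by rewrite !big_ord_recr /= (le_trans (cmodD_le _ _))// lerD2r.
Qed.

Lemma geometric_half_le (M : nat) : \sum_(m < M) (2^-1 : R) ^+ m <= 2.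
Proof.
have : \sum_(m < M) (2^-1 : R) ^+ m = 2 - 2 * 2^-1 ^+ M.
  elim: M => [|M ih]; first by rewrite big_ord0 expr0; ring.
  by rewrite big_ord_recr /= ih exprS; field.
by move=> ->; rewrite gerBl mulr_ge0// exprn_ge0.
Qed.

Lemma cmod_cis_coeff_sum_le (M : nat) (th : R) : `|th| <= 2^-1 ->
  cmod (\sum_(m < M) cis_coeff m th) <= 2.
Proof.
move=> h; apply: le_trans (cmod_sum_le M (fun m => cis_coeff m th)) _.
apply: le_trans (geometric_half_le M); apply: ler_sum => m _.
by apply: le_trans (cmod_cis_coeff _ _) _; rewrite lerXn2r ?nnegrE.
Qed.

(** Cauchy-Schwarz with weights 2^-(m+1), whose sum is at most 1. *)
Lemma sqm_sum_le (M : nat) (a : nat -> R[i]) :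
  sqm (\sum_(m < M) a m) <= \sum_(m < M) 2 ^+ m.+1 * sqm (a m).
Proof.
elim: M a => [|M ih] a; first by rewrite !big_ord0 sqm0.
rewrite !big_ord_recl /= expr1; apply: le_trans (sqmD_le _ _) _.
rewrite lerD2l; have := ih (fun m => a m.+1) => h.
apply: le_trans (_ : 2 * \sum_(m < M) 2 ^+ m.+1 * sqm (a m.+1) <= _); first by rewrite ler_pM2l.
rewrite mulr_sumr; apply: ler_sum => m _ /=.
by rewrite /bump /= add1n (exprS _ m.+1) mulrA.
Qed.

Lemma measurable_cis_coeff d (T : measurableType d) (f : T -> R) (m : nat) :
  measurable_fun setT f -> cmeas (fun x => cis_coeff m (f x)).
Proof.
move=> mf; split => /=; rewrite /cos_coeff /sin_coeff /=.
  by apply: measurable_funM => //; apply: measurable_funM => //; exact: measurable_funX.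
by apply: measurable_funM => //; apply: measurable_funM => //; exact: measurable_funX.
Qed.

End exponential_series.

(** * Localizing the frequencies to a box of side 1/N *)

Section localization.
Context {R : realType}.
Local Notation mu := (@lebesgue_measure R).
Local Notation mu2 := (@leb2 R).
Local Notation mu4 := (@leb2 R \x @leb2 R)%E.
Local Notation R4 := ((R * R) * (R * R))%type.
Variables (N : R) (B S : set (R * R)).
Hypothesis N_gt0 : 0 < N.
Hypothesis mB : measurable (B : set (measurableTypeR R * measurableTypeR R)).
Hypothesis Boo : (mu2 B < +oo)%E.
Hypothesis BS_annulus : forall zeta xi, B (zeta - xi) -> S xi -> annulus1 zeta.
Hypothesis BS_phase : forall zeta xi, B (zeta - xi) -> S xi ->
  `|N * (dot2 xi xi - dot2 zeta zeta)| <= 2^-1.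
Implicit Types g : R * R -> R[i].

Definition supported_in g := forall xi, ~ S xi -> g xi = 0.

Definition window2 (z : R4) : R := \1_B (z.1 - z.2).

Definition phase_gap (z : R4) : R := N * (dot2 z.2 z.2 - dot2 z.1 z.1).

Definition layer_kernel (m : nat) g (z : R4) : R[i] :=
  ((window2 z)%:C)%C * (cis_coeff m (phase_gap z) * g z.2).

(** The m-th term of the expansion of the evolution in powers of t / N: a local
    integral of g over zeta - B, which no longer depends on the time. *)
Definition layer (m : nat) g (zeta : R * R) : R[i] :=
  cint mu2 (fun xi => layer_kernel m g (zeta, xi)).

Lemma measurable_window2B : measurable_fun setT window2.
Proof.
have mI : measurable_fun setT (\1_B : R * R -> R) by exact: measurable_indic.
apply: (measurableT_comp mI); apply: measurable_addp => //.
by apply: measurable_oppp.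
Qed.

Lemma measurable_phase_gap : measurable_fun setT phase_gap.
Proof. by apply: measurable_funM => //; apply: measurable_funB; exact: measurable_dot2. Qed.

Lemma window2_ge0 z : 0 <= window2 z.
Proof. by rewrite /window2 indicE. Qed.

Lemma window2_in z : window2 z != 0 -> B (z.1 - z.2).
Proof. by rewrite /window2 indicE; case: (boolP (_ \in _)) => [/set_mem //|_]; rewrite eqxx. Qed.

Lemma ge0_integral_window2 (xi : R * R) (h : R * R -> \bar R) :
  measurable_fun setT h -> (forall x, 0 <= h x)%E ->
  (\int[mu2]_zeta ((window2 (zeta, xi))%:E * h (zeta - xi)%R) = \int[mu2]_eta ((\1_B eta)%:E * h eta))%E.
Proof.
move=> mh h0.
apply: (@ge0_integral_shift2 _ (fun eta => (\1_B eta)%:E * h eta)%E (- xi)).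
  by apply: emeasurable_funM => //; apply/measurable_EFinP; exact: measurable_indic.
by move=> x; rewrite mule_ge0// lee_fin indicE.
Qed.

Lemma integral_window2 (xi : R * R) : (\int[mu2]_zeta (window2 (zeta, xi))%:E = mu2 B)%E.
Proof.
have := @ge0_integral_window2 xi (fun=> 1%E) (measurable_cst _) (fun=> lee01).
under eq_integral do rewrite mule1.
move=> ->; under eq_integral do rewrite mule1.
by rewrite integral_indic// setIT.
Qed.

Lemma integrable_window2 g : cintegrable mu2 g ->
  mu4.-integrable setT (EFin \o (fun z : R4 => window2 z * cmod (g z.2))).
Proof.
move=> [mg gi]; have mw := measurable_window2B.
have mc : measurable_fun setT (fun xi => cmod (g xi)) by exact: measurable_cmod.
have mc2 : measurable_fun setT (fun z : R4 => cmod (g z.2)) by exact: measurableT_comp mc measurable_snd.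
have mE : measurable_fun setT (EFin \o (fun z : R4 => window2 z * cmod (g z.2))).
  by apply/measurable_EFinP; exact: measurable_funM.
apply/integrable21ltyP => //.
have E xi : (\int[mu2]_zeta `|(EFin \o (fun z : R4 => (window2 z * cmod (g z.2))%R)) (zeta, xi)| =
    (cmod (g xi))%:E * mu2 B)%E.
  rewrite -(integral_window2 xi) -ge0_integralZl_EFin//.
  - by apply: eq_integral => zeta _; rewrite /= ger0_norm ?mulr_ge0 ?window2_ge0 ?cmod_ge0// mulrC EFinM.
  - by move=> zeta _; rewrite lee_fin window2_ge0.
  - apply/measurable_EFinP; exact: (measurableT_comp mw (pair2_measurable xi)).
  - exact: cmod_ge0.
under eq_integral do rewrite E.
rewrite ge0_integralZr//.
- rewrite lte_mul_pinfty//.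
  + by apply: integral_ge0 => xi _; rewrite lee_fin cmod_ge0.
  + rewrite ge0_fin_numE; last by apply: integral_ge0 => xi _; rewrite lee_fin cmod_ge0.
    have [_] := integrableP _ _ _ gi.
    by under eq_integral do rewrite gee0_abs ?lee_fin ?cmod_ge0//.
- exact/measurable_EFinP.
- by move=> xi _; rewrite lee_fin cmod_ge0.
Qed.

Lemma cmeas_layer_kernel m g : cmeas g -> cmeas (layer_kernel m g).
Proof.
move=> mg; apply: cmeasM; first by apply: cmeas_real; exact: measurable_window2B.
apply: cmeasM; first by apply: measurable_cis_coeff; exact: measurable_phase_gap.
exact: cmeas_comp measurable_snd mg.
Qed.

Lemma layer_kernel0 m g z : supported_in g -> ~ (B (z.1 - z.2) /\ S z.2) -> layer_kernel m g z = 0.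
Proof.
move=> gS h; rewrite /layer_kernel; have [|/window2_in Bz] := eqVneq (window2 z) 0.
  by move=> ->; rewrite mul0r.
by rewrite gS ?mulr0// => Sz; apply: h.
Qed.

Lemma phase_gap_le z : B (z.1 - z.2) -> S z.2 -> `|phase_gap z| <= 2^-1.
Proof. exact: BS_phase. Qed.

(** The phase gap being at most 1/2, the m-th term of the exponential series is
    at most 2^-m. *)
Lemma cmod_layer_kernel_le m g z : supported_in g ->
  cmod (layer_kernel m g z) <= 2^-1 ^+ m * (window2 z * cmod (g z.2)).
Proof.
move=> gS; have r0 : 0 <= 2^-1 ^+ m * (window2 z * cmod (g z.2)).
  by rewrite !mulr_ge0 ?exprn_ge0 ?window2_ge0 ?cmod_ge0.
have [[Bz Sz]|h] := pselect (B (z.1 - z.2) /\ S z.2); last by rewrite (layer_kernel0 m gS h) cmod0.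
rewrite /layer_kernel !cmodM cmod_real ?window2_ge0// mulrCA ler_wpM2r ?mulr_ge0 ?window2_ge0 ?cmod_ge0//.
apply: le_trans (cmod_cis_coeff _ _) _.
by rewrite lerXn2r ?nnegrE// phase_gap_le.
Qed.

Lemma cintegrable_layer_kernel m g : supported_in g -> cintegrable mu2 g ->
  cintegrable mu4 (layer_kernel m g).
Proof.
move=> gS gi; have wi := integrable_window2 gi.
apply: (@cintegrable_le _ _ _ mu4 _ (fun z : R4 => 2^-1 ^+ m * (window2 z * cmod (g z.2)))).
- exact: cmeas_layer_kernel gi.1.
- by have := integrableZl measurableT (2^-1 ^+ m) wi.
- by move=> z; exact: cmod_layer_kernel_le.
Qed.

Lemma cmeas_layer m g : cmeas g -> cmeas (layer m g).
Proof. by move=> mg; apply: (@cmeas_cint_fst _ _ _ _ _ mu2); exact: cmeas_layer_kernel. Qed.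

Lemma layer_supported m g zeta : supported_in g -> ~ annulus1 zeta -> layer m g zeta = 0.
Proof.
move=> gS nA; rewrite /layer -[RHS](cint0 mu2); apply: eq_cint => xi.
by rewrite layer_kernel0// => -[Bz Sz]; apply: nA; exact: BS_annulus Bz Sz.
Qed.

Lemma schrodinger_layer m g t x : supported_in g -> cintegrable mu2 g ->
  schrodinger (layer m g) t x =
  cint mu4 (fun z => cis (dot2 x z.1 + t * dot2 z.1 z.1) * layer_kernel m g z).
Proof.
move=> gS gi; have ki := cintegrable_layer_kernel m gS gi.
have mp : measurable_fun setT (fun z : R4 => dot2 x z.1 + t * dot2 z.1 z.1).
  apply: measurable_funD; first exact: measurable_dot2.
  by apply: measurable_funM => //; exact: measurable_dot2.
have ci := cintegrable_cisM (m := mu4) mp ki.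
rewrite -(@cint12 _ _ _ _ _ mu2 mu2 _ ci).
transitivity (cint mu2 (fun zeta => cis (dot2 x zeta + t * dot2 zeta zeta) * layer m g zeta)).
  by apply: (@eq_cint _ _ _ mu2) => zeta; rewrite enorm2_sqr.
have ae1 := @cintegrable_slice_fst _ _ _ _ _ mu2 mu2 _ ki.
have mq : measurable_fun setT (fun zeta : R * R => dot2 x zeta + t * dot2 zeta zeta).
  apply: measurable_funD; first exact: measurable_dot2.
  by apply: measurable_funM => //; exact: measurable_dot2.
apply: ae_eq_cint.
- by apply: cmeasM; [exact: cmeas_cis mq|exact: cmeas_layer gi.1].
- exact: (@cmeas_cint_fst _ _ _ _ _ mu2 _ ci.1).
- apply: filterS ae1 => zeta zi /=.
  by rewrite -cintZ.
Qed.

Definition window_transform (x : R * R) : R[i] := cint mu2 (fun eta => cis (dot2 x eta) * ((\1_B eta : R)%:C)%C).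

(** Integrating in zeta first, the substitution zeta = xi + eta separates the
    window from the evolution of g. *)
Lemma window_schrodinger g t x : cintegrable mu2 g ->
  cint mu4 (fun z => cis (dot2 x z.1) * (((window2 z)%:C)%C * (cis (t * dot2 z.2 z.2) * g z.2))) =
  window_transform x * schrodinger g t x.
Proof.
move=> gi; have mg := gi.1.
have mt : measurable_fun setT (fun z : R4 => t * dot2 z.2 z.2).
  by apply: measurable_funM => //; exact: measurable_dot2.
have mx : measurable_fun setT (fun z : R4 => dot2 x z.1) by exact: measurable_dot2.
have ci : cintegrable mu4 (fun z => cis (dot2 x z.1) * (((window2 z)%:C)%C * (cis (t * dot2 z.2 z.2) * g z.2))).
  apply: cintegrable_cisM => //.
  apply: (cintegrable_le _ (integrable_window2 gi)).
    apply: cmeasM; first by apply: cmeas_real; exact: measurable_window2B.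
    by apply: cmeasM; [exact: cmeas_cis|exact: cmeas_comp measurable_snd mg].
  by move=> z; rewrite !cmodM cmod_cis mul1r cmod_real ?window2_ge0.
rewrite -(@cint21 _ _ _ _ _ mu2 mu2 _ ci) /=.
have mW (y : R * R) : cmeas (fun eta : R * R => cis (dot2 y eta) * ((\1_B eta : R)%:C)%C).
  apply: cmeasM; first by apply: cmeas_cis; exact: measurable_dot2.
  by apply: cmeas_real; exact: measurable_indic.
have iB : mu2.-integrable setT (EFin \o (\1_B : R * R -> R)) by exact: integrable_indicator.
have iW (y : R * R) : cintegrable mu2 (fun eta : R * R => cis (dot2 y eta) * ((\1_B eta : R)%:C)%C).
  apply: (cintegrable_le _ iB) => [|eta]; first exact: mW.
  by rewrite cmodM cmod_cis mul1r cmod_real.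
transitivity (cint mu2 (fun xi => window_transform x * (cis (dot2 x xi + t * enorm2 xi ^+ 2) * g xi))).
  apply: (@eq_cint _ _ _ mu2) => xi.
  transitivity (cint mu2 (fun zeta => (cis (t * dot2 xi xi) * g xi) * cis (dot2 x xi) *
      (cis (dot2 x (zeta - xi)) * ((\1_B (zeta - xi) : R)%:C)%C))).
    apply: (@eq_cint _ _ _ mu2) => zeta.
    have -> : cis (dot2 x zeta) = cis (dot2 x xi) * cis (dot2 x (zeta - xi)).
      by rewrite -cisD; congr cis; rewrite /dot2 /=; ring.
    by rewrite /window2 /=; ring.
  have shiftE := cint_shift2 (- xi) (mW x).
  rewrite -/(window_transform x) in shiftE.
  have iS : cintegrable mu2 (fun zeta : R * R => cis (dot2 x (zeta - xi)) * ((\1_B (zeta - xi) : R)%:C)%C).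
    have ii : mu2.-integrable setT (EFin \o (fun zeta => window2 (zeta, xi))).
      apply/integrableP; split.
        by apply/measurable_EFinP; exact: (measurableT_comp measurable_window2B (pair2_measurable xi)).
      under eq_integral do rewrite gee0_abs ?lee_fin ?window2_ge0//.
      by rewrite integral_window2.
    apply: (cintegrable_le _ ii) => [|zeta].
      apply: cmeas_comp (mW x); apply: measurable_addp => //.
    by rewrite cmodM cmod_cis mul1r cmod_real.
  rewrite cintZ// shiftE enorm2_sqr cisD; ring.
rewrite cintZ//.
apply: cintegrable_cisM gi; apply: measurable_funD; first exact: measurable_dot2.
by under eq_fun do rewrite enorm2_sqr; apply: measurable_funM => //; exact: measurable_dot2.
Qed.

(** The exponential series of the phase t (|xi|^2 - |zeta|^2) = (t / N) phase_gap
    converges under the double integral by dominated convergence, and term by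
    term it is the evolution of the layers. *)
Lemma localized_series_cvg g t x : supported_in g -> cintegrable mu2 g -> 0 <= t <= N ->
  sqm (\sum_(m < M) (((t / N) ^+ m)%:C)%C * schrodinger (layer m g) t x) @[M --> \oo] -->
  sqm (window_transform x * schrodinger g t x).
Proof.
move=> gS gi /andP[t0 tN]; have mg := gi.1.
have s0 : 0 <= t / N by rewrite divr_ge0// ltW.
have s1 : t / N <= 1 by rewrite ler_pdivrMr// mul1r.
pose c z := cis (dot2 x z.1 + t * dot2 z.1 z.1) * (((window2 z)%:C)%C * g z.2).
(* F M is the integrand with the exponential series truncated to M terms. *)
pose F (M : nat) z := c z * \sum_(m < M) cis_coeff m (t / N * phase_gap z).
have mp : measurable_fun setT (fun z : R4 => dot2 x z.1 + t * dot2 z.1 z.1).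
  apply: measurable_funD; first exact: measurable_dot2.
  by apply: measurable_funM => //; exact: measurable_dot2.
have mc : cmeas c.
  apply: cmeasM; first exact: cmeas_cis.
  apply: cmeasM; first by apply: cmeas_real; exact: measurable_window2B.
  exact: cmeas_comp measurable_snd mg.
have mgap : measurable_fun setT (fun z : R4 => t / N * phase_gap z).
  by apply: measurable_funM => //; exact: measurable_phase_gap.
have PE M : \sum_(m < M) (((t / N) ^+ m)%:C)%C * schrodinger (layer m g) t x = cint mu4 (F M).
  have ki m := cintegrable_layer_kernel m gS gi.
  under eq_bigr do rewrite schrodinger_layer//.
  have ci (m : nat) := cintegrable_cisM (m := mu4) mp (ki m).
  under eq_bigr do rewrite -cintZ//.
  rewrite -(@cint_sum _ _ _ mu4 _ _ (fun (m : 'I_M) z => (((t / N) ^+ m)%:C)%C *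
    (cis (dot2 x z.1 + t * dot2 z.1 z.1) * layer_kernel m g z))); last first.
    by move=> m; exact: cintegrableZ.
  apply: (@eq_cint _ _ _ mu4) => z; rewrite /F mulr_sumr; apply: eq_bigr => m _.
  by rewrite cis_coeffM /c /layer_kernel; ring.
have lE : window_transform x * schrodinger g t x = cint mu4 (fun z => c z * cis (t / N * phase_gap z)).
  rewrite -window_schrodinger//; apply: (@eq_cint _ _ _ mu4) => z.
  have -> : t / N * phase_gap z = t * dot2 z.2 z.2 - t * dot2 z.1 z.1.
    by rewrite /phase_gap mulrA divfK ?gt_eqF// mulrBr.
  rewrite /c cisD.
  have -> : cis (t * dot2 z.2 z.2) = cis (t * dot2 z.1 z.1) * cis (t * dot2 z.2 z.2 - t * dot2 z.1 z.1).
    by rewrite -cisD; congr cis; ring.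
  ring.
have di : mu4.-integrable setT (EFin \o (fun z : R4 => 2 * (window2 z * cmod (g z.2)))).
  by have := integrableZl measurableT 2 (integrable_window2 gi).
have dom M z : cmod (F M z) <= 2 * (window2 z * cmod (g z.2)).
  have r0 : 0 <= 2 * (window2 z * cmod (g z.2)) by rewrite !mulr_ge0 ?window2_ge0 ?cmod_ge0.
  rewrite /F cmodM /c cmodM cmod_cis mul1r cmodM cmod_real ?window2_ge0//.
  have [[Bz Sz]|h] := pselect (B (z.1 - z.2) /\ S z.2).
    rewrite mulrC ler_wpM2r ?mulr_ge0 ?window2_ge0 ?cmod_ge0//.
    apply: cmod_cis_coeff_sum_le; rewrite normrM ger0_norm//.
    by apply: le_trans (phase_gap_le Bz Sz); rewrite ler_piMl.
  have -> : window2 z * cmod (g z.2) = 0.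
    have [->|/window2_in Bz] := eqVneq (window2 z) 0; first by rewrite mul0r.
    by rewrite gS ?cmod0 ?mulr0// => Sz; apply: h.
  by rewrite mul0r mulr0.
have mF M : cmeas (F M).
  by apply: cmeasM => //; apply: cmeas_sum => m; exact: measurable_cis_coeff.
have [||cR cI] := @cvg_cint _ _ _ mu4 F (fun z => c z * cis (t / N * phase_gap z)) (fun z : R4 => 2 * (window2 z * cmod (g z.2))) mF (cmeasM mc (cmeas_cis mgap)) di dom.
- move=> z; rewrite /F; under eq_fun do rewrite ReM; rewrite ReM.
  apply: cvgB; (apply: cvgM; first exact: cvg_cst).
    exact: Re_cis_coeff_sum.
  exact: Im_cis_coeff_sum.
- move=> z; rewrite /F; under eq_fun do rewrite ImM; rewrite ImM.
  apply: cvgD; (apply: cvgM; first exact: cvg_cst).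
    exact: Im_cis_coeff_sum.
  exact: Re_cis_coeff_sum.
rewrite lE (_ : (fun M : nat => _) = (fun M => sqm (cint mu4 (F M)))); last first.
  by apply/funext => M; rewrite PE.
by apply: cvgD; apply: cvgM.
Qed.

(** The time enters the expansion only through the evolution of the layers and
    the scalars (t / N)^m <= 1, so the supremum in time passes to the layers;
    the weights are those of [sqm_sum_le]. *)
Lemma sup_sqm_layers g x (c0 : R) : supported_in g -> cintegrable mu2 g -> 0 < c0 ->
  c0 <= sqm (window_transform x) ->
  (c0%:E * sup_sqm N g x <= \sum_(0 <= m <oo) ((2 ^+ m.+1)%:E * sup_sqm N (layer m g) x))%E.
Proof.
move=> gS gi c00 cA; set Z := (\sum_(0 <= m <oo) _)%E.
have tm0 m : (0 <= (2 ^+ m.+1)%:E * sup_sqm N (layer m g) x)%E.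
  by rewrite mule_ge0 ?sup_sqm_ge0// lee_fin exprn_ge0.
have Z0 : (0 <= Z)%E by apply: nneseries_ge0.
rewrite -lee_pdivlMl//; apply: ge_ereal_sup => _ [n _ <-].
rewrite lee_pdivlMl// -EFinM.
have tN := dense_time_itv n (ltW N_gt0); set t := dense_time N n in tN *.
have part M : ((sqm (\sum_(m < M) (((t / N) ^+ m)%:C)%C * schrodinger (layer m g) t x))%:E <= Z)%E.
  apply: le_trans (nneseries_lim_ge M _) => //.
  rewrite big_mkord; apply: le_trans (_ : (\sum_(m < M) (2 ^+ m.+1 * sqm ((((t / N) ^+ m)%:C)%C * schrodinger (layer m g) t x))%:E <= _)%E).
    by rewrite sumEFin lee_fin; exact: (sqm_sum_le M (fun m => (((t / N) ^+ m)%:C)%C * schrodinger (layer m g) t x)).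
  apply: lee_sum => m _; rewrite EFinM lee_wpmul2l ?lee_fin ?exprn_ge0//.
  apply: le_trans (_ : (sqm (schrodinger (layer m g) t x))%:E <= _)%E; last first.
    by apply: ereal_sup_ubound; exists n.
  rewrite lee_fin sqmM sqm_real ler_piMl ?sqm_ge0// -exprM exprn_ile1//.
    by case/andP: tN => t0 _; rewrite divr_ge0// ltW.
  by case/andP: tN => _ tN; rewrite ler_pdivrMr// mul1r.
have c := localized_series_cvg (x := x) gS gi tN.
case: Z Z0 part => [z| |] // _ part; last by rewrite leey.
rewrite lee_fin; apply: le_trans (_ : sqm (window_transform x * schrodinger g t x) <= z).
  by rewrite sqmM ler_wpM2r ?sqm_ge0.
by rewrite -(cvg_lim _ c)//; apply: limr_le; [apply/cvg_ex; eexists; exact: c|apply: nearW => M; rewrite -lee_fin].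
Qed.

Lemma sqm_layer_kernel_le m g z : supported_in g ->
  sqm (layer_kernel m g z) <= 4^-1 ^+ m * (window2 z * sqm (g z.2)).
Proof.
move=> gS; apply: le_trans (sqm_le (cmod_layer_kernel_le m z gS)) _.
rewrite !exprMn cmod_sqr -exprM mulnC exprM (_ : 2^-1 ^+ 2 = 4^-1 :> R); last by field.
rewrite ler_wpM2l ?exprn_ge0// ler_wpM2r ?sqm_ge0//.
by rewrite /window2 indicE; case: (_ \in _); rewrite /= ?expr1n ?expr0n.
Qed.

Lemma integral_window2_sqm g : cmeas g ->
  (\int[mu2]_zeta \int[mu2]_xi (window2 (zeta, xi) * sqm (g xi))%:E = mu2 B * nrm2 mu2 g)%E.
Proof.
move=> mg; have ms := measurable_sqm mg; have mw := measurable_window2B.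
have ms2 : measurable_fun setT (fun z : R4 => sqm (g z.2)) by exact: measurableT_comp ms measurable_snd.
have mE : measurable_fun setT (fun z : R4 => (window2 z * sqm (g z.2))%:E).
  by apply/measurable_EFinP; exact: measurable_funM.
have := @fubini_tonelli _ _ _ _ _ mu2 mu2 _ mE (fun z => _) => ->; last first.
  by move=> z; rewrite lee_fin mulr_ge0 ?window2_ge0 ?sqm_ge0.
rewrite /nrm2 -ge0_integralZl//; last 2 first.
- exact/measurable_EFinP.
- by move=> xi _; rewrite lee_fin sqm_ge0.
apply: eq_integral => xi _; rewrite -(integral_window2 xi) -ge0_integralZr//.
- apply/measurable_EFinP; exact: (measurableT_comp mw (pair2_measurable xi)).
- by move=> zeta _; rewrite lee_fin window2_ge0.
- by rewrite lee_fin sqm_ge0.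
Qed.

Definition modulate (q : R * R -> R) g (xi : R * R) : R[i] := cis (q xi) * g xi.

Variables (n : nat) (p : 'I_n -> R * R -> R) (M : R).
Hypothesis M_ge0 : 0 <= M.
Hypothesis mp : forall j, measurable_fun setT (p j).
Hypothesis bessel_p : forall zeta h, cmeas h -> (nrm2 mu2 h < +oo)%E ->
  (forall xi, h xi != 0 -> B (zeta - xi) /\ S xi) ->
  \sum_j sqm (cint mu2 (fun xi => cis (p j xi) * h xi)) <= M * (\int[mu2]_xi sqm (h xi))%R.

Let beta : R := fine (mu2 B).

Lemma fineB : beta%:E = mu2 B.
Proof. by rewrite fineK// ge0_fin_numE. Qed.

(** At a fixed zeta the layers of the modulated functions are the coefficients of
    one function supported in zeta - B, so Bessel's inequality applies; the
    integral in zeta of the resulting bound is the measure of B times the norm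
    of g. *)
Lemma layer_bessel m g : supported_in g -> cmeas g -> (nrm2 mu2 g < +oo)%E ->
  (\sum_j nrm2 mu2 (layer m (modulate (p j) g)) <=
   (M * 4^-1 ^+ m * beta)%:E * nrm2 mu2 g)%E.
Proof.
move=> gS mg goo; have mw := measurable_window2B; have ms := measurable_sqm mg.
have mk := cmeas_layer_kernel m mg.
pose h zeta xi := layer_kernel m g (zeta, xi).
have mh zeta : cmeas (h zeta) by apply: (cmeas_comp (pair1_measurable zeta) mk).
have hle zeta xi : sqm (h zeta xi) <= 4^-1 ^+ m * (window2 (zeta, xi) * sqm (g xi)).
  exact: sqm_layer_kernel_le.
have mws zeta : measurable_fun setT (fun xi : R * R => (window2 (zeta, xi) * sqm (g xi))%:E).
  apply/measurable_EFinP; apply: measurable_funM => //.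
  exact: (measurableT_comp mw (pair1_measurable zeta)).
have ws0 zeta xi : (0 <= (window2 (zeta, xi) * sqm (g xi))%:E)%E.
  by rewrite lee_fin mulr_ge0 ?window2_ge0 ?sqm_ge0.
have I0 zeta : (0 <= \int[mu2]_xi (window2 (zeta, xi) * sqm (g xi))%:E)%E.
  by apply: integral_ge0 => xi _.
have nh zeta : (nrm2 mu2 (h zeta) <= (4^-1 ^+ m)%:E * \int[mu2]_xi (window2 (zeta, xi) * sqm (g xi))%:E)%E.
  rewrite -ge0_integralZl_EFin ?exprn_ge0// /nrm2; last exact: mws.
  apply: (@ge0_le_integral _ _ _ mu2 setT measurableT) => //.
  - by move=> xi _; rewrite lee_fin sqm_ge0.
  - exact: measurable_sqmE (mh zeta).
  - by apply: measurable_funeM; exact: mws.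
  - by move=> xi _; rewrite -EFinM lee_fin.
have w1 z : window2 z <= 1 by rewrite /window2 indicE; case: (_ \in _).
have hoo zeta : (nrm2 mu2 (h zeta) < +oo)%E.
  apply: le_lt_trans (nh zeta) _; apply: (@le_lt_trans _ _ ((4^-1 ^+ m)%:E * nrm2 mu2 g)%E).
    apply: lee_wpmul2l; first by rewrite lee_fin exprn_ge0.
    rewrite /nrm2; apply: (@ge0_le_integral _ _ _ mu2 setT measurableT) => //.
    - exact: mws.
    - exact: measurable_sqmE mg.
    - by move=> xi _; rewrite lee_fin ler_piMl ?sqm_ge0.
  by rewrite lte_mul_pinfty ?lee_fin ?exprn_ge0.
have slice zeta : (\sum_j (sqm (layer m (modulate (p j) g) zeta))%:E <=
    (M * 4^-1 ^+ m)%:E * \int[mu2]_xi (window2 (zeta, xi) * sqm (g xi))%:E)%E.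
  have hs xi : h zeta xi != 0 -> B (zeta - xi) /\ S xi.
    by move=> h0; apply: contrapT => /(layer_kernel0 m (z := (zeta, xi)) gS) h1; rewrite /h h1 eqxx in h0.
  have := bessel_p (mh zeta) (hoo zeta) hs.
  rewrite -lee_fin EFinM (EFin_Rintegral_sqm (mu := mu2) (mh zeta) (hoo zeta)) => b.
  rewrite EFinM -muleA.
  apply: le_trans (lee_wpmul2l _ (nh zeta)); last by rewrite lee_fin.
  apply: le_trans b; rewrite sumEFin lee_fin; apply: ler_sum => j _.
  rewrite /layer (_ : cint _ _ = cint mu2 (fun xi => cis (p j xi) * h zeta xi))//.
  by apply: (@eq_cint _ _ _ mu2) => xi; rewrite /h /layer_kernel /modulate /=; ring.
have mI : measurable_fun setT (fun zeta => \int[mu2]_xi (window2 (zeta, xi) * sqm (g xi))%:E)%E.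
  apply: (@measurable_fun_fubini_tonelli_F _ _ _ _ _ mu2 (fun z : R4 => (window2 z * sqm (g z.2))%:E)).
    apply/measurable_EFinP; apply: measurable_funM => //.
    exact: measurableT_comp ms measurable_snd.
  by move=> z; rewrite lee_fin mulr_ge0 ?window2_ge0 ?sqm_ge0.
have mgj j : cmeas (modulate (p j) g) by apply: cmeasM => //; exact: cmeas_cis.
rewrite /nrm2 -ge0_integral_sum//; last first.
- by move=> j xi _; rewrite lee_fin sqm_ge0.
- by move=> j; apply: measurable_sqmE; exact: cmeas_layer.
apply: (@le_trans _ _ (\int[mu2]_zeta ((M * 4^-1 ^+ m)%:E * \int[mu2]_xi (window2 (zeta, xi) * sqm (g xi))%:E))%E).
  apply: (@ge0_le_integral _ _ _ mu2 setT measurableT) => //.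
  - by move=> x _; apply: sume_ge0 => j _; rewrite lee_fin sqm_ge0.
  - by apply: emeasurable_sum => j; apply: measurable_sqmE; exact: cmeas_layer.
  - exact: measurable_funeM mI.
rewrite ge0_integralZl_EFin ?mulr_ge0 ?exprn_ge0//.
by rewrite integral_window2_sqm// -fineB muleA -EFinM.
Qed.

Lemma layer_admissible m g j : supported_in g -> cmeas g -> (nrm2 mu2 g < +oo)%E ->
  admissible (layer m (modulate (p j) g)).
Proof.
move=> gS mg goo; split.
- by apply: cmeas_layer; apply: cmeasM => //; exact: cmeas_cis.
- apply: (@le_lt_trans _ _ (\sum_j nrm2 mu2 (layer m (modulate (p j) g)))%E).
    rewrite (bigD1 j)//= leeDl// sume_ge0// => i _; exact: nrm2_ge0.
  apply: le_lt_trans (layer_bessel m gS mg goo) _.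
  by rewrite lte_mul_pinfty ?lee_fin ?mulr_ge0 ?exprn_ge0 ?fine_ge0.
- by move=> xi nA; apply: layer_supported => // z Sz; rewrite /modulate gS ?mulr0.
Qed.

(** Each layer is admissible, so the estimate at scale N applies to it. The loss
    2^(m+1) of the triangle inequality is beaten by the gain 4^-m of the layers,
    and \sum_m 2^(m+1) 4^-m <= 4. *)
Lemma localized_transference (K c0 : R) g : 0 <= K -> 0 < c0 ->
  (forall x, eball2 0 N x -> c0 <= sqm (window_transform x)) ->
  square_estimate N N K -> supported_in g -> admissible g ->
  (\sum_j \int[mu2]_(x in eball2 0%R N) sup_sqm N (modulate (p j) g) x <=
   (4 * K * M * beta / c0)%:E * nrm2 mu2 g)%E.
Proof.
move=> K0 c00 cA hK gS ag; have [mg goo _] := ag.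
have beta0 : 0 <= beta by exact: fine_ge0.
have ag' j : admissible (modulate (p j) g) by exact: admissible_cisM.
have gS' j : supported_in (modulate (p j) g) by move=> xi nS; rewrite /modulate gS ?mulr0.
have alay m j : admissible (layer m (modulate (p j) g)) by exact: layer_admissible.
set D := eball2 0 N; have mD : measurable (D : set (measurableTypeR R * measurableTypeR R)) by exact: measurable_eball2.
have term0 m j x : (0 <= (2 ^+ m.+1)%:E * sup_sqm N (layer m (modulate (p j) g)) x)%E.
  by rewrite mule_ge0 ?sup_sqm_ge0// lee_fin exprn_ge0.
have msup m j : measurable_fun D (sup_sqm N (layer m (modulate (p j) g))).
  by apply: (@measurable_funS _ _ _ _ setT) => //; apply: measurable_sup_sqm; case: (alay m j).
have one j : (c0%:E * \int[mu2]_(x in D) sup_sqm N (modulate (p j) g) x <=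
    \sum_(0 <= m <oo) ((2 ^+ m.+1 * K)%:E * nrm2 mu2 (layer m (modulate (p j) g))))%E.
  have mg' : measurable_fun D (sup_sqm N (modulate (p j) g)).
    by apply: (@measurable_funS _ _ _ _ setT) => //; apply: measurable_sup_sqm; case: (ag' j).
  rewrite -ge0_integralZl_EFin ?(ltW c00)//; last by move=> x _; exact: sup_sqm_ge0.
  apply: (@le_trans _ _ (\int[mu2]_(x in D) \sum_(0 <= m <oo) ((2 ^+ m.+1)%:E * sup_sqm N (layer m (modulate (p j) g)) x))%E).
    apply: (@ge0_le_integral _ _ _ mu2 D mD) => //.
    - by move=> x _; rewrite mule_ge0 ?sup_sqm_ge0// lee_fin (ltW c00).
    - exact: measurable_funeM mg'.
    - by apply: ge0_emeasurable_sum => [m x _ _|m _]; [exact: term0|exact: measurable_funeM (msup m j)].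
    - move=> x Dx; apply: sup_sqm_layers => //; last exact: cA.
      exact: admissible_cintegrable.
  rewrite integral_nneseries//; last by move=> m; exact: measurable_funeM (msup m j).
  apply: lee_nneseries => m; first by move=> _ _; apply: integral_ge0 => x _; exact: term0.
  have msj := msup m j.
  move=> _; rewrite ge0_integralZl_EFin ?exprn_ge0//; last by move=> x _; exact: sup_sqm_ge0.
  by rewrite EFinM -muleA lee_wpmul2l ?lee_fin ?exprn_ge0// hK.
rewrite -(@lee_pmul2l _ c0%:E)// muleA -EFinM [c0 * _]mulrC divfK ?gt_eqF//.
rewrite ge0_sume_distrr; last by move=> j _; exact: int_sup_sqm_ge0.
apply: le_trans (lee_sum _ (fun j _ => one j)) _.
rewrite -nneseries_sum; last first.
  by move=> j m _; rewrite mule_ge0 ?nrm2_ge0// lee_fin mulr_ge0 ?exprn_ge0.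
have fin : (nrm2 mu2 g = (fine (nrm2 mu2 g))%:E) by rewrite fineK// ge0_fin_numE// nrm2_ge0.
have r0 : 0 <= fine (nrm2 mu2 g) by rewrite fine_ge0// nrm2_ge0.
set r := fine _ in fin r0.
have C0 : 0 <= K * M * beta * r by rewrite !mulr_ge0.
apply: (@le_trans _ _ (\sum_(0 <= m <oo) (2 * 2^-1 ^+ m * (K * M * beta * r))%:E)%E).
  apply: lee_nneseries => m.
    by move=> _ _; apply: sume_ge0 => j _; rewrite mule_ge0 ?nrm2_ge0// lee_fin mulr_ge0 ?exprn_ge0.
  move=> _; rewrite -ge0_sume_distrr; last by move=> j _; exact: nrm2_ge0.
  apply: le_trans (lee_wpmul2l _ (layer_bessel m gS mg goo)) _.
    by rewrite lee_fin mulr_ge0 ?exprn_ge0.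
  rewrite fin -!EFinM lee_fin.
  have -> : 4^-1 = 2^-1 * 2^-1 :> R by field.
  rewrite exprMn exprS; have : 2 ^+ m * 2^-1 ^+ m = 1 :> R by rewrite -exprMn mulfV// expr1n.
  move: (2 ^+ m) (2^-1 ^+ m) => a b ab.
  rewrite (_ : 2 * a * K * (M * (b * b) * beta * r) = (a * b) * (2 * b * (K * M * beta * r))); last by ring.
  by rewrite ab mul1r.
apply: lime_le.
  by apply: is_cvg_nneseries => m _ _; rewrite lee_fin mulr_ge0// mulr_ge0// exprn_ge0.
apply: nearW => m; rewrite sumEFin big_mkord fin -EFinM lee_fin -mulr_suml -mulr_sumr.
rewrite (_ : 4 * K * M * beta * r = 2 * 2 * (K * M * beta * r)); last by ring.
by rewrite ler_wpM2r// ler_wpM2l// geometric_half_le.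
Qed.

End localization.

(** * Orthogonality of modulations over a full period *)

Section orthogonality.
Context {R : realType}.
Local Notation mu := (@lebesgue_measure R).
Local Notation mu2 := (@leb2 R).

Lemma cis_period (m : int) (th : R) : cis (th + m%:~R * (2 * pi)) = cis th.
Proof.
have one (x : R) : cis (x + 2 * pi) = cis x.
  have -> : x + 2 * pi = x + pi + pi by ring.
  by rewrite /cis !cosDpi !sinDpi !opprK.
have nat_case (n : nat) (x : R) : cis (x + n%:R * (2 * pi)) = cis x.
  elim: n => [|n ih]; first by rewrite mul0r addr0.
  by rewrite -natr1 mulrDl mul1r addrA one.
case: m => n; first exact: nat_case.
by rewrite -[LHS](nat_case n.+1) NegzE mulrNz mulNr subrK.
Qed.

(** The integrand is the derivative of cis (m phi) / (i m), which takes the same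
    value at both ends. The derivative of the phase serves as the weight, which
    makes a quadratic phase as good as a linear one. *)
Lemma full_period (phi dphi : R -> R) (a b : R) (m : int) : a < b ->
  (forall x : R, is_derive x 1 phi (dphi x)) -> continuous dphi ->
  phi b - phi a = 2 * pi -> m != 0 ->
  cint mu (fun v : R => cis (m%:~R * phi v) * ((dphi v * \1_(`[a, b]%classic) v)%:C)%C) = 0.
Proof.
move=> ab dp cp period m0; set c : R := m%:~R.
have c0 : c != 0 by rewrite intr_eq0.
have cf : continuous phi := is_derive_continuous dp.
have dg (x : R) : is_derive x 1 (fun v : R => c * phi v) (c * dphi x).
  by have := @is_deriveZ _ _ _ phi c x 1 (dphi x) (dp x).
have cg : continuous (fun v : R => c * phi v) := is_derive_continuous dg.
have Ecis : cis (c * phi b) = cis (c * phi a).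
  have -> : phi b = phi a + 2 * pi by rewrite -period; ring.
  by rewrite mulrDr cis_period.
have restrict (f : R -> R) : (\int[mu]_x (f x * (dphi x * \1_(`[a, b]%classic) x)))%R =
    (\int[mu]_(x in `[a, b]) (f x * dphi x))%R.
  rewrite [RHS]Rintegral_mkcond; apply: eq_Rintegral => x _.
  by rewrite patchE indicE mulrA; case: (_ \in _); rewrite ?mulr1 ?mulr0.
have dsin (x : R) : is_derive x 1 (fun v : R => c^-1 * sin (c * phi v)) (cos (c * phi x) * dphi x).
  have h := @is_derive1_comp R sin (fun v : R => c * phi v) x _ _ (is_derive_sin (c * phi x)) (dg x).
  have := is_deriveZ c^-1 h; rewrite /GRing.scale /=.
  by rewrite (_ : c^-1 * (cos (c * phi x) * (c * dphi x)) = cos (c * phi x) * dphi x)//; field.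
have dcos (x : R) : is_derive x 1 (fun v : R => - c^-1 * cos (c * phi v)) (sin (c * phi x) * dphi x).
  have h := @is_derive1_comp R cos (fun v : R => c * phi v) x _ _ (is_derive_cos (c * phi x)) (dg x).
  have := is_deriveZ (- c^-1) h; rewrite /GRing.scale /=.
  by rewrite (_ : - c^-1 * (- sin (c * phi x) * (c * dphi x)) = sin (c * phi x) * dphi x)//; field.
have Ecos : cos (c * phi b) = cos (c * phi a) by have := congr1 (@complex.Re R) Ecis.
have Esin : sin (c * phi b) = sin (c * phi a) by have := congr1 (@complex.Im R) Ecis.
apply: complex_ext => /=.
  under eq_Rintegral do rewrite mulr0 subr0.
  rewrite restrict /Rintegral (@ftc_segment _ _ _ a b ab dsin); first by rewrite /= Esin subrr.
  move=> x; apply: continuousM; last exact: cp.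
  by apply: (@continuous_comp _ _ _ (fun x : R => c * phi x) cos); [exact: cg|exact: continuous_cos].
under eq_Rintegral do rewrite mulr0 add0r.
rewrite restrict /Rintegral (@ftc_segment _ _ _ a b ab dcos); first by rewrite /= Ecos subrr.
move=> x; apply: continuousM; last exact: cp.
by apply: (@continuous_comp _ _ _ (fun x : R => c * phi x) sin); [exact: cg|exact: continuous_sin].
Qed.

Lemma integral_full_period (phi dphi : R -> R) (a b : R) : a < b ->
  (forall x : R, is_derive x 1 phi (dphi x)) -> continuous dphi ->
  (\int[mu]_v (dphi v * \1_(`[a, b]%classic) v))%R = phi b - phi a.
Proof.
move=> ab dp cp; rewrite -[RHS]/(fine (phi b - phi a)%:E) -(@ftc_segment _ _ _ a b ab dp cp).
rewrite -/(Rintegral _ _ _) [RHS]Rintegral_mkcond; apply: eq_Rintegral => x _.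
by rewrite patchE indicE; case: (_ \in _); rewrite ?mulr1 ?mulr0.
Qed.

Lemma integrable_full_period (dphi : R -> R) (a b : R) : continuous dphi ->
  mu.-integrable setT (EFin \o (fun v : R => dphi v * \1_(`[a, b]%classic) v)).
Proof.
move=> cp; have := @continuous_compact_integrable R dphi `[a, b]%classic (@segment_compact _ a b) (continuous_subspaceT cp).
move=> h; have := iffLR (@integrable_mkcond _ _ _ mu `[a, b]%classic (EFin \o dphi) (measurable_itv `[a, b])) h.
congr (_.-integrable _ _); apply/funext => x /=.
by rewrite patchE indicE; case: (_ \in _); rewrite ?mulr1 ?mulr0.
Qed.

Lemma cint_tensor (f g : R -> R[i]) : cintegrable mu f -> cintegrable mu g ->
  cint mu2 (fun z : R * R => f z.1 * g z.2) = cint mu f * cint mu g.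
Proof.
move=> fi gi; have [mf _] := fi; have [mg _] := gi.
have mfg : cmeas (fun z : R * R => f z.1 * g z.2).
  by apply: cmeasM; [exact: cmeas_comp measurable_fst mf|exact: cmeas_comp measurable_snd mg].
have fgi : cintegrable mu2 (fun z : R * R => f z.1 * g z.2).
  apply: (@cintegrable_le _ _ _ mu2 _ (fun z : R * R => cmod (f z.1) * cmod (g z.2))) => //.
    apply: (@integrable_tensor _ _ _ _ _ mu mu (fun x => cmod (f x)) (fun x => cmod (g x)) (fun z : R * R => cmod (f z.1) * cmod (g z.2))).
    - exact: fi.2.
    - exact: gi.2.
    - by apply: measurable_funM; apply: measurable_cmod; [exact: cmeas_comp measurable_fst mf|exact: cmeas_comp measurable_snd mg].
    - by move=> x y.
  by move=> z; rewrite cmodM.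
rewrite -(@cint12 _ _ _ _ _ mu mu _ fgi) /=.
transitivity (cint mu (fun x => cint mu g * f x)).
  by apply: (@eq_cint _ _ _ mu) => x; rewrite [RHS]mulrC -(@cintZ _ _ _ mu).
by rewrite cintZ// mulrC.
Qed.

(** For modulations and weights that split over the coordinates it is enough that
    one of the two factors is orthogonal. *)
Lemma bessel_tensor n (q1 q2 : 'I_n -> R -> R) (w1 w2 : R -> R) (M1 M2 w0 : R) (h : R * R -> R[i]) :
  0 < w0 -> 0 < M1 -> 0 < M2 -> (forall x, 0 <= w1 x) -> (forall x, 0 <= w2 x) ->
  mu.-integrable setT (EFin \o w1) -> mu.-integrable setT (EFin \o w2) ->
  (\int[mu]_x w1 x)%R = M1 -> (\int[mu]_x w2 x)%R = M2 ->
  (forall j, measurable_fun setT (q1 j)) -> (forall j, measurable_fun setT (q2 j)) ->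
  (forall j k, j != k ->
    cint mu (fun x : R => cis (q1 j x - q1 k x) * ((w1 x)%:C)%C) = 0 \/
    cint mu (fun x : R => cis (q2 j x - q2 k x) * ((w2 x)%:C)%C) = 0) ->
  cmeas h -> (nrm2 mu2 h < +oo)%E -> (forall z, h z != 0 -> w0 <= w1 z.1 * w2 z.2) ->
  \sum_j sqm (cint mu2 (fun z => cis (q1 j z.1 + q2 j z.2) * h z)) <=
  M1 * M2 / w0 * (\int[mu2]_z sqm (h z))%R.
Proof.
move=> w00 M10 M20 w1_0 w2_0 w1i w2i w1M w2M mq1 mq2 orth mh hoo hw.
have mw1 : measurable_fun setT w1 by apply/measurable_EFinP; exact: measurable_int w1i.
have mw2 : measurable_fun setT w2 by apply/measurable_EFinP; exact: measurable_int w2i.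
have ci (w : R -> R) (q : R -> R) : (forall x, 0 <= w x) -> mu.-integrable setT (EFin \o w) ->
    measurable_fun setT q -> cintegrable mu (fun x : R => cis (q x) * ((w x)%:C)%C).
  move=> w0' wi mq; have mw : measurable_fun setT w by apply/measurable_EFinP; exact: measurable_int wi.
  apply: (cintegrable_le _ wi).
    by apply: cmeasM; [exact: cmeas_cis mq|exact: cmeas_real].
  by move=> x; rewrite cmodM cmod_cis mul1r cmod_real.
have mq (q : R -> R) (r : R -> R) : measurable_fun setT q -> measurable_fun setT r ->
  measurable_fun setT (fun x => q x - r x) by exact: measurable_funB.
have ci' (w : R -> R) : (forall x, 0 <= w x) -> mu.-integrable setT (EFin \o w) ->
    cintegrable mu (fun x : R => ((w x)%:C)%C).
  move=> w0' wi; have := ci w (fun=> 0) w0' wi (measurable_cst _).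
  by under eq_fun do rewrite cis0 mul1r.
apply: (@bessel _ _ _ mu2 n (fun j z => q1 j z.1 + q2 j z.2) (fun z => w1 z.1 * w2 z.2)) => //.
- exact: mulr_gt0.
- by move=> z; rewrite mulr_ge0.
- apply: (@integrable_tensor _ _ _ _ _ mu mu w1 w2 (fun z : R * R => w1 z.1 * w2 z.2)) => //.
  apply: measurable_funM; first exact: measurableT_comp mw1 measurable_fst.
  exact: measurableT_comp mw2 measurable_snd.
- have := congr1 (@complex.Re R) (cint_tensor (ci' _ w1_0 w1i) (ci' _ w2_0 w2i)).
  rewrite ReM /= w1M w2M !Rintegral_cst//= !mul0r subr0 => <-.
  by apply: eq_Rintegral => z _; rewrite subr0.
- move=> j; apply: measurable_funD; first exact: measurableT_comp (mq1 j) measurable_fst.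
  exact: measurableT_comp (mq2 j) measurable_snd.
- move=> j k jk.
  have := cint_tensor (ci w1 (fun x => q1 j x - q1 k x) w1_0 w1i (mq _ _ (mq1 j) (mq1 k)))
                      (ci w2 (fun x => q2 j x - q2 k x) w2_0 w2i (mq _ _ (mq2 j) (mq2 k))).
  have -> : cint mu (fun x : R => cis (q1 j x - q1 k x) * ((w1 x)%:C)%C) *
         cint mu (fun x : R => cis (q2 j x - q2 k x) * ((w2 x)%:C)%C) = 0.
    by case: (orth j k jk) => ->; rewrite ?mul0r ?mulr0.
  move=> h0; rewrite -[RHS]h0; apply: (@eq_cint _ _ _ mu2) => z.
  have -> : q1 j z.1 + q2 j z.2 - (q1 k z.1 + q2 k z.2) =
    (q1 j z.1 - q1 k z.1) + (q2 j z.2 - q2 k z.2) by ring.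
  by rewrite cisD rmorphM; ring.
Qed.

Lemma period_weight_affine (N c : R) : 0 < N ->
  exists w : R -> R, [/\ (forall v, 0 <= w v), mu.-integrable setT (EFin \o w),
    (\int[mu]_v w v)%R = 2 * pi,
    (forall m : int, m != 0 -> cint mu (fun v : R => cis (m%:~R * (N * v)) * ((w v)%:C)%C) = 0) &
    (forall v, `|v - c| <= pi / N -> N <= w v)].
Proof.
move=> N0; have N0' : N != 0 by rewrite gt_eqF.
have pN : 0 < pi / N :> R by rewrite divr_gt0// pi_gt0.
set a := c - pi / N; set b := c + pi / N.
have ab : a < b by rewrite /a /b; lra.
have dphi (x : R) : is_derive x 1 (fun v : R => N * v) N.
  by under eq_fun do rewrite mulrC; exact: is_derive_mulr.
have cd : continuous (fun _ : R => N) by move=> x; exact: cvg_cst.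
have per : N * b - N * a = 2 * pi by rewrite /a /b; field.
exists (fun v => N * \1_(`[a, b]%classic) v); split.
- by move=> v; rewrite indicE mulr_ge0// ltW.
- exact: integrable_full_period cd.
- by rewrite (integral_full_period ab dphi cd) per.
- by move=> m m0; exact: (full_period ab dphi cd per m0).
- move=> v; rewrite ler_norml => /andP[h1 h2].
  by rewrite indicE mem_set ?mulr1// /= in_itv /= /a /b; apply/andP; split; lra.
Qed.

(** The interval is cut off at 1/4, where the derivative of N v^2 is N / 2, and is
    extended until v^2 has increased by 2 pi / N; the set to be covered has
    length 2 a and lies in [1/4, 1], so v^2 varies on it by at most 4 a, which
    is smaller. The sign s reduces negative v to positive ones. *)
Lemma period_weight_square (N a c s : R) : 0 < N -> 0 < a -> a * N <= 1 -> s = 1 \/ s = -1 ->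
  exists w : R -> R, [/\ (forall v, 0 <= w v), mu.-integrable setT (EFin \o w),
    (\int[mu]_v w v)%R = 2 * pi,
    (forall m : int, m != 0 -> cint mu (fun v : R => cis (m%:~R * (N * v ^+ 2)) * ((w v)%:C)%C) = 0) &
    (forall v, `|v - c| <= a -> 4^-1 <= s * v <= 1 -> N / 2 <= w v)].
Proof.
move=> N0 a0 aN hs; have N0' : N != 0 by rewrite gt_eqF.
have pi2 : 2 <= pi :> R by exact: pi_ge2.
have [b [d [bd per pos cover]]] : exists b d : R, [/\ b < d, s * (N * d ^+ 2) - s * (N * b ^+ 2) = 2 * pi,
    (forall v, b <= v <= d -> 4^-1 <= s * v) &
    (forall v, `|v - c| <= a -> 4^-1 <= s * v <= 1 -> b <= v <= d)].
  have key (m : R) : exists v0 v1 : R, [/\ 4^-1 <= v0, v0 < v1, N * v1 ^+ 2 - N * v0 ^+ 2 = 2 * pi &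
      forall v, `|v - m| <= a -> 4^-1 <= v <= 1 -> v0 <= v <= v1].
    (* The positive case; v1 is determined by the requirement of a full period. *)
    pose v0 := Num.max 4^-1 (m - a); pose v1 := Num.sqrt (v0 ^+ 2 + 2 * pi / N).
    have v00 : 4^-1 <= v0 by rewrite /v0 le_max lexx.
    have pN : 0 < 2 * pi / N by rewrite divr_gt0// mulr_gt0// pi_gt0.
    have v1E : v1 ^+ 2 = v0 ^+ 2 + 2 * pi / N by rewrite sqr_sqrtr// addr_ge0 ?sqr_ge0// ltW.
    have v10 : 0 <= v1 by exact: sqrtr_ge0.
    exists v0, v1; split => //.
    - by rewrite ltNge; apply/negP => h; nra.
    - by rewrite v1E; field.
    - move=> v; rewrite ler_norml => /andP[h1 h2] /andP[h3 h4].
      have v0v : v0 <= v by rewrite /v0 ge_max h3/=; lra.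
      rewrite v0v /=.
      have mv0 : m - a <= v0 by rewrite /v0 le_max lexx orbT.
      rewrite leNgt; apply/negP => h5.
      have e1 : v ^+ 2 - v0 ^+ 2 <= 4 * a by nra.
      have e2 : 4 * a <= 2 * pi / N by rewrite ler_pdivlMr//; nra.
      nra.
  case: hs => ->.
    have [v0 [v1 [h1 h2 h3 h4]]] := key c; exists v0, v1; split => //.
    - by rewrite !mul1r.
    - by move=> v /andP[h5 _]; rewrite mul1r (le_trans h1).
    - by move=> v; rewrite mul1r; exact: h4.
  have [v0 [v1 [h1 h2 h3 h4]]] := key (- c); exists (- v1), (- v0); split.
  - by rewrite ltrN2.
  - by rewrite !sqrrN -h3; ring.
  - by move=> v /andP[_ h5]; lra.
  - move=> v h5; rewrite mulN1r => h6; have := h4 (- v) _ h6.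
    have -> : - v - - c = - (v - c) by ring.
    by rewrite normrN => /(_ h5) /andP[h7 h8]; apply/andP; split; lra.
have dphi (x : R) : is_derive x 1 (fun v : R => s * (N * v ^+ 2)) (s * (N * (2 * x))).
  have sq : is_derive x 1 (fun v : R => v ^+ 2) (2 * x).
    by apply: (@is_derive_eq _ _ _ _ _ _ _ _ (is_deriveM (is_derive_id x 1) (is_derive_id x 1))); rewrite /GRing.scale /=; ring.
  have := is_deriveZ (s * N) sq.
  rewrite /GRing.scale /= (_ : s * N * (2 * x) = s * (N * (2 * x))); last by ring.
  by rewrite (_ : (_ \*: _) = (fun v : R => s * (N * v ^+ 2)))//; apply/funext => v; rewrite /= /GRing.scale /= mulrA.
have cd : continuous (fun x : R => s * (N * (2 * x))).
  by move=> x; apply: cvgM; [exact: cvg_cst|apply: cvgM; [exact: cvg_cst|apply: cvgM; [exact: cvg_cst|exact: cvg_id]]].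
have s2 : s * s = 1 by case: hs => ->; ring.
exists (fun v => s * (N * (2 * v)) * \1_(`[b, d]%classic) v); split.
- move=> v; rewrite indicE; case: (boolP (_ \in _)) => [/set_mem|_]; last by rewrite mulr0.
  rewrite /= in_itv /= mulr1 => /pos h.
  by rewrite (_ : s * (N * (2 * v)) = N * (2 * (s * v))); [nra|ring].
- exact: integrable_full_period cd.
- by rewrite (integral_full_period bd dphi cd) per.
- move=> m m0; have := full_period bd dphi cd per.
  case: hs => hs.
    by move=> /(_ _ m0); under eq_fun do rewrite {1}hs mul1r.
  have m0' : - m != 0 by rewrite oppr_eq0.
  by move=> /(_ _ m0'); under eq_fun do rewrite {1}hs mulN1r mulrN intrN mulNr opprK.
- move=> v h1 h2; have h3 := cover v h1 h2.
  rewrite indicE mem_set ?mulr1; last by rewrite /= in_itv.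
  rewrite (_ : s * (N * (2 * v)) = N * (2 * (s * v))); last by ring.
  by case/andP: h2 => h2 _; nra.
Qed.

Lemma bessel_space n (k1 k2 : 'I_n -> int) (N : R) (c : R * R) (h : R * R -> R[i]) : 0 < N ->
  (forall j j', j != j' -> k1 j != k1 j' \/ k2 j != k2 j') ->
  cmeas h -> (nrm2 mu2 h < +oo)%E ->
  (forall z, h z != 0 -> `|z.1 - c.1| <= pi / N /\ `|z.2 - c.2| <= pi / N) ->
  \sum_j sqm (cint mu2 (fun z => cis (dot2 (N * (k1 j)%:~R, N * (k2 j)%:~R) z) * h z)) <=
  (2 * pi) * (2 * pi) / (N * N) * (\int[mu2]_z sqm (h z))%R.
Proof.
move=> N0 dist mh hoo hc.
have [w1 [w1_0 w1i w1M orth1 w1N]] := period_weight_affine c.1 N0.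
have [w2 [w2_0 w2i w2M orth2 w2N]] := period_weight_affine c.2 N0.
have p0 : 0 < 2 * pi :> R by rewrite mulr_gt0// pi_gt0.
apply: (@bessel_tensor n (fun j v => N * (k1 j)%:~R * v) (fun j v => N * (k2 j)%:~R * v) w1 w2) => //.
- exact: mulr_gt0.
- by move=> j; exact: measurable_funM.
- by move=> j; exact: measurable_funM.
- have E (m m' : int) (v : R) : N * m%:~R * v - N * m'%:~R * v = (m - m')%:~R * (N * v).
    by rewrite intrB; ring.
  move=> j j' /dist [d|d]; [left; rewrite -[RHS](orth1 (k1 j - k1 j'))|right; rewrite -[RHS](orth2 (k2 j - k2 j'))]; rewrite ?subr_eq0//;
    by apply: (@eq_cint _ _ _ mu) => v; rewrite E.
- move=> z /hc [h1 h2]; apply: ler_pM; rewrite ?(ltW N0)//; [exact: w1N|exact: w2N].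
Qed.

Lemma box_weight (a c : R) : 0 < a ->
  exists w : R -> R, [/\ (forall v, 0 <= w v), mu.-integrable setT (EFin \o w),
    (\int[mu]_v w v)%R = 2 * a & (forall v, `|v - c| <= a -> 1 <= w v)].
Proof.
move=> a0; have cd : continuous (fun _ : R => 1 : R) by move=> x; exact: cvg_cst.
have ab : c - a < c + a by lra.
exists (fun v => 1 * \1_(`[c - a, c + a]%classic) v); split.
- by move=> v; rewrite indicE mul1r.
- exact: integrable_full_period cd.
- rewrite (integral_full_period (phi := id) ab _ cd); ring.
- move=> v; rewrite ler_norml => /andP[h1 h2].
  by rewrite indicE mem_set ?mulr1// /= in_itv /=; apply/andP; split; lra.
Qed.

Definition coord (i : bool) (z : R * R) : R := if i then z.1 else z.2.

(** The other coordinate only contributes a unimodular factor, and is weighted by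
    an indicator whose mass 2 a enters the constant. *)
Lemma bessel_time n (l : 'I_n -> int) (N a s : R) (i : bool) (c : R * R) (h : R * R -> R[i]) :
  0 < N -> 0 < a -> a * N <= 1 -> s = 1 \/ s = -1 -> injective l ->
  cmeas h -> (nrm2 mu2 h < +oo)%E ->
  (forall z, h z != 0 -> [/\ `|z.1 - c.1| <= a, `|z.2 - c.2| <= a & 4^-1 <= s * coord i z <= 1]) ->
  \sum_j sqm (cint mu2 (fun z => cis ((l j)%:~R * N * dot2 z z) * h z)) <=
  (2 * pi) * (2 * a) / (N / 2) * (\int[mu2]_z sqm (h z))%R.
Proof.
move=> N0 a0 aN hs linj mh hoo hc.
have [w1 [w1_0 w1i w1M orth1 w1N]] := period_weight_square (coord i c) N0 a0 aN hs.
have [w2 [w2_0 w2i w2M w2N]] := box_weight (coord (~~ i) c) a0.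
have p0 : 0 < 2 * pi :> R by rewrite mulr_gt0// pi_gt0.
have a20 : 0 < 2 * a by rewrite mulr_gt0.
pose q (j : 'I_n) (v : R) := (l j)%:~R * N * v ^+ 2.
have mq j : measurable_fun setT (q j) by apply: measurable_funM => //; exact: measurable_funX.
have E : \sum_j sqm (cint mu2 (fun z => cis ((l j)%:~R * N * dot2 z z) * h z)) =
    \sum_j sqm (cint mu2 (fun z => cis (q j z.1 + q j z.2) * h z)).
  apply: eq_bigr => j _; congr sqm; apply: (@eq_cint _ _ _ mu2) => z.
  by congr (cis _ * _); rewrite /q /dot2; ring.
have orth j k : j != k -> cint mu (fun x : R => cis (q j x - q k x) * ((w1 x)%:C)%C) = 0.
  move=> jk; rewrite -[RHS](orth1 (l j - l k)); last by rewrite subr_eq0 (inj_eq linj).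
  by apply: (@eq_cint _ _ _ mu) => v; congr (cis _ * _); rewrite /q intrB; ring.
have N20 : 0 < N / 2 by rewrite divr_gt0.
rewrite E; case: i hc w1N w2N => /= hc w1N w2N.
  apply: (@bessel_tensor n q q w1 w2) => //.
  - by move=> j k jk; left; exact: orth.
  - move=> z /hc [h1 h2 h3]; have := w1N _ h1 h3; have := w2N _ h2; nra.
rewrite [2 * pi * _]mulrC; apply: (@bessel_tensor n q q w2 w1) => //.
- by move=> j k jk; right; exact: orth.
- move=> z /hc [h1 h2 h3]; have := w1N _ h2 h3; have := w2N _ h1; nra.
Qed.

End orthogonality.

(** * Pieces of the annulus and their boxes *)

Section pieces.
Context {R : realType}.
Local Notation mu := (@lebesgue_measure R).
Local Notation mu2 := (@leb2 R).

Definition square_box (u : R * R) (a : R) : set (R * R) :=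
  `[u.1 - a, u.1 + a]%classic `*` `[u.2 - a, u.2 + a]%classic.

Lemma square_boxP u a z : square_box u a z <-> `|z.1 - u.1| <= a /\ `|z.2 - u.2| <= a.
Proof. by rewrite /square_box /= !in_itv /= !ler_distl. Qed.

Lemma measurable_square_box u a : measurable (square_box u a : set (measurableTypeR R * measurableTypeR R)).
Proof. by apply: measurableX. Qed.

Lemma leb2_square_box u a : 0 < a -> mu2 (square_box u a) = (4 * a ^+ 2)%:E.
Proof. by move=> a0; rewrite leb2_box; [congr EFin; ring|lra|lra]. Qed.

(** After removing the phase at the centre of the box, the argument of the
    exponential is at most 1 on the box, where the cosine is at least cos 1. *)
Lemma window_transform_ge (N a : R) (u x : R * R) : 0 < a -> 2 * a * N <= 1 -> eball2 0 N x ->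
  (cos 1 * (4 * a ^+ 2)) ^+ 2 <= sqm (window_transform (square_box u a) x).
Proof.
move=> a0 aN; rewrite /eball2 /= subr0 => xN; set B := square_box u a.
have Boo : (mu2 B < +oo)%E by rewrite leb2_square_box// ltry.
have iB : mu2.-integrable setT (EFin \o (\1_B : R * R -> R)).
  by apply: integrable_indicator => //; exact: measurable_square_box.
have mx : measurable_fun setT (fun eta : R * R => dot2 x eta) by exact: measurable_dot2.
have mB1 : measurable_fun setT (\1_B : R * R -> R) by apply: measurable_indic; exact: measurable_square_box.
have iW : cintegrable mu2 (fun eta => cis (dot2 x eta) * ((\1_B eta : R)%:C)%C).
  apply: (cintegrable_le _ iB) => [|eta]; last by rewrite cmodM cmod_cis mul1r cmod_real.
  by apply: cmeasM; [exact: cmeas_cis|exact: cmeas_real].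
have I1 : (\int[mu2]_x \1_B x)%R = 4 * a ^+ 2.
  rewrite /Rintegral integral_indic ?setIT//; last exact: measurable_square_box.
  by rewrite -[RHS]/(fine (4 * a ^+ 2)%:E) -(leb2_square_box u a0).
rewrite -(sqm_cisM (- dot2 x u)) -cintZ//.
set G := (fun eta => _).
have GE eta : complex.Re (G eta) = cos (dot2 x (eta - u)) * \1_B eta.
  rewrite /G mulrA -cisD ReM /= mulr0 subr0; congr (cos _ * _).
  by rewrite /dot2 /=; ring.
have n0 := enorm2_ge0 x; have nx := enorm2_sqr x.
have [x1 x2] : `|x.1| <= N /\ `|x.2| <= N.
  by rewrite !ler_norml; move: nx; rewrite /dot2 => nx; split; apply/andP; split; nra.
have ge : cos 1 * (4 * a ^+ 2) <= complex.Re (cint mu2 G).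
  have -> : complex.Re (cint mu2 G) = (\int[mu2]_eta (cos (dot2 x (eta - u)) * \1_B eta))%R.
    by transitivity (\int[mu2]_eta complex.Re (G eta))%R => //; apply: eq_Rintegral => eta _; exact: GE.
  rewrite -I1 -RintegralZl//; apply: le_Rintegral => //.
  - by have := integrableZl measurableT (cos 1) iB.
  - apply: (@integrableM_bounded _ _ _ _ 1) => //; last by move=> eta; rewrite ler_norml cos_geN1 cos_le1.
    apply: measurableT_comp; first by apply: continuous_measurable_fun; exact: continuous_cos.
    have -> : (fun eta => dot2 x (eta - u)) = (fun eta => dot2 x eta - dot2 x u).
      by apply/funext => eta; rewrite /dot2 /=; ring.
    exact: measurable_funB.
  - move=> eta _; rewrite indicE; case: (boolP (_ \in _)) => [/set_mem|_]; last by rewrite !mulr0.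
    rewrite !mulr1 => /square_boxP [h1 h2]; set th := dot2 _ _.
    have th1 : `|th| <= 1.
      apply: le_trans (_ : N * a + N * a <= 1); last by rewrite (_ : N * a + N * a = 2 * a * N)//; ring.
      by apply: le_trans (ler_normD _ _) _; rewrite !normrM; apply: lerD; apply: ler_pM.
    rewrite -[cos th]cos_norm; have := @ltr_cos R; set D := `[0, pi] => lc.
    have p2 : 2 <= pi :> R by exact: pi_ge2.
    by rewrite leNgt lc ?in_itv/= ?normr_ge0 -?leNgt ?ler01//=; lra.
rewrite /sqm; apply: le_trans (_ : complex.Re (cint mu2 G) ^+ 2 <= _); last by rewrite lerDl sqr_ge0.
rewrite lerXn2r ?nnegrE//; last apply: le_trans ge.
all: by rewrite mulr_ge0 ?(ltW (cos1_gt0 _))// mulr_ge0 ?sqr_ge0.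
Qed.

(** Frequencies with a coordinate of size at least 1/4 and prescribed sign, in
    the outer or the inner part of the annulus; 9 / 16 is the square of the
    middle radius. *)
Definition piece (i : bool) (s : R) (outer : bool) : set (R * R) :=
  [set xi | [/\ annulus1 xi, 4^-1 <= s * coord i xi &
    if outer then 9 / 16 <= dot2 xi xi else dot2 xi xi <= 9 / 16]].

Definition on_axis (i : bool) (v : R) : R * R := if i then (v, 0) else (0, v).

(** The box is displaced by 9 times its half-side along the large coordinate,
    towards the origin in the outer part and away from it in the inner part.
    The displacement dominates the half-side by enough to decide the sign of
    the change of |xi|^2. *)
Definition piece_center (i : bool) (s a : R) (outer : bool) : R * R :=
  on_axis i (s * (if outer then - (9 * a) else 9 * a)).

(** Along the large coordinate p >= 1/4 the shift d changes the sum of squares by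
    at least 2 p |d| >= 4 a in the right direction, against at most 2 a from
    the other coordinate and 101 a^2 from the quadratic terms. All changes
    together are at most 24 a, small enough not to reach the other circle. *)
Lemma sumsq_shift (a p q d w : R) (outer : bool) : 0 < a <= 128^-1 ->
  4^-1 <= p <= 1 -> `|q| <= 1 -> `|w| <= a ->
  (if outer then -10 * a <= d <= - (8 * a) else 8 * a <= d <= 10 * a) ->
  4^-1 <= p ^+ 2 + q ^+ 2 <= 1 ->
  (if outer then 9 / 16 <= p ^+ 2 + q ^+ 2 else p ^+ 2 + q ^+ 2 <= 9 / 16) ->
  4^-1 <= (p + d) ^+ 2 + (q + w) ^+ 2 <= 1 /\
  `|p ^+ 2 + q ^+ 2 - ((p + d) ^+ 2 + (q + w) ^+ 2)| <= 24 * a.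
Proof.
move=> /andP[a0 a1] /andP[p0 p1] q1 w1 hd /andP[r0 r1] hr.
have qw : `|q * w| <= a by rewrite normrM -[leRHS]mul1r ler_pM.
move: qw; rewrite ler_norml => /andP[qw1 qw2].
have ww : w ^+ 2 <= a ^+ 2 by rewrite -real_normK ?num_real// lerXn2r ?nnegrE// ltW.
have aa : a ^+ 2 <= a / 64 by rewrite expr2; nra.
have w0 := sqr_ge0 w; have d0 := sqr_ge0 d.
have -> : (p + d) ^+ 2 + (q + w) ^+ 2 = p ^+ 2 + q ^+ 2 + (2 * (p * d) + 2 * (q * w) + d ^+ 2 + w ^+ 2) by ring.
have dd : d ^+ 2 <= 100 * a ^+ 2 by case: outer hd {hr} => /andP[d1 d2]; nra.
rewrite ler_norml.
move: (p ^+ 2 + q ^+ 2) r0 r1 hr => r r0 r1 hr.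
case: outer hd hr => /andP[d1 d2] hr.
  have pd1 : p * d <= - (2 * a) by nra.
  have pd2 : - (10 * a) <= p * d by nra.
  by split; apply/andP; split; lra.
have pd1 : 2 * a <= p * d by nra.
have pd2 : p * d <= 10 * a by nra.
by split; apply/andP; split; lra.
Qed.

Lemma piece_shift (i : bool) (s a : R) (outer : bool) (zeta xi : R * R) : 0 < a <= 128^-1 ->
  s = 1 \/ s = -1 -> square_box (piece_center i s a outer) a (zeta - xi) -> piece i s outer xi ->
  annulus1 zeta /\ `|dot2 xi xi - dot2 zeta zeta| <= 24 * a.
Proof.
move=> ha hs /square_boxP hB [/annulus1P hA hc ho].
have ss : s * s = 1 by case: hs => ->; ring.
pose p := s * coord i xi; pose q := coord (~~ i) xi.
pose d := s * (coord i zeta - coord i xi); pose w := coord (~~ i) zeta - coord (~~ i) xi.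
have dE (z : R * R) : dot2 z z = (s * coord i z) ^+ 2 + coord (~~ i) z ^+ 2.
  rewrite exprMn [s ^+ 2]expr2 ss mul1r /dot2 /coord; case: (i) => /=; ring.
have zE : dot2 zeta zeta = (p + d) ^+ 2 + (q + w) ^+ 2.
  by rewrite dE /p /d /q /w; ring.
rewrite annulus1P zE dE; rewrite dE in hA; rewrite dE in ho.
apply: (@sumsq_shift a p q d w outer) => //.
- by rewrite hc /=; case/andP: hA => _; rewrite -/p -/q => hA; nra.
- by rewrite ler_norml; case/andP: hA => _; rewrite -/p -/q => hA; apply/andP; split; nra.
- by rewrite /w /coord; case: (i) hB => /= -[h1 h2]; rewrite ?subr0 in h1 h2.
- have : `|(coord i zeta - coord i xi) - s * (if outer then - (9 * a) else 9 * a)| <= a.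
    by rewrite /coord; case: (i) hB => /= -[].
  rewrite ler_norml => /andP[h1 h2]; rewrite /d.
  move: (coord i zeta - coord i xi) h1 h2 => e h1 h2.
  by case: hs => hs'; rewrite hs' in h1 h2 *; case: (outer) h1 h2 => h1 h2; apply/andP; split; lra.
Qed.

Lemma measurable_piece i s o : measurable (piece i s o : set (measurableTypeR R * measurableTypeR R)).
Proof.
have mc : measurable_fun setT (fun z : R * R => s * coord i z).
  by apply: measurable_funM => //; case: i; [exact: measurable_fst|exact: measurable_snd].
have md : measurable_fun setT (fun z : R * R => dot2 z z) by exact: measurable_dot2.
have -> : piece i s o = annulus1 `&` (((fun z : R * R => s * coord i z) @^-1` `[4^-1, +oo[%classic) `&`
    ((fun z : R * R => dot2 z z) @^-1` (if o then `[9 / 16, +oo[%classic else `]-oo, 9 / 16]%classic))).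
  apply/seteqP; split => z; rewrite /piece /=.
    by case: (o) => -[h1 h2 h3]; rewrite /= !in_itv /= ?andbT.
  by case: (o); rewrite /= !in_itv /= ?andbT => -[h1 [h2 h3]].
apply: measurableI; first exact: measurable_annulus1.
apply: measurableI.
  by rewrite -[X in measurable X]setTI; apply: mc.
by rewrite -[X in measurable X]setTI; case: o; apply: md.
Qed.

(** Since |xi| >= 1/2, one coordinate is at least 1 / (2 sqrt 2) > 1/4 in size. *)
Lemma annulus_pieces (xi : R * R) : annulus1 xi -> exists i s o, (s = 1 \/ s = -1) /\ piece i s o xi.
Proof.
move=> hA; have /annulus1P /andP[h _] := hA.
have hb : exists i s, (s = 1 \/ s = -1) /\ 4^-1 <= s * coord i xi.
  case: (lerP 4^-1 xi.1) => h1; first by exists true, 1; split; [left|rewrite mul1r].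
  case: (lerP xi.1 (- 4^-1)) => h2; first by exists true, (-1); split; [right|rewrite /coord; lra].
  case: (lerP 4^-1 xi.2) => h3; first by exists false, 1; split; [left|rewrite mul1r].
  case: (lerP xi.2 (- 4^-1)) => h4; first by exists false, (-1); split; [right|rewrite /coord; lra].
  by exfalso; rewrite /dot2 in h; nra.
case: hb => i [s [hs hc]].
by case: (lerP (9 / 16) (dot2 xi xi)) => ho; [exists i, s, true|exists i, s, false]; split => //; split => //; exact: ltW.
Qed.

Variables (N : R) (n : nat) (q : 'I_n -> R * R -> R).
Hypothesis N_ge1 : 1 <= N.
Hypothesis mq : forall j, measurable_fun setT (q j).

Let N_gt0 : 0 < N. Proof. exact: lt_le_trans ltr01 N_ge1. Qed.

(** The strengthened estimate for data supported in S, with constant Q. *)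
Definition transfers (Q : R) (S : set (R * R)) := forall g, admissible g -> supported_in S g ->
  (\sum_j \int[mu2]_(x in eball2 0%R N) sup_sqm N (modulate (q j) g) x <= Q%:E * nrm2 mu2 g)%E.

Lemma admissible_cut (S : set (R * R)) g : measurable (S : set (measurableTypeR R * measurableTypeR R)) ->
  admissible g -> admissible (cut S g).
Proof.
move=> mS [mg goo gA]; split; first exact: cmeas_cut.
  exact: le_lt_trans (nrm2_cut_le mS mg) goo.
by move=> xi nA; rewrite /cut gA ?mulr0.
Qed.

Lemma sup_sqmD_le T g1 g2 x : cintegrable mu2 g1 -> cintegrable mu2 g2 ->
  (sup_sqm T (fun xi => g1 xi + g2 xi)%R x <= 2%:E * sup_sqm T g1 x + 2%:E * sup_sqm T g2 x)%E.
Proof.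
move=> i1 i2; apply: ge_ereal_sup => _ [m _ <-]; set t := dense_time T m.
have E : schrodinger (fun xi => g1 xi + g2 xi) t x = schrodinger g1 t x + schrodinger g2 t x.
  have mp : measurable_fun setT (fun xi : R * R => dot2 x xi + t * enorm2 xi ^+ 2).
    apply: measurable_funD; first exact: measurable_dot2.
    by under eq_fun do rewrite enorm2_sqr; apply: measurable_funM => //; exact: measurable_dot2.
  have c1 := cintegrable_cisM (m := mu2) mp i1; have c2 := cintegrable_cisM (m := mu2) mp i2.
  rewrite -[RHS](cintD c1 c2); apply: (@eq_cint _ _ _ mu2) => xi.
  by rewrite mulrDr.
rewrite E; apply: (@le_trans _ _ (2 * sqm (schrodinger g1 t x) + 2 * sqm (schrodinger g2 t x))%:E).
  by rewrite lee_fin sqmD_le.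
by rewrite EFinD !EFinM; apply: leeD; apply: lee_wpmul2l => //; apply: ereal_sup_ubound; exists m.
Qed.

Lemma ge0_integral_le2D d (T : measurableType d) (m : {measure set T -> \bar R}) (D : set T)
    (f f1 f2 : T -> \bar R) : measurable D ->
  measurable_fun D f -> measurable_fun D f1 -> measurable_fun D f2 ->
  (forall x, D x -> 0 <= f x)%E -> (forall x, D x -> 0 <= f1 x)%E -> (forall x, D x -> 0 <= f2 x)%E ->
  (forall x, D x -> f x <= 2%:E * f1 x + 2%:E * f2 x)%E ->
  (\int[m]_(x in D) f x <= 2%:E * \int[m]_(x in D) f1 x + 2%:E * \int[m]_(x in D) f2 x)%E.
Proof.
move=> mD mf m1 m2 f0 f10 f20 le.
have q1 x : D x -> (0 <= 2%:E * f1 x)%E by move=> /f10 ?; rewrite mule_ge0.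
have q2 x : D x -> (0 <= 2%:E * f2 x)%E by move=> /f20 ?; rewrite mule_ge0.
have mm1 : measurable_fun D (fun x => 2%:E * f1 x)%E by exact: measurable_funeM.
have mm2 : measurable_fun D (fun x => 2%:E * f2 x)%E by exact: measurable_funeM.
rewrite -!ge0_integralZl_EFin// -ge0_integralD//.
by apply: ge0_le_integral => //; exact: emeasurable_funD.
Qed.

Lemma sum_double2 k (u v : 'I_k -> \bar R) : (forall j, 0 <= u j)%E -> (forall j, 0 <= v j)%E ->
  (\sum_j (2%:E * u j + 2%:E * v j) = 2%:E * \sum_j u j + 2%:E * \sum_j v j)%E.
Proof. by move=> u0 v0; rewrite big_split /= -!ge0_sume_distrr. Qed.

(** Split the datum over S1 and its complement: the square of a sum costs a factor
    2, and both parts contribute. *)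
Lemma transfers_union Q (S1 S2 : set (R * R)) : 0 <= Q ->
  measurable (S1 : set (measurableTypeR R * measurableTypeR R)) ->
  transfers Q S1 -> transfers Q S2 -> transfers (4 * Q) (S1 `|` S2).
Proof.
move=> Q0 mS1 h1 h2 g ag gS; have [mg goo gA] := ag.
have mC1 : measurable (~` S1 : set (measurableTypeR R * measurableTypeR R)) by exact: measurableC.
pose g1 := cut S1 g; pose g2 := cut (~` S1) g.
have ag1 : admissible g1 by exact: admissible_cut.
have ag2 : admissible g2 by exact: admissible_cut.
have s1 : supported_in S1 g1 by move=> xi nS; rewrite /g1 cut_out.
have s2 : supported_in S2 g2.
  move=> xi nS; have [h|h] := pselect (S1 xi); first by rewrite /g2 cut_out//=; apply.
  by rewrite /g2 /cut gS ?mulr0// => -[].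
have gE j : modulate (q j) g = (fun xi => modulate (q j) g1 xi + modulate (q j) g2 xi).
  apply/funext => xi; rewrite /modulate -mulrDr; congr (_ * _).
  have [h|h] := pselect (S1 xi); first by rewrite /g1 /g2 (cut_in _ h) cut_out ?addr0//=; apply.
  by rewrite /g1 /g2 (cut_out _ h) (@cut_in _ (~` S1)) ?add0r.
have am j g' : admissible g' -> admissible (modulate (q j) g') by exact: admissible_cisM.
set D := eball2 0 N; have mD : measurable (D : set (measurableTypeR R * measurableTypeR R)) by exact: measurable_eball2.
have ms j g' : admissible g' -> measurable_fun D (sup_sqm N (modulate (q j) g')).
  by move=> /(am j) [m' _ _]; apply: (@measurable_funS _ _ _ _ setT) => //; exact: measurable_sup_sqm.
apply: (@le_trans _ _ (\sum_j (2%:E * \int[mu2]_(x in D) sup_sqm N (modulate (q j) g1) x +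
    2%:E * \int[mu2]_(x in D) sup_sqm N (modulate (q j) g2) x))%E).
  apply: lee_sum => j _.
  have m1 := ms j g1 ag1; have m2 := ms j g2 ag2; have m0 := ms j g ag.
  have p1 x : D x -> (0 <= sup_sqm N (modulate (q j) g1) x)%E by move=> _; exact: sup_sqm_ge0.
  have p2 x : D x -> (0 <= sup_sqm N (modulate (q j) g2) x)%E by move=> _; exact: sup_sqm_ge0.
  have p0 x : D x -> (0 <= sup_sqm N (modulate (q j) g) x)%E by move=> _; exact: sup_sqm_ge0.
  apply: (@ge0_integral_le2D _ _ mu2 D _ _ _ mD m0 m1 m2 p0 p1 p2).
  move=> x _; rewrite gE; apply: sup_sqmD_le; apply: admissible_cintegrable; exact: am.
rewrite sum_double2; [|by move=> j; exact: int_sup_sqm_ge0|by move=> j; exact: int_sup_sqm_ge0].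
apply: (@le_trans _ _ (2%:E * (Q%:E * nrm2 mu2 g1) + 2%:E * (Q%:E * nrm2 mu2 g2))%E).
  by apply: leeD; apply: lee_wpmul2l => //; [exact: h1|exact: h2].
have le (g' : R * R -> R[i]) : (nrm2 mu2 g' <= nrm2 mu2 g)%E ->
    (2%:E * (Q%:E * nrm2 mu2 g') <= (2 * Q)%:E * nrm2 mu2 g)%E.
  by move=> h; rewrite muleA -EFinM lee_wpmul2l// lee_fin mulr_ge0.
apply: le_trans (leeD (le _ (nrm2_cut_le mS1 mg)) (le _ (nrm2_cut_le mC1 mg))) _.
rewrite -ge0_muleDl ?lee_fin ?mulr_ge0// -EFinD (_ : 2 * Q + 2 * Q = 4 * Q)//; ring.
Qed.

Let a : R := (128 * N)^-1.

Let a_gt0 : 0 < a. Proof. by rewrite invr_gt0 mulr_gt0. Qed.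

Let aN : a * N = 128^-1.
Proof. by rewrite /a; field; rewrite gt_eqF. Qed.

Let a_le : a <= 128^-1.
Proof. by rewrite -aN ler_peMr ?(ltW a_gt0). Qed.

(** The constant 4 K M |B| / c0 of the localized estimate, in which all powers of
    N cancel. *)
Definition piece_constant (K : R) : R := K * (256 * pi / cos 1) ^+ 2.

(** The box has half-side a = 1 / (128 N), so that the phases x . xi and
    N |xi|^2 both vary by at most a small constant over it. *)
Lemma piece_transfers (K : R) (i : bool) (s : R) (o : bool) : 0 <= K -> s = 1 \/ s = -1 ->
  (forall zeta h, cmeas h -> (nrm2 mu2 h < +oo)%E ->
    (forall xi, h xi != 0 -> [/\ `|xi.1 - (zeta - piece_center i s a o).1| <= a,
      `|xi.2 - (zeta - piece_center i s a o).2| <= a & 4^-1 <= s * coord i xi <= 1]) ->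
    \sum_j sqm (cint mu2 (fun xi => cis (q j xi) * h xi)) <=
    (2 * pi) * (2 * pi) / (N * N) * (\int[mu2]_xi sqm (h xi))%R) ->
  square_estimate N N K -> transfers (piece_constant K) (piece i s o).
Proof.
move=> K0 hs hB hK g ag gS; set B := square_box (piece_center i s a o) a.
have Boo : (mu2 B < +oo)%E by rewrite leb2_square_box// ltry.
have ha : 0 < a <= 128^-1 by rewrite a_gt0 a_le.
have BA zeta xi : B (zeta - xi) -> piece i s o xi -> annulus1 zeta.
  by move=> h1 h2; case: (piece_shift ha hs h1 h2).
have BP zeta xi : B (zeta - xi) -> piece i s o xi -> `|N * (dot2 xi xi - dot2 zeta zeta)| <= 2^-1.
  move=> h1 h2; case: (piece_shift ha hs h1 h2) => _ h.
  rewrite normrM ger0_norm ?(ltW N_gt0)//; have := aN; have := N_gt0; nra.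
have c0 : 0 < cos 1 :> R := cos1_gt0 R.
have M0 : 0 <= (2 * pi) * (2 * pi) / (N * N).
  by rewrite divr_ge0// mulr_ge0 ?(ltW N_gt0)// mulr_ge0// pi_ge0.
have C0 : 0 < (cos 1 * (4 * a ^+ 2)) ^+ 2 by rewrite exprn_gt0// mulr_gt0// mulr_gt0// exprn_gt0.
have cA x : eball2 0 N x -> (cos 1 * (4 * a ^+ 2)) ^+ 2 <= sqm (window_transform B x).
  by apply: window_transform_ge => //; rewrite -mulrA aN; lra.
have hB' zeta h : cmeas h -> (nrm2 mu2 h < +oo)%E -> (forall xi, h xi != 0 -> B (zeta - xi) /\ piece i s o xi) ->
    \sum_j sqm (cint mu2 (fun xi => cis (q j xi) * h xi)) <=
    (2 * pi) * (2 * pi) / (N * N) * (\int[mu2]_xi sqm (h xi))%R.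
  move=> mh hoo hh; apply: (hB zeta) => // xi /hh [/square_boxP [h1 h2] [/annulus1P /andP[_ h3] h4 _]].
  split.
  - by rewrite -normrN; congr (`|_| <= _): h1; rewrite /=; ring.
  - by rewrite -normrN; congr (`|_| <= _): h2; rewrite /=; ring.
  - rewrite h4 /=; move: h3; rewrite /dot2 /coord; case: (i); case: hs => ->; nra.
have := localized_transference N_gt0 (measurable_square_box _ _) Boo BA BP M0 mq hB' K0 C0 cA hK gS ag.
rewrite leb2_square_box//=; congr (_ <= _%:E * _)%E.
rewrite /piece_constant (_ : N = (128 * a)^-1); last by rewrite /a; field; rewrite gt_eqF.
by field; rewrite !gt_eqF.
Qed.

(** Three successive unions collect the eight pieces, and each costs a factor 4. *)
Lemma annulus_transfers (Q : R) : 0 <= Q ->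
  (forall i s o, s = 1 \/ s = -1 -> transfers Q (piece i s o)) ->
  forall g, admissible g ->
  (\sum_j \int[mu2]_(x in eball2 0%R N) sup_sqm N (modulate (q j) g) x <= (64 * Q)%:E * nrm2 mu2 g)%E.
Proof.
move=> Q0 h g ag; have [_ _ gA] := ag.
pose S1 i s := piece i s true `|` piece i s false.
have mS1 i s : measurable (S1 i s : set (measurableTypeR R * measurableTypeR R)).
  by apply: measurableU; exact: measurable_piece.
have t1 i s : s = 1 \/ s = -1 -> transfers (4 * Q) (S1 i s).
  by move=> hs; apply: transfers_union => //; [exact: measurable_piece|exact: h|exact: h].
have Q1 : 0 <= 4 * Q by rewrite mulr_ge0.
have Q2 : 0 <= 4 * (4 * Q) by rewrite mulr_ge0.
pose S2 i := S1 i 1 `|` S1 i (-1).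
have t2 i : transfers (4 * (4 * Q)) (S2 i).
  by apply: transfers_union => //; apply: t1; [left|right].
have t3 : transfers (4 * (4 * (4 * Q))) (S2 true `|` S2 false).
  by apply: transfers_union => //; apply: measurableU.
rewrite (_ : 64 * Q = 4 * (4 * (4 * Q))); last by ring.
apply: t3 => // xi nS; apply: gA => /annulus_pieces h1; apply: nS.
case: h1 => i [s [e [hs hp]]].
have : S1 i s xi by case: e hp; [left|right].
by case: i hp => hp; case: hs => -> h1; [left; left|left; right|right; left|right; right].
Qed.

End pieces.

(** * Long times and large balls *)

Section transference.
Context {R : realType}.
Local Notation mu2 := (@leb2 R).
Implicit Types g : R * R -> R[i].

Lemma piece_constant_ge0 (K : R) : 0 <= K -> 0 <= piece_constant K.
Proof. by move=> K0; rewrite mulr_ge0 ?sqr_ge0. Qed.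

Lemma Rintegral_sqm_ge0 d (T : measurableType d) (m : {measure set T -> \bar R}) (h : T -> R[i]) :
  0 <= (\int[m]_x sqm (h x))%R.
Proof. by apply: Rintegral_ge0 => x _; exact: sqm_ge0. Qed.

Lemma schrodinger_time_shift g (t s : R) x :
  schrodinger g (t + s) x = schrodinger (modulate (fun xi => t * dot2 xi xi) g) s x.
Proof.
apply: (@eq_cint _ _ _ mu2) => xi; rewrite /modulate mulrA -cisD enorm2_sqr.
by congr (cis _ * _); ring.
Qed.

Lemma schrodinger_space_shift g t (x y : R * R) :
  schrodinger g t (y + x) = schrodinger (modulate (dot2 x) g) t y.
Proof.
apply: (@eq_cint _ _ _ mu2) => xi; rewrite /modulate mulrA -cisD.
by congr (cis _ * _); rewrite /dot2 /=; ring.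
Qed.

(** A time t in [0, N^2] is l N + s with l an integer at most N and s in [0, N],
    and the shift by l N is a modulation by cis (l N |xi|^2). *)
Lemma time_transference (N K : R) : 1 <= N -> 0 <= K -> square_estimate N N K ->
  square_estimate (N ^+ 2) N (64 * piece_constant K).
Proof.
move=> N1 K0 hK g ag; have N0 : 0 < N by exact: lt_le_trans ltr01 N1.
have [mg _ _] := ag.
pose L := (Num.truncn N).+1; pose l (j : 'I_L) : int := (j : nat)%:Z.
have linj : injective l by move=> j k [jk]; exact: val_inj.
pose q (j : 'I_L) (xi : R * R) : R := (l j)%:~R * N * dot2 xi xi.
have mq j : measurable_fun setT (q j) by apply: measurable_funM => //; exact: measurable_dot2.
have Qp := piece_constant_ge0 K0.
have tp i s o : s = 1 \/ s = -1 -> transfers N q (piece_constant K) (piece i s o).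
  move=> hs; apply: piece_transfers => // zeta h mh hoo hh.
  have a0 : 0 < (128 * N)^-1 by rewrite invr_gt0 mulr_gt0.
  have aN : (128 * N)^-1 * N = 128^-1 by field; rewrite gt_eqF.
  have aN1 : (128 * N)^-1 * N <= 1 by rewrite aN; lra.
  apply: le_trans (bessel_time N0 a0 aN1 hs linj mh hoo hh) _.
  rewrite ler_wpM2r ?Rintegral_sqm_ge0//.
  (* Bessel's constant for the time modulations is smaller than the one for the
     space modulations, which both cases use. *)
  have -> : 2 * pi * (2 * (128 * N)^-1) / (N / 2) = (pi / 16) / (N * N) by field; rewrite gt_eqF.
  rewrite ler_wpM2r ?invr_ge0 ?mulr_ge0 ?(ltW N0)//; have := pi_ge2 R; nra.
apply: (le_trans _ (annulus_transfers mq Qp tp ag)).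
set D := eball2 0 N; have mD : measurable (D : set (measurableTypeR R * measurableTypeR R)) by exact: measurable_eball2.
have am j : cmeas (modulate (q j) g) by case: (admissible_cisM (mq j) ag).
have ms T g' : cmeas g' -> measurable_fun D (sup_sqm T g').
  by move=> mg'; apply: (@measurable_funS _ _ _ _ setT) => //; exact: measurable_sup_sqm.
rewrite -ge0_integral_sum//; last 2 first.
- by move=> j; exact: ms.
- by move=> j x _; exact: sup_sqm_ge0.
apply: (@ge0_le_integral _ _ _ mu2 D mD).
- by move=> x _; exact: sup_sqm_ge0.
- exact: ms.
- by apply: emeasurable_sum => j; exact: ms.
move=> x _; apply: ge_ereal_sup => _ [k _ <-].
have /andP[t0 tN] := dense_time_itv k (sqr_ge0 N); set t := dense_time _ k in t0 tN *.
have tN0 : 0 <= t / N by rewrite divr_ge0// ltW.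
have /andP[h1 h2] := truncn_itv tN0; set p := Num.truncn _ in h1 h2.
have /andP[_ h3] := truncn_itv (ltW N0).
have pL : (p < L)%N.
  rewrite -(ltr_nat R); apply: le_lt_trans h1 _; apply: le_lt_trans h3.
  by rewrite ler_pdivrMr.
rewrite (bigD1 (Ordinal pL))//=.
apply: (@le_trans _ _ (sup_sqm N (modulate (q (Ordinal pL)) g) x)).
  have agm : admissible (modulate (q (Ordinal pL)) g) by exact: admissible_cisM (mq _) ag.
  have -> : schrodinger g t x = schrodinger (modulate (q (Ordinal pL)) g) (t - p%:R * N) x.
    rewrite -[X in schrodinger g X x](_ : p%:R * N + (t - p%:R * N) = t); last by ring.
    exact: schrodinger_time_shift.
  apply: sup_sqm_ub agm _.
  by rewrite ler_pdivlMr// in h1; rewrite ltr_pdivrMr// -natr1 mulrDl mul1r in h2; apply/andP; split; lra.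
by rewrite leeDl// sume_ge0// => j _; exact: sup_sqm_ge0.
Qed.

Lemma grid_round (N y : R) (A : nat) : 0 < N -> `|y| <= N * (A%:R - 1) ->
  exists2 p : nat, (p < A * 2)%N & `|y - N * (p%:Z - A%:Z)%:~R| <= N / 2.
Proof.
move=> N0; rewrite ler_norml => /andP[y1 y2].
have e1 : y / N <= A%:R - 1 by rewrite ler_pdivrMr// mulrC.
have e2 : - (A%:R - 1) <= y / N by rewrite ler_pdivlMr// mulNr mulrC.
(* The nearest integer to y / N is the integer part of y / N + 1/2; the shift by A
   makes it a natural number. *)
pose z := y / N + A%:R + 2^-1.
have z0 : 0 <= z by rewrite /z; lra.
have /andP[h1 h2] := truncn_itv z0; exists (Num.truncn z).
  by rewrite -(ltr_nat R); apply: le_lt_trans h1 _; rewrite natrM /z; lra.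
rewrite -natr1 in h2.
move: (Num.truncn z) h1 h2 => p h1 h2.
have -> : y - N * (p%:Z - A%:Z)%:~R = N * (z - p%:R - 2^-1).
  by rewrite intrB /z; field; rewrite gt_eqF.
rewrite normrM gtr0_norm// ler_wpM2l ?(ltW N0)//.
by rewrite ler_norml; apply/andP; split; lra.
Qed.

(** The points N k, k in Z^2, form a net whose cells have circumradius
    N / sqrt 2 < N, so finitely many balls of radius N cover the large ball. The
    translation by N k is a modulation by the frequency N k; the number of
    balls, hence lambda, does not enter the constant. *)
Lemma space_transference (N K lambda : R) : 1 <= N -> 0 <= K -> square_estimate N N K ->
  square_estimate N (lambda * N) (64 * piece_constant K).
Proof.
move=> N1 K0 hK g ag; have N0 : 0 < N by exact: lt_le_trans ltr01 N1.
have [mg _ _] := ag.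
(* The grid consists of the points N (p1 - A, p2 - A) with p1, p2 < m = 2 A,
   numbered as p1 * m + p2. *)
pose A := (Num.truncn `|lambda|).+2; pose m := (A * 2)%N.
have m0 : (0 < m)%N by [].
pose k1 (j : 'I_(m * m)) : int := ((j %/ m)%N%:Z - A%:Z)%R.
pose k2 (j : 'I_(m * m)) : int := ((j %% m)%N%:Z - A%:Z)%R.
have dist j j' : j != j' -> k1 j != k1 j' \/ k2 j != k2 j'.
  move=> jj; apply/orP; rewrite -negb_and; apply: contra jj => /andP[/eqP /addIr [e1] /eqP /addIr [e2]].
  by apply/eqP/val_inj; rewrite /= (divn_eq j m) (divn_eq j' m) e1 e2.
pose c (j : 'I_(m * m)) : R * R := (N * (k1 j)%:~R, N * (k2 j)%:~R).
pose q (j : 'I_(m * m)) := dot2 (c j).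
have mq j : measurable_fun setT (q j) by exact: measurable_dot2.
have Qp := piece_constant_ge0 K0.
have tp i s o : s = 1 \/ s = -1 -> transfers N q (piece_constant K) (piece i s o).
  move=> hs; apply: piece_transfers => // zeta h mh hoo hh.
  have le : (128 * N)^-1 <= pi / N.
    rewrite invfM ler_wpM2r ?invr_ge0 ?(ltW N0)//; have := pi_ge2 R; lra.
  apply: (bessel_space (c := zeta - piece_center i s (128 * N)^-1 o) N0 dist mh hoo).
  by move=> z /hh [h1 h2 _]; split; exact: le_trans le.
apply: (le_trans _ (annulus_transfers mq Qp tp ag)).
set D := eball2 0 N; have mD : measurable (D : set (measurableTypeR R * measurableTypeR R)) by exact: measurable_eball2.
set E := eball2 0 (lambda * N); have mE : measurable (E : set (measurableTypeR R * measurableTypeR R)) by exact: measurable_eball2.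
have am j : cmeas (modulate (q j) g) by case: (admissible_cisM (mq j) ag).
pose F j (y : R * R) := ((\1_D y)%:E * sup_sqm N (modulate (q j) g) y)%E.
have F0 j y : (0 <= F j y)%E by rewrite mule_ge0 ?sup_sqm_ge0// lee_fin.
have mF j : measurable_fun setT (F j).
  apply: emeasurable_funM; last exact: measurable_sup_sqm.
  by apply/measurable_EFinP; exact: measurable_indic.
have FE j : (\int[mu2]_(x in D) sup_sqm N (modulate (q j) g) x = \int[mu2]_x F j (x - c j)%R)%E.
  rewrite (@ge0_integral_shift2 _ (F j) (- c j) (mF j) (F0 j)) integral_mkcond.
  apply: eq_integral => x _; rewrite patchE /F indicE.
  by case: (_ \in _); rewrite /= ?mul1e ?mul0e.
under eq_bigr do rewrite FE.
have mFs j : measurable_fun setT (fun x : R * R => F j (x - c j)).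
  by apply: (measurableT_comp (mF j)); apply: measurable_addp.
rewrite -ge0_integral_sum//.
rewrite [leLHS]integral_mkcond; apply: (@ge0_le_integral _ _ _ mu2 setT measurableT).
- by move=> x _; rewrite patchE; case: ifP => // _; exact: sup_sqm_ge0.
- by apply/(measurable_restrictT _ mE); apply: (@measurable_funS _ _ _ _ setT) => //; exact: measurable_sup_sqm.
- by apply: emeasurable_sum => j; exact: mFs.
move=> x _; rewrite patchE; case: ifPn => [/set_mem|_]; last by apply: sume_ge0 => j _; exact: F0.
rewrite /E /eball2 /= subr0 => xE.
have n0 := enorm2_ge0 x; have nx := enorm2_sqr x.
have lN : lambda * N <= N * (A%:R - 1).
  rewrite mulrC ler_wpM2l ?(ltW N0)//; have /andP[_] := truncn_itv (normr_ge0 lambda).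
  rewrite /A -[(_.+2)%:R]natr1; have := ler_norm lambda; lra.
have rb (y : R) : y ^+ 2 <= enorm2 x ^+ 2 -> `|y| <= N * (A%:R - 1).
  move=> h; apply: le_trans lN; apply: le_trans (ltW xE).
  by rewrite -(ger0_norm n0) -ler_sqr ?nnegrE// !real_normK ?num_real.
have [p1 p1m r1] : exists2 p : nat, (p < m)%N & `|x.1 - N * (p%:Z - A%:Z)%:~R| <= N / 2.
  by apply: grid_round => //; apply: rb; rewrite nx /dot2 -!expr2 lerDl sqr_ge0.
have [p2 p2m r2] : exists2 p : nat, (p < m)%N & `|x.2 - N * (p%:Z - A%:Z)%:~R| <= N / 2.
  by apply: grid_round => //; apply: rb; rewrite nx /dot2 -!expr2 lerDr sqr_ge0.
have jlt : (p1 * m + p2 < m * m)%N.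
  by rewrite (leq_trans (n := p1.+1 * m))// ?leq_mul2r ?p1m ?orbT// mulSn addnC ltn_add2r.
pose j := Ordinal jlt.
have cE : c j = (N * (p1%:Z - A%:Z)%:~R, N * (p2%:Z - A%:Z)%:~R).
  by rewrite /c /k1 /k2 /= divnMDl// divn_small// addn0 modnMDl modn_small.
have Dx : D (x - c j).
  rewrite /D /eball2 /= subr0; have n1 := enorm2_ge0 (x - c j); have n2 := enorm2_sqr (x - c j).
  move: r1 r2 n2; rewrite cE /dot2 /= !ler_norml => /andP[a1 a2] /andP[a3 a4] n2.
  by rewrite ltNge; apply/negP => h; nra.
rewrite (bigD1 j)//=; apply: (@le_trans _ _ (F j (x - c j))); last by rewrite leeDl// sume_ge0// => i _; exact: F0.
rewrite /F indicE mem_set// mul1e /sup_sqm le_eqVlt; apply/orP; left; apply/eqP; congr ereal_sup.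
apply/seteqP; split => _ [k _ <-]; exists k => //=; rewrite -schrodinger_space_shift subrK//.
Qed.

End transference.

Lemma maximal_estimate_le (R : realType) (T r K K' : R) : K <= K' ->
  maximal_estimate T r K -> maximal_estimate T r K'.
Proof.
move=> KK h f fhat ft supp; apply: le_trans (h _ _ ft supp) _.
by rewrite lee_wpmul2r ?lee_fin// L2normE poweR_ge0.
Qed.

Theorem theorem1p1 (R : realType) (alpha : R) :
  (exists C : R, exists N0 : R,
    forall N : R, N0 <= N -> maximal_estimate N N (C * N `^ alpha)) ->
  exists C' : R, exists N1 : R, exists lambda1 : R,
    forall N lambda : R, N1 <= N -> lambda1 <= lambda ->
      maximal_estimate (N ^+ 2) N (C' * N `^ alpha) /\
      maximal_estimate N (lambda * N) (C' * N `^ alpha).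
Proof.
move=> [C [N0 hC]]; exists (`|C| * (64 ^+ 2 * pi / cos 1)), (Num.max 1 N0), 0.
move=> N lambda; rewrite ge_max => /andP[N1 NN0] _.
have N_ge0 : 0 <= N by exact: le_trans ler01 N1.
have c0 : 0 < cos 1 :> R := cos1_gt0 R.
have p0 : 0 <= pi :> R := pi_ge0 R.
set K := `|C| * N `^ alpha.
have K0 : 0 <= K by rewrite mulr_ge0 ?powR_ge0.
have hK : maximal_estimate N N K.
  apply: maximal_estimate_le (hC N NN0).
  by rewrite ler_wpM2r ?powR_ge0// ler_norm.
have hQ := maximal_square_estimate N_ge0 K0 hK.
set Q := (K * (2 * pi)) ^+ 2 in hQ.
have Q0 : 0 <= Q by exact: sqr_ge0.
set K' := _ * _ * N `^ alpha.
have K'E : K' = K * (64 ^+ 2 * pi / cos 1) by rewrite /K' /K mulrAC.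
have K'0 : 0 <= K' by rewrite K'E mulr_ge0// divr_ge0 ?(ltW c0)// mulr_ge0// sqr_ge0.
have QK : 64 * piece_constant Q <= (K' * pi) ^+ 2.
  rewrite K'E /piece_constant /Q le_eqVlt; apply/orP; left; apply/eqP.
  by field; rewrite gt_eqF.
split; apply: square_maximal_estimate QK _ => //.
- exact: sqr_ge0.
- exact: time_transference.
- exact: space_transference.
Qed.
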